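(* Let $m,n,d,K$ be positive integers, and let $p>n$ be a multiple of $n$. Let $Q$ be a noncommutative multilinear polynomial of degree $d$ in $m$ variables with coefficients in $M_n(\mathbb{C})$ such that $\|Q(\sigma)\|\le1$ for all $\sigma\in\{-1,1\}^m$. Let $\tau:=\max_{i=1,\dots,m}\mathrm{Inf}_iQ$, with $\tau>0$. Let $\mathcal{G}$ be a distribution on $M_n(\mathbb{C})$ such that $G\sim\mathcal{G}$ satisfies $\mathbb{E}G=0$ and $\mathbb{E}GG^*=I$, and assume $\|\mathbb{E}(GG^* )^K\|\le c_K$ for some $c_K\ge1$. Then $$\mathbb{E}_{G_i\sim\mathcal{G}\otimes I,\;H_i\sim\mathcal{H}_p}\frac1n\mathrm{Tr}\,|Q^{\iota}\{G_iH_i\}|^{2K}\le\mathbb{E}_{b_i\sim\mathcal{B}}\frac1n\mathrm{Tr}\,|Q\{b_i\}|^{2K}+K^3(2K-1)^{2dK}c_K^{d}\,n^{2K}\tau^{1/4}+O_{m,n}(p^{-1/2}K^2\tau^{-1/4}).$$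
   Context: A noncommutative multilinear polynomial of degree $d$ in $m$ variables is an expression $Q(X_1,\dots,X_m)=\sum_{S\subseteq\{1,\dots,m\}:|S|\le d}\widehat{Q}(S)\prod_{i\in S}X_i$, where $\widehat{Q}(S)\in M_n(\mathbb{C})$, the $X_i$ are noncommuting $n\times n$ matrix variables, and products are taken in increasing order of the index. Scalars are substituted as multiples of the identity, and $Q\{A_i\}$ denotes $Q(A_1,\dots,A_m)$. The $i$-th influence is $\mathrm{Inf}_iQ=\sum_{S\subseteq\{1,\dots,m\}:\,i\in S}\mathrm{Tr}(\widehat{Q}(S)\widehat{Q}(S)^* )$. For $A\in M_n(\mathbb{C})$, $\iota(A)=\begin{pmatrix}A&0\\0&0\end{pmatrix}\in M_p(\mathbb{C})$, and $Q^{\iota}(X_1,\dots,X_m)=\sum_{S}\iota(\widehat{Q}(S))\prod_{i\in S}X_i$ for $p\times p$ matrix variables $X_i$. $|A|=(AA^* )^{1/2}$; $\|A\|$ is the operator norm; $\mathrm{Tr}$ is the unnormalized trace. $b_i\sim\mathcal{B}$: $b_1,\dots,b_m$ are independent uniform on $\{-1,1\}$. $G_i\sim\mathcal{G}\otimes I$: $G_i=G_i'\otimes I_{p/n}\in M_p(\mathbb{C})$ with $G_1',\dots,G_m'$ i.i.d. of distribution $\mathcal{G}$. $H_i\sim\mathcal{H}_p$: $H_1,\dots,H_m$ are independent $p\times p$ Haar-distributed random unitary matrices. All these random variables are independent. $a\le O_c(b)$ means that $a\le C(c)b$ for a constant $C(c)>0$ depending on $c$. *)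

(* Defs.v *)
From HB Require Import structures.
From mathcomp Require Import all_boot all_order all_algebra.
From mathcomp Require Import complex.
From mathcomp Require mxtens.
From mathcomp Require Import all_classical all_reals all_analysis.

Set Implicit Arguments.
Unset Strict Implicit.
Unset Printing Implicit Defensive.

Import Order.TTheory GRing.Theory Num.Theory.
Import numFieldNormedType.Exports.

Local Open Scope classical_set_scope.
Local Open Scope ring_scope.
Local Open Scope sesquilinear_scope.

Section Matrices.
Variable R : realType.
Local Notation C := R[i].

Definition l2norm n (v : 'cV[C]_n) : R :=
  Num.sqrt (\sum_i complex.Re `|v i 0| ^+ 2).

Definition opnorm n (A : 'M[C]_n) : R :=
  sup [set l2norm (A *m v) | v in [set v : 'cV[C]_n | l2norm v <= 1]].

(* On R[i], 0 <= z entails that z is real, so psdmx A entails A^t* = A. *)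
Definition psdmx n (A : 'M[C]_n) : Prop :=
  forall v : 'cV[C]_n, 0 <= (v^t* *m A *m v) 0 0.

(* |A| = (A A^* )^(1/2), the positive semidefinite square root of A A^*;
   see absmxP. *)
Definition absmx n (A : 'M[C]_n) : 'M[C]_n :=
  xget 0 [set B | psdmx B /\ B *m B = A *m A^t*].

Lemma absmxP n (A : 'M[C]_n) :
  psdmx (absmx A) /\ absmx A *m absmx A = A *m A^t*.
Proof.
suff [B hB] : exists B : 'M[C]_n, psdmx B /\ B *m B = A *m A^t*.
  by rewrite /absmx; case: xgetP => [_ -> //|/(_ B)].
set M := A *m A^t*; set U := spectralmx M; set D := spectral_diag M.
have MC : M^t* = M by rewrite /M trmx_mul map_mxM /= trmxCK.
have uU : U \is unitarymx by exact: spectral_unitarymx.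
have eM : M = U^t* *m diag_mx D *m U.
  rewrite -invmx_unitary //; apply/orthomx_spectralP.
  by rewrite qualifE /= MC.
have eUM : diag_mx D = (U *m A) *m (U *m A)^t*.
  rewrite trmx_mul map_mxM /= !mulmxA -[U *m A *m _]mulmxA -/M eM !mulmxA.
  by rewrite (unitarymxP uU) mul1mx mulmxtVK.
have D0 i : 0 <= D 0 i.
  have /matrixP/(_ i i) := eUM; rewrite !mxE eqxx mulr1n => ->.
  by apply: sumr_ge0 => j _; rewrite !mxE -normCK exprn_ge0.
pose S := diag_mx (map_mx sqrtC D).
have SS : S *m S = diag_mx D.
  rewrite /S mulmx_diag; congr diag_mx; apply/rowP => i.
  by rewrite !mxE -expr2 sqrtCK.
exists (U^t* *m S *m U); split; last first.
  rewrite !mulmxA mulmxtVK // -[U^t* *m S *m S]mulmxA SS.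
  exact/esym.
move=> v; have -> : v^t* *m (U^t* *m S *m U) *m v = (U *m v)^t* *m S *m (U *m v).
  by rewrite trmx_mul map_mxM /= !mulmxA.
rewrite /S mul_mx_diag mxE; apply: sumr_ge0 => i _.
rewrite !mxE mulrAC [_^* * _]mulrC -normCK mulr_ge0 ?exprn_ge0 //.
by rewrite sqrtC_ge0.
Qed.

(* Tr |A|^r; this trace is real, so taking Re loses nothing. *)
Definition tr_abs_pow n (r : nat) (A : 'M[C]_n) : R :=
  complex.Re (\tr (absmx A ^+ r)).

(* The block matrix [A 0; 0 0] of size p, for n <= p. *)
Definition iotamx n p (A : 'M[C]_n) : 'M[C]_p :=
  conform_mx 0 (block_mx A 0 0 (0 : 'M[C]_(p - n))).

(* A (x) I_(p/n), of size p when n divides p. *)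
Definition tens_idmx n p (A : 'M[C]_n) : 'M[C]_p :=
  conform_mx 0 (mxtens.tensmx A (1%:M : 'M[C]_(p %/ n))).

End Matrices.

Section Polynomials.
Variable R : realType.
Local Notation C := R[i].

(* A noncommutative multilinear polynomial in m variables is given by its
   family of coefficients S |-> Q^(S). *)
Definition ncpoly m n := {set 'I_m} -> 'M[C]_n.

Definition ncdeg_le m n (d : nat) (Q : ncpoly m n) : Prop :=
  forall S : {set 'I_m}, (d < #|S|)%N -> Q S = 0.

(* \prod_(i in S) multiplies in increasing order of the index. *)
Definition nceval m n (Q : ncpoly m n) (X : 'I_m -> 'M[C]_n) : 'M[C]_n :=
  \sum_(S : {set 'I_m}) Q S *m \prod_(i in S) X i.

Definition ncpoly_iota m n p (Q : ncpoly m n) : ncpoly m p :=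
  fun S => iotamx p (Q S).

Definition influence m n (Q : ncpoly m n) (i : 'I_m) : R :=
  \sum_(S : {set 'I_m} | i \in S) complex.Re (\tr (Q S *m (Q S)^t*)).

Definition max_influence m n (Q : ncpoly m n) : R :=
  \big[Num.max/0]_(i < m) influence Q i.

(* Q(s) for s in {-1,1}^m, encoded by the booleans b i with s_i = (-1)^(b i). *)
Definition nceval_sign m n (Q : ncpoly m n) (b : {ffun 'I_m -> bool}) :
    'M[C]_n :=
  nceval Q (fun i => ((-1) ^+ b i)%:M).

Definition sign_mean m (f : {ffun 'I_m -> bool} -> R) : R :=
  (2 ^ m)%:R^-1 * \sum_(b : {ffun 'I_m -> bool}) f b.

End Polynomials.

HB.instance Definition _ (R : realType) := isPointed.Build R[i] 0.

(* M_n(C) with its Borel sigma-algebra, generated by the real and imaginary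
   parts of the entries. *)
Definition mx_cylinder (R : realType) (n : nat) : set (set 'M[R[i]]_n) :=
  [set A | exists i j, exists2 B : set R, measurable B &
     A = [set M : 'M[R[i]]_n | B (complex.Re (M i j))] \/
     A = [set M : 'M[R[i]]_n | B (complex.Im (M i j))]].

Definition borel_mx (R : realType) (n : nat) :=
  g_sigma_algebraType (@mx_cylinder R n).

HB.instance Definition _ (R : realType) (n : nat) :=
  Measurable.on (borel_mx R n).

Section RandomMatrices.
Variable R : realType.
Local Notation C := R[i].

Section Expectation.
Context (d : measure_display) (T : measurableType d) (P : probability T R).

Definition mx_integrable n (X : T -> 'M[C]_n) : Prop :=
  forall i j,
    P.-integrable setT (EFin \o (fun w => complex.Re (X w i j))) /\
    P.-integrable setT (EFin \o (fun w => complex.Im (X w i j))).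

Definition mx_mean n (X : T -> 'M[C]_n) : 'M[C]_n :=
  \matrix_(i, j) Complex (fine 'E_P[fun w => complex.Re (X w i j)])
                         (fine 'E_P[fun w => complex.Im (X w i j)]).

Definition mutually_independent (I : finType) (F : I -> set (set T)) : Prop :=
  forall (J : {set I}) (E : I -> set T), (forall i, i \in J -> F i (E i)) ->
    P (\bigcap_(i in [set` J]) E i) = (\prod_(i in J) P (E i))%E.

End Expectation.

Definition haar_unitary p (mu : probability (borel_mx R p) R) : Prop :=
  mu [set U : 'M[C]_p | U \is unitarymx] = 1%E /\
  forall (U : 'M[C]_p) (A : set (borel_mx R p)),
    U \is unitarymx -> measurable A ->
    mu [set V : 'M[C]_p | A (U *m V)] = mu A /\
    mu [set V : 'M[C]_p | A (V *m U)] = mu A.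

End RandomMatrices.

(* Main.v *)
Require Import Defs.
From HB Require Import structures.
From mathcomp Require Import all_boot all_order all_algebra fingroup perm.
From mathcomp Require Import complex ring lra.
From mathcomp Require Import all_classical all_reals all_analysis.
From mathcomp Require Import measurable_realfun.

Set Implicit Arguments.
Unset Strict Implicit.
Unset Printing Implicit Defensive.

Import Order.TTheory GRing.Theory Num.Theory.
Import numFieldNormedType.Exports.

Local Open Scope classical_set_scope.
Local Open Scope ring_scope.
Local Open Scope sesquilinear_scope.

(** Writing X_S for the word in the variables G_i H_i indexed by S, the left
    hand side is the expected trace of the K-th power of the sum over S, V of
    Q(S) (X_S X_V^* )_{11} Q(V)^*, where ( )_{11} is the upper left n x n block.
    Integrating out one Haar unitary at a time, from the largest index down,
    this block is within O(p^{-1/2}) of 0 if S <> V, and of a scalar a_S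
    depending only on the G_i if S = V.  Replacing it by a_S leaves the trace of
    (sum_S a_S W_S)^K with W_S = Q(S) Q(S)^*; tuples of pairwise disjoint sets
    have E prod a_S = 1 and the other ones contribute O(tau) by the influence
    bound.  Finally the trace of (sum_S W_S)^K is at most the Rademacher mean,
    by Parseval's identity and convexity of the trace of the K-th power.

    The error must not involve c_K, so only tuples of sets that are not all
    equal are replaced: some G_i then enters with an exponent strictly between
    0 and 2K, and its moment is o(c_K).  A constant tuple is bounded directly by
    c_K^d times a power of tau.  When K is large or tau is small compared with
    m and n, a term by term estimate suffices, so the constants of the
    replacement step have to be uniform only over finitely many K and d. *)

(** * Complex numbers, Frobenius norms and trace inequalities *)

(** The replacement error has the form B M p^(-1/2), with B depending on m, n, K only and M a bound
    for the expected product of the 2K word norms of a tuple. Hölder alone gives M = (n^K c_K)^d,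
    which must not multiply p^(-1/2). For the tuples that are replaced, M can be taken to be eps
    (n^K c_K)^d + L with L free of c_K. Put t = tau^(1/4) and let D be the number of tuples times
    n^(K d). If D t <= 1, the term by term estimate is of order t^2, and one factor t pays for D. If
    D t > 1, then eps is fixed beforehand so that B eps n^(K d) <= 1/D < t; the part with c_K is
    then at most c_K^d t and joins the tau^(1/4) term, and only B L p^(-1/2) is left. Degrees above
    m reduce to degree m, since a set of indices has at most m elements. *)

Section ComplexParts.
Variable R : rcfType.
Local Notation C := R[i].
Implicit Types z w : C.

Lemma cReD z w : complex.Re (z + w) = complex.Re z + complex.Re w.
Proof. by case: z w => [? ?] [? ?]. Qed.

Lemma cImD z w : complex.Im (z + w) = complex.Im z + complex.Im w.
Proof. by case: z w => [? ?] [? ?]. Qed.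

Lemma cReN z : complex.Re (- z) = - complex.Re z.
Proof. by case: z. Qed.

Lemma cImN z : complex.Im (- z) = - complex.Im z.
Proof. by case: z. Qed.

Lemma cReM z w : complex.Re (z * w) =
  complex.Re z * complex.Re w - complex.Im z * complex.Im w.
Proof. by case: z w => [? ?] [? ?]. Qed.

Lemma cImM z w : complex.Im (z * w) =
  complex.Re z * complex.Im w + complex.Im z * complex.Re w.
Proof. by case: z w => [? ?] [? ?]. Qed.

Lemma cRe_conj z : complex.Re (z^*) = complex.Re z.
Proof. by case: z. Qed.

Lemma cIm_conj z : complex.Im (z^*) = - complex.Im z.
Proof. by case: z. Qed.

Lemma cRe_sum (I : Type) (r : seq I) (P : pred I) (F : I -> C) :
  complex.Re (\sum_(i <- r | P i) F i) = \sum_(i <- r | P i) complex.Re (F i).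
Proof. by apply: (big_morph (@complex.Re R)) => //; exact: cReD. Qed.

Lemma cIm_sum (I : Type) (r : seq I) (P : pred I) (F : I -> C) :
  complex.Im (\sum_(i <- r | P i) F i) = \sum_(i <- r | P i) complex.Im (F i).
Proof. by apply: (big_morph (@complex.Im R)) => //; exact: cImD. Qed.

Definition nrm2 z : R := complex.Re z ^+ 2 + complex.Im z ^+ 2.

Definition cabs z : R := Num.sqrt (nrm2 z).

Lemma nrm2_ge0 z : 0 <= nrm2 z.
Proof. by rewrite addr_ge0 ?sqr_ge0. Qed.

Lemma nrm2M z w : nrm2 (z * w) = nrm2 z * nrm2 w.
Proof. by rewrite /nrm2 cReM cImM; ring. Qed.

Lemma nrm2N z : nrm2 (- z) = nrm2 z.
Proof. by rewrite /nrm2 cReN cImN !sqrrN. Qed.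

Lemma nrm2_conj z : nrm2 (z^*) = nrm2 z.
Proof. by rewrite /nrm2 cRe_conj cIm_conj sqrrN. Qed.

Lemma nrm20 : nrm2 0 = 0.
Proof. by rewrite /nrm2 /= expr0n /= addr0. Qed.

Lemma nrm2_real (x : R) : nrm2 x%:C%C = x ^+ 2.
Proof. by rewrite /nrm2 /= expr0n /= addr0. Qed.

Lemma mul_conj_nrm2 z : z * z^* = (nrm2 z)%:C%C.
Proof.
by case: z => a b; apply/eqP; rewrite eq_complex /nrm2 /=; apply/andP; split;
  apply/eqP; ring.
Qed.

Lemma cabs_ge0 z : 0 <= cabs z. Proof. exact: sqrtr_ge0. Qed.

Lemma sqr_cabs z : cabs z ^+ 2 = nrm2 z.
Proof. by rewrite sqr_sqrtr ?nrm2_ge0. Qed.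

Lemma cabsM z w : cabs (z * w) = cabs z * cabs w.
Proof. by rewrite /cabs nrm2M sqrtrM ?nrm2_ge0. Qed.

Lemma cabs0 : cabs 0 = 0. Proof. by rewrite /cabs nrm20 sqrtr0. Qed.

Lemma cabsN z : cabs (- z) = cabs z. Proof. by rewrite /cabs nrm2N. Qed.

Lemma cabs_conj z : cabs (z^*) = cabs z. Proof. by rewrite /cabs nrm2_conj. Qed.

Lemma cabs_real (x : R) : cabs x%:C%C = `|x|.
Proof. by rewrite /cabs nrm2_real sqrtr_sqr. Qed.

Lemma Re_le_cabs z : complex.Re z <= cabs z.
Proof.
apply: (le_trans (ler_norm _)); rewrite -sqrtr_sqr ler_sqrt ?nrm2_ge0 //.
by rewrite lerDl sqr_ge0.
Qed.

Lemma cabsD z w : cabs (z + w) <= cabs z + cabs w.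
Proof.
have h := Re_le_cabs (z * w^*).
rewrite cabsM cabs_conj cReM cRe_conj cIm_conj mulrN opprK in h.
rewrite -(ler_pXn2r (n := 2)) ?nnegrE ?addr_ge0 ?cabs_ge0 //.
rewrite sqrrD !sqr_cabs /nrm2 cReD cImD; lra.
Qed.

Lemma cabs_sum (I : Type) (r : seq I) (P : pred I) (F : I -> C) :
  cabs (\sum_(i <- r | P i) F i) <= \sum_(i <- r | P i) cabs (F i).
Proof.
elim/big_ind2: _ => [|x1 x2 y1 y2 h1 h2|//]; first by rewrite cabs0.
by apply: le_trans (cabsD _ _) _; rewrite lerD.
Qed.

Lemma CauchySchwarz_sum (I : finType) (x y : I -> R) :
  (\sum_i x i * y i) ^+ 2 <= (\sum_i x i ^+ 2) * (\sum_i y i ^+ 2).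
Proof.
have: 0 <= \sum_i \sum_j (x i * y j - x j * y i) ^+ 2.
  by apply: sumr_ge0 => i _; apply: sumr_ge0 => j _; rewrite sqr_ge0.
have -> : \sum_i \sum_j (x i * y j - x j * y i) ^+ 2 =
    (\sum_i x i ^+ 2) * (\sum_i y i ^+ 2) * 2 - (\sum_i x i * y i) ^+ 2 * 2.
  transitivity (\sum_i \sum_j (x i ^+ 2 * y j ^+ 2 + y i ^+ 2 * x j ^+ 2
      - (x i * y i) * (x j * y j) * 2)).
    by apply: eq_bigr => i _; apply: eq_bigr => j _; ring.
  under eq_bigr do rewrite sumrB big_split /= -!mulr_sumr -mulr_suml -mulr_sumr.
  rewrite sumrB big_split /= -!mulr_suml expr2; ring.
by lra.
Qed.

End ComplexParts.

Section Frobenius.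
Variable R : rcfType.
Local Notation C := R[i].

Definition fro2 m n (A : 'M[C]_(m, n)) : R := \sum_i \sum_j nrm2 (A i j).
Definition fro m n (A : 'M[C]_(m, n)) : R := Num.sqrt (fro2 A).

Lemma fro2_ge0 m n (A : 'M[C]_(m, n)) : 0 <= fro2 A.
Proof. by do 2![apply: sumr_ge0 => ? _]; exact: nrm2_ge0. Qed.

Lemma fro_ge0 m n (A : 'M[C]_(m, n)) : 0 <= fro A.
Proof. exact: sqrtr_ge0. Qed.

Lemma sqr_fro m n (A : 'M[C]_(m, n)) : fro A ^+ 2 = fro2 A.
Proof. by rewrite sqr_sqrtr ?fro2_ge0. Qed.

Lemma fro20 m n : fro2 (0 : 'M[C]_(m, n)) = 0.
Proof. by rewrite /fro2 !big1 // => i _; rewrite big1 // => j _; rewrite mxE nrm20. Qed.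

Lemma fro0 m n : fro (0 : 'M[C]_(m, n)) = 0.
Proof. by rewrite /fro fro20 sqrtr0. Qed.

Lemma fro2_adj m n (A : 'M[C]_(m, n)) : fro2 (A^t*) = fro2 A.
Proof.
rewrite /fro2 exchange_big /=; apply: eq_bigr => i _; apply: eq_bigr => j _.
by rewrite !mxE nrm2_conj.
Qed.

Lemma fro_adj m n (A : 'M[C]_(m, n)) : fro (A^t*) = fro A.
Proof. by rewrite /fro fro2_adj. Qed.

Lemma tr_mul_adj m n (A : 'M[C]_(m, n)) : \tr (A *m A^t*) = (fro2 A)%:C%C.
Proof.
rewrite /mxtrace /fro2 rmorph_sum /=; apply: eq_bigr => i _.
rewrite mxE rmorph_sum /=; apply: eq_bigr => j _.
by rewrite !mxE mul_conj_nrm2.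
Qed.

Lemma fro2_unitary m n (A : 'M[C]_(m, n)) (U : 'M[C]_n) :
  U \is unitarymx -> fro2 (A *m U) = fro2 A.
Proof.
move=> uU; apply: (@complexI R); rewrite -!tr_mul_adj.
by rewrite trmx_mul map_mxM /= !mulmxA mulmxtVK.
Qed.

Lemma fro_unitary m n (A : 'M[C]_(m, n)) (U : 'M[C]_n) :
  U \is unitarymx -> fro (A *m U) = fro A.
Proof. by move=> uU; rewrite /fro fro2_unitary. Qed.

Lemma fro2_mul m n p (A : 'M[C]_(m, n)) (B : 'M[C]_(n, p)) :
  fro2 (A *m B) <= fro2 A * fro2 B.
Proof.
rewrite /fro2 mulr_suml; apply: ler_sum => i _.
rewrite [X in _ * X]exchange_big mulr_sumr /=; apply: ler_sum => k _.
rewrite mxE -sqr_cabs.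
apply: (@le_trans _ _ ((\sum_j cabs (A i j) * cabs (B j k)) ^+ 2)).
  rewrite ler_pXn2r ?nnegrE ?cabs_ge0 ?sumr_ge0 // => [|j _].
    by apply: le_trans (cabs_sum _ _ _) _; under eq_bigr do rewrite cabsM.
  by rewrite mulr_ge0 ?cabs_ge0.
apply: le_trans (CauchySchwarz_sum _ _) _.
by rewrite le_eqVlt; apply/orP; left; apply/eqP; congr (_ * _);
   apply: eq_bigr => j _; rewrite sqr_cabs.
Qed.

Lemma fro_mul m n p (A : 'M[C]_(m, n)) (B : 'M[C]_(n, p)) :
  fro (A *m B) <= fro A * fro B.
Proof. by rewrite /fro -sqrtrM ?fro2_ge0 // ler_sqrt ?mulr_ge0 ?fro2_ge0 ?fro2_mul. Qed.

Lemma cabs_le_fro m n (A : 'M[C]_(m, n)) i j : cabs (A i j) <= fro A.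
Proof.
rewrite /cabs /fro ler_sqrt ?fro2_ge0 // /fro2 (bigD1 i) //= (bigD1 j) //=.
rewrite -addrA lerDl addr_ge0 ?sumr_ge0 // => *; rewrite ?sumr_ge0 //.
  exact: nrm2_ge0.
by move=> *; exact: nrm2_ge0.
Qed.

Lemma fro_le_sum_cabs m n (A : 'M[C]_(m, n)) : fro A <= \sum_i \sum_j cabs (A i j).
Proof.
have s0 : 0 <= \sum_i \sum_j cabs (A i j).
  by do 2![apply: sumr_ge0 => ? _]; exact: cabs_ge0.
rewrite -(ler_pXn2r (n := 2)) ?nnegrE ?fro_ge0 // sqr_fro /fro2.
rewrite expr2 mulr_suml; apply: ler_sum => i _.
rewrite mulr_suml; apply: ler_sum => j _.
rewrite -sqr_cabs expr2 ler_wpM2l ?cabs_ge0 // (bigD1 i) //= (bigD1 j) //=.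
rewrite -addrA lerDl addr_ge0 ?sumr_ge0 // => *; rewrite ?sumr_ge0 //.
  exact: cabs_ge0.
by move=> *; exact: cabs_ge0.
Qed.

Lemma fro_mxE m n (A : 'M[C]_(m, n)) :
  fro2 A = \sum_(ij : 'I_m * 'I_n) cabs (A ij.1 ij.2) ^+ 2.
Proof.
rewrite /fro2 pair_big; apply: eq_bigr => -[i j] _ /=; by rewrite sqr_cabs.
Qed.

Lemma froD m n (A B : 'M[C]_(m, n)) : fro (A + B) <= fro A + fro B.
Proof.
rewrite -(ler_pXn2r (n := 2)) ?nnegrE ?addr_ge0 ?fro_ge0 //.
rewrite sqrrD !sqr_fro !fro_mxE.
set x := fun ij : 'I_m * 'I_n => cabs (A ij.1 ij.2).
set y := fun ij : 'I_m * 'I_n => cabs (B ij.1 ij.2).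
have xy : \sum_ij x ij * y ij <= fro A * fro B.
  apply: le_trans (ler_norm _) _.
  rewrite -(ler_pXn2r (n := 2)) ?nnegrE ?mulr_ge0 ?fro_ge0 ?normr_ge0 //.
  rewrite real_normK ?num_real // exprMn !sqr_fro !fro_mxE.
  exact: CauchySchwarz_sum.
apply: (@le_trans _ _ (\sum_ij (x ij ^+ 2 + (x ij * y ij) *+ 2 + y ij ^+ 2))).
  apply: ler_sum => -[i j] _ /=; rewrite mxE -sqrrD.
  by rewrite ler_pXn2r ?nnegrE ?addr_ge0 ?cabs_ge0 // cabsD.
by rewrite !big_split /= -/(x _); lra.
Qed.

Lemma froZ m n (a : R) (A : 'M[C]_(m, n)) : fro (a%:C%C *: A) = `|a| * fro A.
Proof.
rewrite /fro -sqrtr_sqr -sqrtrM ?sqr_ge0 // /fro2 mulr_sumr; congr Num.sqrt.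
apply: eq_bigr => i _; rewrite mulr_sumr; apply: eq_bigr => j _.
by rewrite mxE nrm2M nrm2_real.
Qed.

Lemma cabs_tr n (A : 'M[C]_n) : cabs (\tr A) <= n%:R * fro A.
Proof.
apply: le_trans (cabs_sum _ _ _) _.
apply: (@le_trans _ _ (\sum_(i < n) fro A)).
  by apply: ler_sum => i _; exact: cabs_le_fro.
by rewrite sumr_const card_ord mulr_natl.
Qed.

Lemma fro_prod k n (I : Type) (r : seq I) (A : I -> 'M[C]_n) (a : I -> R)
    (B : 'M[C]_(k, n)) (b : R) :
  fro B <= b -> (forall i, fro (A i) <= a i) ->
  fro (B *m \prod_(i <- r) A i) <= b * \prod_(i <- r) a i.
Proof.
move=> hB hA; elim: r B b hB => [|i r IH] B b hB.
  by rewrite !big_nil mulmx1 mulr1.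
rewrite !big_cons mulmxA mulrA; apply: IH.
apply: le_trans (fro_mul _ _) _.
by rewrite ler_pM ?fro_ge0.
Qed.

End Frobenius.

Section Spectral.
Variable R : rcfType.
Local Notation C := R[i].

(** The tangent at [x] of the convex function [y ^+ K.+1] lies below its graph. In the induction,
    the case [K] is multiplied by [y] and the difference is a multiple of [(x - y) ^+ 2]. *)
Lemma young_pow (K : nat) (x y : R) : 0 <= x -> 0 <= y ->
  K.+1%:R * x ^+ K * y <= K%:R * x ^+ K.+1 + y ^+ K.+1.
Proof.
move=> x0 y0; elim: K => [|K IH]; first by rewrite expr0 !mul1r mul0r add0r expr1.
have h1 := ler_wpM2r y0 IH.
have h2 : 0 <= K.+1%:R * x ^+ K * (x - y) ^+ 2.
  by rewrite mulr_ge0 ?sqr_ge0 // mulr_ge0 ?exprn_ge0.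
rewrite -subr_ge0; set RHS := (X in 0 <= X).
have -> : RHS = (K%:R * x ^+ K.+1 + y ^+ K.+1) * y - K.+1%:R * x ^+ K * y * y
   + K.+1%:R * x ^+ K * (x - y) ^+ 2.
  rewrite /RHS -![K.+2%:R]natr1 -![K.+1%:R]natr1 !exprS; ring.
by rewrite addr_ge0 // subr_ge0.
Qed.

(** Jensen's inequality for weights that need not sum to 1: [young_pow] is taken at the weighted
    mean [mu] and summed over the weights. *)
Lemma power_mean (I : finType) (K : nat) (p d : I -> R) :
  (forall i, 0 <= p i) -> (forall i, 0 <= d i) ->
  (\sum_i p i * d i) ^+ K.+1 <= (\sum_i p i) ^+ K * \sum_i p i * d i ^+ K.+1.
Proof.
move=> p0 d0; set P := \sum_i p i; set M := \sum_i p i * d i.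
have P0 : 0 <= P by exact: sumr_ge0.
have M0 : 0 <= M by apply: sumr_ge0 => i _; rewrite mulr_ge0.
have [PE|PN] := eqVneq P 0.
  have pz i : p i = 0.
    by have := psumr_eq0P (fun i _ => p0 i) PE; apply.
  have -> : M = 0 by rewrite /M big1 // => i _; rewrite pz mul0r.
  rewrite expr0n /= mulr_ge0 ?exprn_ge0 // sumr_ge0 // => i _.
  by rewrite mulr_ge0 // exprn_ge0.
pose mu := M / P.
have mu0 : 0 <= mu by rewrite divr_ge0.
have ME : M = mu * P by rewrite /mu divfK.
have h : K.+1%:R * mu ^+ K * M <= K%:R * mu ^+ K.+1 * P + \sum_i p i * d i ^+ K.+1.
  rewrite /M /P !mulr_sumr -big_split /=; apply: ler_sum => i _.
  have := ler_wpM2l (p0 i) (young_pow K mu0 (d0 i)).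
  set a := (_ ^+ K.+1); set b := (_ ^+ K.+1); set c := (_ ^+ K).
  by rewrite mulrDr [p i * (_ * d i)]mulrCA [p i * (K%:R * a)]mulrC.
have h2 : mu ^+ K.+1 * P <= \sum_i p i * d i ^+ K.+1.
  move: h; rewrite ME -natr1 exprSr; lra.
by rewrite ME exprMn [P ^+ K.+1]exprSr mulrCA ler_wpM2l ?exprn_ge0.
Qed.

(** Self-adjointness is built in and row vectors are used, to fit the spectral theorem and the
    products [V *m A *m V^t*] below. *)
Definition psd n (A : 'M[C]_n) : Prop :=
  A^t* = A /\ forall v : 'rV[C]_n, 0 <= complex.Re ((v *m A *m v^t*) 0 0).

Lemma psd_mul_adj n k (P : 'M[C]_(n, k)) : psd (P *m P^t*).
Proof.
split; first by rewrite trmx_mul map_mxM /= trmxCK.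
move=> v; have -> : v *m (P *m P^t*) *m v^t* = (v *m P) *m (v *m P)^t*.
  by rewrite trmx_mul map_mxM /= !mulmxA.
have := tr_mul_adj (v *m P); rewrite /mxtrace big_ord1 => -> /=.
exact: fro2_ge0.
Qed.

Lemma psd0 n : psd (0 : 'M[C]_n).
Proof.
split; first by apply/matrixP => i j; rewrite !mxE conjC0.
by move=> v; rewrite mulmx0 mul0mx mxE.
Qed.

Lemma psdD n (A B : 'M[C]_n) : psd A -> psd B -> psd (A + B).
Proof.
move=> [hA pA] [hB pB]; split; first by rewrite linearD /= map_mxD hA hB.
by move=> v; rewrite mulmxDr mulmxDl mxE cReD addr_ge0.
Qed.

Lemma psd_sum n (I : Type) (r : seq I) (P : pred I) (A : I -> 'M[C]_n) :
  (forall i, psd (A i)) -> psd (\sum_(i <- r | P i) A i).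
Proof. by move=> h; apply: big_ind => [|B D|i _]; [exact: psd0|exact: psdD|exact: h]. Qed.

Lemma psd_spectral n (A : 'M[C]_n) : psd A ->
  exists (U : 'M[C]_n) (d : 'I_n -> R), [/\ U \is unitarymx, forall i, 0 <= d i
    & A = U^t* *m diag_mx (\row_i (d i)%:C%C) *m U].
Proof.
move=> [hA pA]; set U := spectralmx A; set D := spectral_diag A.
have uU : U \is unitarymx by exact: spectral_unitarymx.
have eA : A = U^t* *m diag_mx D *m U.
  rewrite -invmx_unitary //; apply/orthomx_spectralP.
  by rewrite qualifE /= hA.
have eD : diag_mx D = U *m A *m U^t*.
  by rewrite {1}eA !mulmxA mulmxtVK // (unitarymxP uU) mul1mx.
have DE i : D 0 i = (row i U *m A *m (row i U)^t*) 0 0.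
  have /matrixP/(_ i i) := eD; rewrite !mxE eqxx mulr1n => ->.
  apply: eq_bigr => j _; rewrite !mxE; congr (_ * _).
  by apply: eq_bigr => k _; rewrite !mxE.
have Dc i : (D 0 i)^* = D 0 i.
  have h : (diag_mx D)^t* = diag_mx D.
    by rewrite eD !trmx_mul !map_mxM /= trmxCK hA mulmxA.
  by have /matrixP/(_ i i) := h; rewrite !mxE eqxx !mulr1n.
exists U, (fun i => complex.Re (D 0 i)); split; first exact: uU.
  by move=> i; rewrite DE; exact: pA.
suff -> : \row_i (complex.Re (D 0 i))%:C%C = D by exact: eA.
apply/rowP => i; rewrite mxE.
move: (Dc i); case: (D 0 i) => a b [] /= h.
by apply/eqP; rewrite eq_complex /= eqxx /=; apply/eqP; lra.
Qed.

Lemma spectral_exp n (U : 'M[C]_n) (d : 'I_n -> R) K : U \is unitarymx ->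
  (U^t* *m diag_mx (\row_i (d i)%:C%C) *m U) ^+ K =
  U^t* *m diag_mx (\row_i (d i ^+ K)%:C%C) *m U.
Proof.
move=> uU; have uUt : U^t* *m U = 1%:M.
  by rewrite -{2}[U]trmxCK; apply/unitarymxP; rewrite trmxC_unitary.
elim: K => [|K IH].
  rewrite expr0 (_ : diag_mx _ = 1%:M) ?mulmx1 ?uUt //.
  by apply/matrixP => i j; rewrite !mxE.
transitivity ((U^t* *m diag_mx (\row_i (d i)%:C%C) *m U) *m
    (U^t* *m diag_mx (\row_i (d i ^+ K)%:C%C) *m U)); first by rewrite -IH; exact: exprS.
rewrite !mulmxA -(mulmxA _ U) (unitarymxP uU) mulmx1 -(mulmxA (U^t*)) mulmx_diag.
congr (_ *m diag_mx _ *m _).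
by apply/rowP => i; rewrite !mxE exprS rmorphM.
Qed.

Lemma Re_tr_diag k n (M : 'M[C]_(k, n)) (d : 'I_n -> R) :
  complex.Re (\tr (M *m diag_mx (\row_i (d i)%:C%C) *m M^t*)) =
  \sum_i (\sum_j nrm2 (M j i)) * d i.
Proof.
rewrite /mxtrace cRe_sum.
under eq_bigr do rewrite mul_mx_diag mxE cRe_sum.
rewrite exchange_big /=; apply: eq_bigr => i _; rewrite mulr_suml.
apply: eq_bigr => j _; rewrite !mxE mulrAC mul_conj_nrm2 -rmorphM /=.
by [].
Qed.

Lemma Re_tr_spectral k n (V : 'M[C]_(k, n)) (U : 'M[C]_n) (d : 'I_n -> R) :
  complex.Re (\tr (V *m (U^t* *m diag_mx (\row_i (d i)%:C%C) *m U) *m V^t*)) =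
  \sum_i (\sum_j nrm2 ((V *m U^t*) j i)) * d i.
Proof.
rewrite -Re_tr_diag; congr (complex.Re (\tr _)).
by rewrite trmx_mul map_mxM /= trmxCK !mulmxA.
Qed.

(** In an eigenbasis of [A], the rows of [V] define a measure of total mass [fro2 V] on the
    spectrum, and both traces are integrals against it; the rest is [power_mean]. *)
Lemma trace_Jensen k n K (V : 'M[C]_(k, n)) (A : 'M[C]_n) : psd A ->
  complex.Re (\tr (V *m A *m V^t*)) ^+ K.+1 <=
  fro2 V ^+ K * complex.Re (\tr (V *m A ^+ K.+1 *m V^t*)).
Proof.
move=> pA; have [U [d [uU d0 eA]]] := psd_spectral pA.
have eK : A ^+ K.+1 = U^t* *m diag_mx (\row_i (d i ^+ K.+1)%:C%C) *m U.
  by rewrite eA; exact: spectral_exp.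
have -> : complex.Re (\tr (V *m A *m V^t*)) = \sum_i (\sum_j nrm2 ((V *m U^t*) j i)) * d i.
  by rewrite eA; exact: Re_tr_spectral.
have -> : complex.Re (\tr (V *m A ^+ K.+1 *m V^t*)) =
    \sum_i (\sum_j nrm2 ((V *m U^t*) j i)) * d i ^+ K.+1.
  by rewrite eK; exact: (Re_tr_spectral V U (fun i => d i ^+ K.+1)).
have -> : fro2 V = \sum_i \sum_j nrm2 ((V *m U^t*) j i).
  have uUt : U^t* \is unitarymx by rewrite trmxC_unitary.
  by rewrite -(fro2_unitary V uUt) /fro2 exchange_big.
by apply: power_mean => // i; apply: sumr_ge0 => j _; exact: nrm2_ge0.
Qed.

Lemma tr_conj_unitary n (U A : 'M[C]_n) : U \is unitarymx ->
  \tr (U *m A *m U^t*) = \tr A.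
Proof.
move=> uU; have uUt : U^t* *m U = 1%:M.
  by rewrite -{2}[U]trmxCK; apply/unitarymxP; rewrite trmxC_unitary.
by rewrite mxtrace_mulC mulmxA uUt mul1mx.
Qed.

Lemma Re_diag_psd n (U A : 'M[C]_n) i : psd A -> 0 <= complex.Re ((U *m A *m U^t*) i i).
Proof.
move=> [_ /(_ (row i U))]; rewrite -row_mul; congr (0 <= complex.Re _).
by rewrite !mxE; apply: eq_bigr => j _; rewrite !mxE.
Qed.

(** In any orthonormal basis a diagonal entry of [A] is a mean of its eigenvalues with weights of
    sum 1, so its power is at most the diagonal entry of the power. Both trace inequalities below
    rest on this. *)
Lemma Peierls n K (U A : 'M[C]_n) : U \is unitarymx -> psd A ->
  \sum_i complex.Re ((U *m A *m U^t*) i i) ^+ K.+1 <= complex.Re (\tr (A ^+ K.+1)).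
Proof.
move=> uU pA; rewrite -(tr_conj_unitary _ uU) /mxtrace cRe_sum.
apply: ler_sum => i _.
have rowE (B : 'M[C]_n) : (U *m B *m U^t*) i i = \tr (row i U *m B *m (row i U)^t*).
  rewrite /mxtrace big_ord1 -row_mul !mxE.
  by apply: eq_bigr => j _; rewrite !mxE.
rewrite !rowE; apply: le_trans (trace_Jensen _ _ pA) _.
have -> : fro2 (row i U) = 1.
  apply: (@complexI R); rewrite -tr_mul_adj.
  have := rowE 1%:M; rewrite !mulmx1 => <-.
  by rewrite (unitarymxP uU) mxE eqxx.
by rewrite expr1n mul1r.
Qed.

(** Higher powers are not operator monotone, but their traces are: in the eigenbasis of [B], the
    eigenvalues of [B] are below the diagonal entries of [A], to which [Peierls] applies. *)
Lemma tr_exp_mono n K (A B : 'M[C]_n) : psd A -> psd B -> psd (A - B) ->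
  complex.Re (\tr (B ^+ K.+1)) <= complex.Re (\tr (A ^+ K.+1)).
Proof.
move=> pA pB pAB; have [U [d [uU d0 eB]]] := psd_spectral pB.
apply: le_trans (Peierls K uU pA).
have dE i : d i = complex.Re ((U *m B *m U^t*) i i).
  by rewrite eB !mulmxA mulmxtVK // (unitarymxP uU) mul1mx !mxE eqxx.
rewrite {1}eB spectral_exp // -(tr_conj_unitary _ uU).
rewrite !mulmxA mulmxtVK // (unitarymxP uU) mul1mx /mxtrace cRe_sum.
apply: ler_sum => i _; rewrite [diag_mx _ i i]mxE [X in X *+ _]mxE eqxx mulr1n /=.
have hd : d i <= complex.Re ((U *m A *m U^t*) i i).
  have := Re_diag_psd U i pAB.
  by rewrite mulmxBr mulmxBl mxE [X in _ + X]mxE cReD cReN subr_ge0 -dE.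
by rewrite lerXn2r ?nnegrE // (le_trans (d0 i) hd).
Qed.

(** In the eigenbasis of [B], scalar convexity handles the diagonal entries, and [Peierls] each
    [A i]. *)
Lemma tr_exp_convex n K (I : finType) (c : I -> R) (A : I -> 'M[C]_n) (B : 'M[C]_n) :
  (forall i, 0 <= c i) -> \sum_i c i = 1 -> (forall i, psd (A i)) -> psd B ->
  B = \sum_i (c i)%:C%C *: A i ->
  complex.Re (\tr (B ^+ K.+1)) <= \sum_i c i * complex.Re (\tr (A i ^+ K.+1)).
Proof.
move=> c0 c1 pA pB BE; have [U [d [uU d0 eB]]] := psd_spectral pB.
have dE i : d i = \sum_k c k * complex.Re ((U *m A k *m U^t*) i i).
  transitivity (complex.Re ((U *m B *m U^t*) i i)).
    by rewrite eB !mulmxA mulmxtVK // (unitarymxP uU) mul1mx !mxE eqxx.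
  rewrite BE mulmx_sumr mulmx_suml summxE cRe_sum; apply: eq_bigr => k _.
  by rewrite -scalemxAr -scalemxAl mxE cReM /= mul0r subr0.
apply: (@le_trans _ _ (\sum_k c k * \sum_i complex.Re ((U *m A k *m U^t*) i i) ^+ K.+1)).
  rewrite {1}eB spectral_exp // -(tr_conj_unitary _ uU).
  rewrite !mulmxA mulmxtVK // (unitarymxP uU) mul1mx /mxtrace cRe_sum.
  under [X in _ <= X]eq_bigr do rewrite mulr_sumr.
  rewrite exchange_big /=; apply: ler_sum => i _.
  rewrite [diag_mx _ i i]mxE [X in X *+ _]mxE eqxx mulr1n /= dE.
  have := power_mean K c0 (fun k => Re_diag_psd U i (pA k)).
  by rewrite c1 expr1n mul1r.
by apply: ler_sum => k _; rewrite ler_wpM2l ?Peierls.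
Qed.

End Spectral.

(** * Freezing independent variables *)

Section IndependentPair.
Local Open Scope ereal_scope.
Context (R : realType) (d d1 d2 : measure_display) (T : measurableType d)
  (T1 : measurableType d1) (T2 : measurableType d2) (P : probability T R)
  (Y : {mfun T >-> T1}) (X : {mfun T >-> T2}).
Hypothesis indep : forall A B, measurable A -> measurable B ->
  P (Y @^-1` A `&` X @^-1` B) = P (Y @^-1` A) * P (X @^-1` B).

Let YXf (w : T) : T1 * T2 := (Y w, X w).
Let mYXf : measurable_fun setT YXf.
Proof. exact: measurable_fun_pair. Qed.
Let YX : {mfun T >-> (T1 * T2)%type} :=
  HB.pack YXf (isMeasurableFun.Build _ _ _ _ YXf mYXf).

(** By independence the joint law of [Y] and [X] is the product of their laws, so this is Tonelli's
    theorem. *)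
Lemma indep_fubini (f : T1 * T2 -> \bar R) :
  measurable_fun setT f -> (forall z, 0 <= f z) ->
  \int[P]_w f (Y w, X w) = \int[P]_w \int[distribution P X]_x f (Y w, x).
Proof.
move=> mf f0.
have -> : \int[P]_w f (Y w, X w) = \int[distribution P YX]_z f z.
  by rewrite ge0_integral_distribution.
have -> : \int[distribution P YX]_z f z =
    \int[(distribution P Y \x distribution P X)]_z f z.
  apply: eq_measure_integral => A mA _; apply/esym.
  exact: product_measure_unique.
rewrite fubini_tonelli1 // ge0_integral_distribution //.
- exact: measurable_fun_fubini_tonelli_F.
- by move=> w; apply: integral_ge0.
Qed.

Lemma measurable_indep_fubini (f : T1 * T2 -> \bar R) :
  measurable_fun setT f -> (forall z, 0 <= f z) ->
  measurable_fun setT (fun w : T => \int[distribution P X]_x f (Y w, x)).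
Proof.
move=> mf f0; apply: (@measurableT_comp _ _ _ _ _ _
  (fun y => \int[distribution P X]_x f (y, x))) => //.
exact: measurable_fun_fubini_tonelli_F.
Qed.

End IndependentPair.

Section IndependentPiSystem.
Local Open Scope ereal_scope.
Context (R : realType) (d : measure_display) (T : measurableType d)
  (P : probability T R).

(** As functions of [A] both sides are finite measures, and they agree on a pi-system that generates
    the sigma-algebra. *)
Lemma indep_g_sigma (Gs : set (set T)) (B : set T) : Gs `<=` measurable ->
  setI_closed Gs -> Gs setT -> measurable B ->
  (forall A, Gs A -> P (A `&` B) = P A * P B) ->
  forall A, <<s Gs >> A -> P (A `&` B) = P A * P B.
Proof.
move=> GsM GsI GsT mB indep A sA.
pose c := fine (P B).
have c0 : (0 <= c)%R by rewrite fine_ge0.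
have cE : c%:E = P B by rewrite fineK// fin_num_measure.
pose m1 := mrestr P mB.
pose m2 := mscale (NngNum c0) P.
have -> : P (A `&` B) = m1 A by [].
have -> : P A * P B = m2 A by rewrite -cE muleC.
apply: (@g_sigma_algebra_measure_unique _ R T Gs GsM (fun=> setT)) => //.
- by rewrite bigcup_const.
- by move=> C GC; rewrite [RHS]muleC; have := indep _ GC; rewrite -cE.
- move=> _; apply: (@le_lt_trans _ _ 1); last exact: ltry.
  exact: probability_le1 (measurableI _ _ measurableT mB).
Qed.

End IndependentPiSystem.

Section Freezing.
Context (R : realType) (d : measure_display) (T : measurableType d)
  (P : probability T R) (I : finType) (F : I -> set (set T)) (k0 : I).
Hypotheses (FM : forall k, F k `<=` measurable) (FT : forall k, F k setT)
  (FI : forall k, setI_closed (F k)) (indF : mutually_independent P F).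

(** It generates the sigma-algebra of all the families but [k0]. Mutual independence only speaks of
    such intersections, so independence from the generated sigma-algebra is derived through this
    pi-system. *)
Definition others_pi_system : set (set T) :=
  [set A | exists2 E : I -> set T, (forall k, F k (E k)) &
     A = \bigcap_(k in [set` [set~ k0]%SET]) E k].

Local Notation Gs := others_pi_system.

Lemma others_pi_system_measurable : Gs `<=` measurable.
Proof.
move=> _ [E FE ->]; apply: fin_bigcap_measurable => // k _.
exact: (FM (FE k)).
Qed.

Lemma others_pi_systemI : setI_closed Gs.
Proof.
move=> _ _ [E FE ->] [E' FE' ->]; exists (fun k => E k `&` E' k).
  by move=> k; exact: FI.
by rewrite bigcapI.
Qed.

Lemma others_pi_systemT : Gs setT.
Proof. by exists (fun=> setT) => //; apply/seteqP; split. Qed.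

Lemma others_pi_system_sub k A : k != k0 -> F k A -> Gs A.
Proof.
move=> kk0 FA; exists (fun l => if l == k then A else setT).
  by move=> l; case: eqP => [->|_].
apply/seteqP; split=> [x Ax l _|x /(_ k)]; first by case: eqP.
by rewrite eqxx => h; apply: h; rewrite /= !inE.
Qed.

Lemma others_pi_system_indep A B : Gs A -> F k0 B ->
  P (A `&` B) = (P A * P B)%E.
Proof.
move=> [E FE ->] FB.
pose E' k := if k == k0 then B else E k.
have FE' k : F k (E' k) by rewrite /E'; case: eqP => [->|_].
have -> : \bigcap_(k in [set` [set~ k0]%SET]) E k `&` B =
    \bigcap_(k in [set` [set: I]%SET]) E' k.
  apply/seteqP; split=> [x [Ex Bx] k _|x Ex].
    rewrite /E'; case: eqP => [//|/eqP kk0].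
    by apply: Ex; rewrite /= !inE.
  split=> [k|].
    move: (Ex k); rewrite /= !inE /E' => + kk0.
    by rewrite (negbTE kk0); exact.
  by have := Ex k0; rewrite /E' eqxx => h; apply: h; rewrite /= inE.
rewrite (indF (fun k _ => FE' k)) (indF (fun k _ => FE k)).
rewrite (bigD1 k0) ?inE //= /E' eqxx muleC; congr (_ * _)%E.
apply: eq_big => [k|k]; first by rewrite !inE.
by rewrite !inE /= => /negbTE ->.
Qed.

Local Notation T1 := (g_sigma_algebraType Gs).

Lemma measurable_others k (d' : measure_display) (E : measurableType d')
    (V : T1 -> E) : k != k0 -> (forall B, measurable B -> F k (V @^-1` B)) ->
  measurable_fun setT V.
Proof.
move=> kk0 FV _ B mB; rewrite setTI; apply: sub_sigma_algebra.
exact: others_pi_system_sub kk0 (FV _ mB).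
Qed.

(** The identity, seen as a random element of [T] with the coarser sigma-algebra of the other
    variables. It represents all of them at once, which reduces freezing to the case of two
    independent variables. *)
Let Yf (w : T) : T1 := w.
Let mYf : measurable_fun setT Yf.
Proof.
move=> _ A; rewrite setTI; apply: smallest_sub => //.
  exact: sigma_algebra_measurable.
exact: others_pi_system_measurable.
Qed.
Let Y : {mfun T >-> T1} := HB.pack Yf (isMeasurableFun.Build _ _ _ _ Yf mYf).

Lemma freezing (d' : measure_display) (E : measurableType d')
    (X : {mfun T >-> E}) (f : T1 * E -> \bar R) :
  (forall B, measurable B -> F k0 (X @^-1` B)) ->
  measurable_fun setT f -> (forall z, 0 <= f z)%E ->
  (\int[P]_w f (w, X w) = \int[P]_w \int[distribution P X]_x f (w, x))%E.
Proof.
move=> FX mf f0.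
apply: (@indep_fubini R _ _ _ T T1 E P Y X) => // A B mA mB.
apply: (@indep_g_sigma _ _ _ _ Gs) => //.
- exact: others_pi_system_measurable.
- exact: others_pi_systemI.
- exact: others_pi_systemT.
- exact: (FM (FX _ mB)).
- by move=> A' GA'; exact: others_pi_system_indep GA' (FX _ mB).
Qed.

Lemma measurable_freezing (d' : measure_display) (E : measurableType d')
    (X : {mfun T >-> E}) (f : T1 * E -> \bar R) :
  measurable_fun setT f -> (forall z, 0 <= f z)%E ->
  measurable_fun [set: T] (fun w => \int[distribution P X]_x f (w, x))%E.
Proof. exact: (@measurable_indep_fubini R _ _ _ T T1 E P Y X). Qed.

End Freezing.

(** * Tensoring with the identity *)

Section TensorIdentity.
Variables (R : realType) (n p : nat).
Hypothesis hdvd : (n %| p)%N.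
Local Notation C := R[i].
Local Notation q := (p %/ n)%N.

Fact tens_dim : (n * q = p)%N. Proof. by rewrite mulnC divnK. Qed.

Definition tens_idx (ab : 'I_n * 'I_q) : 'I_p :=
  cast_ord tens_dim (mxtens.mxtens_index ab).

Definition tens_unidx (x : 'I_p) : 'I_n * 'I_q :=
  mxtens.mxtens_unindex (cast_ord (esym tens_dim) x).

Lemma tens_idxK : cancel tens_idx tens_unidx.
Proof. by move=> ab; rewrite /tens_unidx /tens_idx cast_ordK mxtens.mxtens_indexK. Qed.

Lemma tens_unidxK : cancel tens_unidx tens_idx.
Proof. by move=> x; rewrite /tens_unidx /tens_idx mxtens.mxtens_unindexK cast_ordKV. Qed.

Lemma sum_tens_idx (V : nmodType) (F : 'I_p -> V) :
  \sum_x F x = \sum_b \sum_a F (tens_idx (a, b)).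
Proof.
rewrite exchange_big /= pair_big /=.
rewrite (reindex tens_idx) /=; first by apply: eq_bigr => -[a b].
by exists tens_unidx => ? _; rewrite (tens_idxK, tens_unidxK).
Qed.

Lemma tens_idmx_cast (A : 'M[C]_n) :
  tens_idmx p A = castmx (tens_dim, tens_dim) (mxtens.tensmx A 1%:M).
Proof. by rewrite /tens_idmx -(conform_castmx (tens_dim, tens_dim)) conform_mx_id. Qed.

Lemma tens_idmxE (A : 'M[C]_n) a b a' b' :
  tens_idmx p A (tens_idx (a, b)) (tens_idx (a', b')) = A a a' *+ (b == b').
Proof.
rewrite tens_idmx_cast castmxE /tens_idx !cast_ordK mxtens.tensmxE mxE.
by rewrite mulr_natr.
Qed.

Lemma tens_idmxM (A B : 'M[C]_n) :
  tens_idmx p (A *m B) = tens_idmx p A *m tens_idmx p B.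
Proof.
apply/matrixP => x y; rewrite -(tens_unidxK x) -(tens_unidxK y).
case: (tens_unidx x) (tens_unidx y) => [a b] [a' b'].
rewrite tens_idmxE !mxE sum_tens_idx (bigD1 b) //= [X in _ = _ + X]big1.
  rewrite addr0 -sumrMnl; apply: eq_bigr => c _.
  by rewrite !tens_idmxE eqxx mulr1n mulrnAr.
move=> c cb; rewrite big1 // => c' _.
by rewrite tens_idmxE eq_sym (negbTE cb) mul0r.
Qed.

Lemma tens_idmx_adj (A : 'M[C]_n) : tens_idmx p (A^t*) = (tens_idmx p A)^t*.
Proof.
apply/matrixP => x y; rewrite -(tens_unidxK x) -(tens_unidxK y).
case: (tens_unidx x) (tens_unidx y) => [a b] [a' b'].
rewrite mxE [in RHS]mxE !tens_idmxE !mxE eq_sym.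
by case: eqP => _; rewrite ?mulr1n // !mulr0n conjC0.
Qed.

Lemma tens_idmxX (A : 'M[C]_n) k : tens_idmx p (A ^+ k.+1) = tens_idmx p A ^+ k.+1.
Proof. by elim: k => [|k IH] //; rewrite exprS tens_idmxM IH [in RHS]exprS. Qed.

(** The columns whose second tensor index is [b]. Multiplication by [tens_idmx p A] acts on each
    slice as [A], so that questions of size [p] split into questions of size [n]. *)
Definition slice k (V : 'M[C]_(k, p)) (b : 'I_q) : 'M[C]_(k, n) :=
  \matrix_(i, a) V i (tens_idx (a, b)).

Lemma slice_mul k (V : 'M[C]_(k, p)) (A : 'M[C]_n) b :
  slice (V *m tens_idmx p A) b = slice V b *m A.
Proof.
apply/matrixP => i a; rewrite !mxE sum_tens_idx (bigD1 b) //= [X in _ + X]big1.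
  by rewrite addr0; apply: eq_bigr => a' _; rewrite tens_idmxE eqxx !mxE.
move=> b' bb'; rewrite big1 // => a' _; rewrite tens_idmxE (negbTE bb').
by rewrite mulr0.
Qed.

Lemma fro2_slice k (V : 'M[C]_(k, p)) : fro2 V = \sum_b fro2 (slice V b).
Proof.
rewrite /fro2 exchange_big /= sum_tens_idx; apply: eq_bigr => b _.
rewrite exchange_big /=; apply: eq_bigr => i _; apply: eq_bigr => a _.
by rewrite mxE.
Qed.

(** The factor is [fro2 A], smaller by [p %/ n] than [fro2 (tens_idmx p A)]. This is why the norm
    bounds on words are uniform in [p]. *)
Lemma fro2_mul_tens k (V : 'M[C]_(k, p)) (A : 'M[C]_n) :
  fro2 (V *m tens_idmx p A) <= fro2 V * fro2 A.
Proof.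
rewrite !fro2_slice mulr_suml; apply: ler_sum => b _.
by rewrite slice_mul fro2_mul.
Qed.

Lemma fro_mul_tens k (V : 'M[C]_(k, p)) (A : 'M[C]_n) :
  fro (V *m tens_idmx p A) <= fro V * fro A.
Proof.
by rewrite /fro -sqrtrM ?fro2_ge0 // ler_sqrt ?mulr_ge0 ?fro2_ge0 ?fro2_mul_tens.
Qed.

Lemma tr_mul_tens k (V : 'M[C]_(k, p)) (A : 'M[C]_n) :
  \tr (V *m tens_idmx p A *m (V^t* )) = \sum_b \tr (slice V b *m A *m (slice V b)^t*).
Proof.
rewrite /mxtrace exchange_big /=; apply: eq_bigr => i _.
rewrite mxE sum_tens_idx; apply: eq_bigr => b _.
rewrite mxE; apply: eq_bigr => a _.
have := congr1 (fun M : 'M[C]_(k, n) => M i a) (slice_mul V A b).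
by rewrite {1}/slice mxE => ->; rewrite !mxE.
Qed.

Lemma tr_tens (A : 'M[C]_n) : \tr (tens_idmx p A) = q%:R * \tr A.
Proof.
rewrite /mxtrace sum_tens_idx mulr_natl.
under eq_bigr do under eq_bigr do rewrite tens_idmxE eqxx.
by rewrite sumr_const card_ord.
Qed.

Lemma fro2_tens (A : 'M[C]_n) : fro2 (tens_idmx p A) = q%:R * fro2 A.
Proof.
apply: (@complexI R); rewrite rmorphM /= -!tr_mul_adj rmorph_nat -tens_idmx_adj -tens_idmxM.
exact: tr_tens.
Qed.

(** The first tensor index is the quotient of [x] by [q], hence 0 throughout the upper left block
    once [n <= q]. *)
Lemma tens_idx_val (x : 'I_p) : (n <= q)%N -> (x < n)%N ->
  exists (a : 'I_n) (b : 'I_q), [/\ x = tens_idx (a, b), a = 0 :> nat & b = x :> nat].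
Proof.
move=> nq xn; have xq : (x < q)%N by exact: leq_trans nq.
exists (tens_unidx x).1, (tens_unidx x).2; split.
- by rewrite -surjective_pairing tens_unidxK.
- by rewrite /= divn_small.
- by rewrite /= modn_small.
Qed.

End TensorIdentity.

(** * Measurability of matrix-valued maps *)

Section MeasurableMatrices.
Context (R : realType) (d : measure_display) (D : measurableType d).
Local Notation C := R[i].

Definition cmeas a b (u : D -> 'M[C]_(a, b)) : Prop := forall i j,
  measurable_fun setT (fun x => complex.Re (u x i j)) /\
  measurable_fun setT (fun x => complex.Im (u x i j)).

Lemma cmeas_cst a b (A : 'M[C]_(a, b)) : cmeas (fun=> A).
Proof. by move=> i j; split; exact: measurable_cst. Qed.

Lemma cmeasD a b (u v : D -> 'M[C]_(a, b)) : cmeas u -> cmeas v ->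
  cmeas (fun x => u x + v x).
Proof.
move=> mu mv i j; have [ru iu] := mu i j; have [rv iv] := mv i j; split.
  under eq_fun do rewrite mxE cReD; exact: measurable_funD.
under eq_fun do rewrite mxE cImD; exact: measurable_funD.
Qed.

Lemma cmeasN a b (u : D -> 'M[C]_(a, b)) : cmeas u -> cmeas (fun x => - u x).
Proof.
move=> mu i j; have [ru iu] := mu i j; split.
  under eq_fun do rewrite mxE cReN; exact: measurableT_comp.
under eq_fun do rewrite mxE cImN; exact: measurableT_comp.
Qed.

Lemma cmeasB a b (u v : D -> 'M[C]_(a, b)) : cmeas u -> cmeas v ->
  cmeas (fun x => u x - v x).
Proof. by move=> mu mv; apply: cmeasD => //; exact: cmeasN. Qed.

Lemma cmeas_mul a b c (u : D -> 'M[C]_(a, b)) (v : D -> 'M[C]_(b, c)) :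
  cmeas u -> cmeas v -> cmeas (fun x => u x *m v x).
Proof.
move=> mu mv i j; split.
  under eq_fun do rewrite mxE cRe_sum.
  apply: measurable_sum => k; under eq_fun do rewrite cReM.
  have [ru iu] := mu i k; have [rv iv] := mv k j.
  by apply: measurable_funB; exact: measurable_funM.
under eq_fun do rewrite mxE cIm_sum.
apply: measurable_sum => k; under eq_fun do rewrite cImM.
have [ru iu] := mu i k; have [rv iv] := mv k j.
by apply: measurable_funD; exact: measurable_funM.
Qed.

Lemma cmeas_adj a b (u : D -> 'M[C]_(a, b)) : cmeas u -> cmeas (fun x => (u x)^t*).
Proof.
move=> mu i j; have [ru iu] := mu j i; split.
  by under eq_fun do rewrite !mxE cRe_conj.
under eq_fun do rewrite !mxE cIm_conj; exact: measurableT_comp.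
Qed.

Lemma cmeas_prod a (I : Type) (r : seq I) (Q : pred I) (u : I -> D -> 'M[C]_a) :
  (forall i, cmeas (u i)) -> cmeas (fun x => \prod_(i <- r | Q i) u i x).
Proof.
move=> mu; elim: r => [|k r IH].
  by under eq_fun do rewrite big_nil; exact: cmeas_cst.
under eq_fun do rewrite big_cons.
by case: (Q k) => //; apply: (cmeas_mul (mu k)).
Qed.

Lemma cmeas_exp a k (u : D -> 'M[C]_a) : cmeas u -> cmeas (fun x => u x ^+ k).
Proof.
move=> mu; elim: k => [|k IH]; first by under eq_fun do rewrite expr0; exact: cmeas_cst.
by under eq_fun do rewrite exprS; exact: cmeas_mul.
Qed.

Lemma cmeas_sum a b (I : Type) (r : seq I) (Q : pred I) (u : I -> D -> 'M[C]_(a, b)) :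
  (forall i, cmeas (u i)) -> cmeas (fun x => \sum_(i <- r | Q i) u i x).
Proof.
move=> mu; elim: r => [|k r IH].
  by under eq_fun do rewrite big_nil; exact: cmeas_cst.
under eq_fun do rewrite big_cons.
by case: (Q k) => //; apply: (cmeasD (mu k)).
Qed.

Lemma cmeas_scale a b (f : D -> R) (u : D -> 'M[C]_(a, b)) :
  measurable_fun setT f -> cmeas u -> cmeas (fun x => (f x)%:C%C *: u x).
Proof.
move=> mf mu i j; have [ru iu] := mu i j; split.
  under eq_fun do rewrite mxE cReM /= mul0r subr0; exact: measurable_funM.
under eq_fun do rewrite mxE cImM /= mul0r addr0; exact: measurable_funM.
Qed.

Lemma cmeas_tens a p (u : D -> 'M[C]_a) : (a %| p)%N -> cmeas u ->
  cmeas (fun x => tens_idmx p (u x)).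
Proof.
move=> ap mu i j; rewrite -(tens_unidxK ap i) -(tens_unidxK ap j).
case: (tens_unidx ap i) (tens_unidx ap j) => [c b] [c' b'].
have [r s] := mu c c'.
under eq_fun do rewrite tens_idmxE.
under [X in _ /\ measurable_fun _ X]eq_fun do rewrite tens_idmxE.
by case: eqP => _ //; split; exact: measurable_cst.
Qed.

Lemma measurable_nrm2 a b (u : D -> 'M[C]_(a, b)) i j : cmeas u ->
  measurable_fun setT (fun x => nrm2 (u x i j)).
Proof.
by move=> mu; have [ru iu] := mu i j; apply: measurable_funD;
  apply: measurable_funX.
Qed.

Lemma measurable_fro2 a b (u : D -> 'M[C]_(a, b)) : cmeas u ->
  measurable_fun setT (fun x => fro2 (u x)).
Proof.
by move=> mu; do 2![apply: measurable_sum => ?]; exact: measurable_nrm2.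
Qed.

Lemma measurable_sqrt (f : D -> R) : measurable_fun setT f ->
  measurable_fun setT (fun x => Num.sqrt (f x)).
Proof.
move=> mf; apply: (@measurableT_comp _ _ _ _ _ _ (@Num.sqrt R)) => //.
by apply: continuous_measurable_fun; exact: sqrt_continuous.
Qed.

Lemma measurable_fro a b (u : D -> 'M[C]_(a, b)) : cmeas u ->
  measurable_fun setT (fun x => fro (u x)).
Proof. by move=> mu; apply/measurable_sqrt/measurable_fro2. Qed.

Lemma measurable_cabs a b (u : D -> 'M[C]_(a, b)) i j : cmeas u ->
  measurable_fun setT (fun x => cabs (u x i j)).
Proof. by move=> mu; apply/measurable_sqrt/measurable_nrm2. Qed.

Lemma measurable_Re_tr a (u : D -> 'M[C]_a) : cmeas u ->
  measurable_fun setT (fun x => complex.Re (\tr (u x))).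
Proof.
move=> mu; under eq_fun do rewrite /mxtrace cRe_sum.
by apply: measurable_sum => i; have [] := mu i i.
Qed.

Lemma measurable_cabs_tr a (u : D -> 'M[C]_a) : cmeas u ->
  measurable_fun setT (fun x => cabs (\tr (u x))).
Proof.
move=> mu; apply: measurable_sqrt; apply: measurable_funD;
  apply: measurable_funX; first exact: measurable_Re_tr.
under eq_fun do rewrite /mxtrace cIm_sum.
by apply: measurable_sum => i; have [] := mu i i.
Qed.

Lemma measurable_borel_mx a (u : D -> borel_mx R a) :
  measurable_fun setT u <-> cmeas u.
Proof.
split=> [mu i j|mu].
  split=> _ B mB; rewrite setTI.
    rewrite -[X in measurable X]setTI.
    apply: (mu measurableT [set M : 'M[C]_a | B (complex.Re (M i j))]).
    by apply: sub_sigma_algebra; exists i, j; exists B => //; left.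
  rewrite -[X in measurable X]setTI.
  apply: (mu measurableT [set M : 'M[C]_a | B (complex.Im (M i j))]).
  by apply: sub_sigma_algebra; exists i, j; exists B => //; right.
apply: (@measurability _ _ D (borel_mx R a) setT u (@mx_cylinder R a)) => //.
move=> _ [_ [i [j [B mB [->|->]]]] <-].
  by have [h _] := mu i j; exact: h.
by have [_ h] := mu i j; exact: h.
Qed.

End MeasurableMatrices.

(** * Expectations over the random matrices *)

Section PreimageSigma.
Context (d d' : measure_display) (T : measurableType d) (E : measurableType d')
  (f : {mfun T >-> E}).

Lemma g_sigma_algebra_preimage_measurable :
  g_sigma_algebra_preimage f `<=` @measurable d T.
Proof. by move=> _ [B mB <-]; exact: measurable_funPT. Qed.

Lemma g_sigma_algebra_preimageT : g_sigma_algebra_preimage f setT.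
Proof. by exists setT => //; rewrite setTI preimage_setT. Qed.

Lemma g_sigma_algebra_preimageI : setI_closed (g_sigma_algebra_preimage f).
Proof.
move=> _ _ [B mB <-] [B' mB' <-]; exists (B `&` B'); first exact: measurableI.
by rewrite !setTI preimage_setI.
Qed.

Lemma g_sigma_algebra_preimage_in B : measurable B ->
  g_sigma_algebra_preimage f (f @^-1` B).
Proof. by move=> mB; exists B => //; rewrite setTI. Qed.

End PreimageSigma.

Section Environment.
Context (R : realType) (m n p : nat).
Local Notation C := R[i].
Local Notation genv := ('I_m -> 'M[C]_n).
Local Notation henv := ('I_m -> 'M[C]_p).

(* Quantifying over all measurable substitutions keeps the notion stable when
   one of the arguments is frozen. *)
Definition env_measurable (Phi : genv -> henv -> R) : Prop :=
  forall (d : measure_display) (D : measurableType d)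
    (g : 'I_m -> D -> 'M[C]_n) (h : 'I_m -> D -> 'M[C]_p),
    (forall i, cmeas (g i)) -> (forall i, cmeas (h i)) ->
    measurable_fun setT (fun x => Phi (g ^~ x) (h ^~ x)).

Definition upd (k : nat) (f : 'I_m -> 'M[C]_k) (j : 'I_m) (x : 'M[C]_k) :=
  fun i => if i == j then x else f i.

Lemma upd_same k (f : 'I_m -> 'M[C]_k) j : upd f j (f j) = f.
Proof. by apply/funext => i; rewrite /upd; case: eqP => [->|]. Qed.

Lemma env_measurableM (Phi Psi : genv -> henv -> R) :
  env_measurable Phi -> env_measurable Psi ->
  env_measurable (fun g h => Phi g h * Psi g h).
Proof. by move=> mPhi mPsi d D g h mg mh; apply: measurable_funM; auto. Qed.

Lemma env_measurableD (Phi Psi : genv -> henv -> R) :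
  env_measurable Phi -> env_measurable Psi ->
  env_measurable (fun g h => Phi g h + Psi g h).
Proof. by move=> mPhi mPsi d D g h mg mh; apply: measurable_funD; auto. Qed.

Lemma env_measurable_cst (c : R) : env_measurable (fun _ _ => c).
Proof. by move=> d D g h mg mh; exact: measurable_cst. Qed.

Lemma env_measurableX k (Phi : genv -> henv -> R) : env_measurable Phi ->
  env_measurable (fun g h => Phi g h ^+ k).
Proof. by move=> mPhi d D g h mg mh; apply: measurable_funX; auto. Qed.

Lemma env_measurable_sum (I : Type) (r : seq I) (Q : pred I)
    (Phi : I -> genv -> henv -> R) : (forall i, env_measurable (Phi i)) ->
  env_measurable (fun g h => \sum_(i <- r | Q i) Phi i g h).
Proof.
move=> mPhi d D g h mg mh; elim: r => [|i r IH].
  by under eq_fun do rewrite big_nil; exact: measurable_cst.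
under eq_fun do rewrite big_cons.
by case: (Q i) => //; apply: measurable_funD => //; exact: mPhi.
Qed.

Lemma env_measurable_prod (I : Type) (r : seq I) (Q : pred I)
    (Phi : I -> genv -> henv -> R) : (forall i, env_measurable (Phi i)) ->
  env_measurable (fun g h => \prod_(i <- r | Q i) Phi i g h).
Proof.
move=> mPhi d D g h mg mh; elim: r => [|i r IH].
  by under eq_fun do rewrite big_nil; exact: measurable_cst.
under eq_fun do rewrite big_cons.
by case: (Q i) => //; apply: measurable_funM => //; exact: mPhi.
Qed.

End Environment.

Section EnvExpectation.
Context (R : realType) (m n p : nat) (disp : measure_display)
  (T : measurableType disp) (P : probability T R)
  (G : 'I_m -> {RV P >-> borel_mx R n}) (H : 'I_m -> {RV P >-> borel_mx R p}).
Hypothesis hH : forall i : 'I_m, haar_unitary (distribution P (H i)).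
Hypothesis hind : mutually_independent P (fun k : 'I_m + 'I_m =>
       match k with
       | inl i => g_sigma_algebra_preimage (G i)
       | inr i => g_sigma_algebra_preimage (H i)
       end).
Local Notation C := R[i].
Local Notation genv := ('I_m -> 'M[C]_n).
Local Notation henv := ('I_m -> 'M[C]_p).
Implicit Types Phi Psi : genv -> henv -> R.

(** An extended-real integral: for nonnegative integrands the rules below hold without any
    integrability, so finiteness of moments can be left to the final bounds. *)
Definition Ex Phi : \bar R :=
  (\int[P]_w (Phi (fun i => G i w) (fun i => H i w))%:E)%E.

Lemma Ex_measurable Phi : env_measurable Phi ->
  measurable_fun [set: T] (fun w => Phi (fun i => G i w) (fun i => H i w)).
Proof.
move=> mPhi; apply: (mPhi _ T (fun i w => G i w) (fun i w => H i w)) => i;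
  exact/measurable_borel_mx/measurable_funPT.
Qed.

Lemma ExD Phi Psi : env_measurable Phi -> env_measurable Psi ->
  (forall g h, 0 <= Phi g h) -> (forall g h, 0 <= Psi g h) ->
  Ex (fun g h => Phi g h + Psi g h) = (Ex Phi + Ex Psi)%E.
Proof.
move=> mPhi mPsi Phi0 Psi0; rewrite /Ex.
under eq_integral do rewrite EFinD.
by rewrite ge0_integralD //=; try (by move=> w _; rewrite lee_fin);
  exact/measurable_EFinP/Ex_measurable.
Qed.

Lemma ExZ (c : R) Phi : env_measurable Phi -> 0 <= c ->
  (forall g h, 0 <= Phi g h) ->
  Ex (fun g h => c * Phi g h) = (c%:E * Ex Phi)%E.
Proof.
move=> mPhi c0 Phi0; rewrite /Ex.
under eq_integral do rewrite EFinM.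
by rewrite ge0_integralZl_EFin //=; [move=> w _; rewrite lee_fin
  | exact/measurable_EFinP/Ex_measurable].
Qed.

Lemma Ex_cst (c : R) : Ex (fun _ _ => c) = c%:E.
Proof. by rewrite /Ex integral_cst //= probability_setT mule1. Qed.

Lemma Ex_sum (I : Type) (r : seq I) (Q : pred I) (Phi : I -> genv -> henv -> R) :
  (forall i, env_measurable (Phi i)) -> (forall i g h, 0 <= Phi i g h) ->
  Ex (fun g h => \sum_(i <- r | Q i) Phi i g h) = (\sum_(i <- r | Q i) Ex (Phi i))%E.
Proof.
move=> mPhi Phi0; elim: r => [|i r IH].
  rewrite big_nil -[0%E](Ex_cst 0); congr Ex.
  by apply/funext => g; apply/funext => h; rewrite big_nil.
rewrite big_cons -IH; case: ifP => Qi.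
  rewrite -ExD //; first by congr Ex; apply/funext => g; apply/funext => h;
    rewrite big_cons Qi.
    exact: env_measurable_sum.
  by move=> g h; apply: sumr_ge0 => j _.
by congr Ex; apply/funext => g; apply/funext => h; rewrite big_cons Qi.
Qed.

Lemma Ex_ge0 Phi : (forall g h, 0 <= Phi g h) -> (0 <= Ex Phi)%E.
Proof. by move=> Phi0; apply: integral_ge0 => w _; rewrite lee_fin. Qed.

Lemma measurable_unitary : measurable [set U : borel_mx R p | U \is unitarymx].
Proof.
have -> : [set U : borel_mx R p | U \is unitarymx] =
    (fun U : 'M[C]_p => fro2 (U *m U^t* - 1%:M)) @^-1` [set 0].
  apply/seteqP; split => U /=; first by move/unitarymxP ->; rewrite subrr fro20.
  move=> h0; apply/unitarymxP/eqP; rewrite -subr_eq0; apply/eqP.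
  apply/matrixP => i j; rewrite [RHS]mxE.
  have h1 := psumr_eq0P (fun i _ => sumr_ge0 _ (fun j _ => nrm2_ge0 _)) h0 (i := i) isT.
  have := psumr_eq0P (fun j _ => nrm2_ge0 _) h1 (i := j) isT.
  set z := (_ i j); move/eqP; rewrite paddr_eq0 ?sqr_ge0 // !sqrf_eq0.
  by move=> /andP[/eqP zr /eqP zi]; apply/eqP; rewrite eq_complex zr zi !eqxx.
rewrite -[X in measurable X]setTI; apply: measurable_fro2 => //.
apply: cmeasB; last exact: cmeas_cst.
have c : cmeas (fun U : borel_mx R p => U : 'M[C]_p) by exact/measurable_borel_mx.
by apply: cmeas_mul => //; exact: cmeas_adj.
Qed.

Lemma ae_unitary : {ae P, forall w, forall i, (H i w : 'M[C]_p) \is unitarymx}.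
Proof.
apply: filter_forall => i.
have [h1 _] := hH i.
exists (~` (H i @^-1` [set U : borel_mx R p | U \is unitarymx])); split => //.
- apply: measurableC; rewrite -[X in measurable X]setTI.
  exact: measurable_funPT measurableT _ measurable_unitary.
- rewrite probability_setC; last first.
    rewrite -[X in measurable X]setTI.
    exact: measurable_funPT measurableT _ measurable_unitary.
  by rewrite (_ : P _ = 1%E) ?subee.
Qed.

Lemma Ex_le Phi Psi : env_measurable Phi -> env_measurable Psi ->
  (forall g h, 0 <= Phi g h) -> (forall g h, 0 <= Psi g h) ->
  (forall g h, (forall i, h i \is unitarymx) -> Phi g h <= Psi g h) ->
  (Ex Phi <= Ex Psi)%E.
Proof.
move=> mPhi mPsi Phi0 Psi0 le; apply: ae_ge0_le_integral => //.
- by move=> w _; rewrite lee_fin.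
- exact/measurable_EFinP/Ex_measurable.
- by move=> w _; rewrite lee_fin.
- exact/measurable_EFinP/Ex_measurable.
- by apply: filterS ae_unitary => w uw _; rewrite lee_fin le.
Qed.

Let F (k : 'I_m + 'I_m) : set (set T) := match k with
       | inl i => g_sigma_algebra_preimage (G i)
       | inr i => g_sigma_algebra_preimage (H i)
       end.

Let FM k : F k `<=` measurable.
Proof. by case: k => i; exact: g_sigma_algebra_preimage_measurable. Qed.
Let FT k : F k setT.
Proof. by case: k => i; exact: g_sigma_algebra_preimageT. Qed.
Let FI k : setI_closed (F k).
Proof. by case: k => i; exact: g_sigma_algebra_preimageI. Qed.

Local Notation T1 k := (g_sigma_algebraType (others_pi_system F k)).

(** The [j]-th unitary becomes a separate argument. The first component then has to be measurable
    only for the sigma-algebra of the other variables, as [freezing] requires. *)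
Let fH j Phi (z : T1 (inr j) * borel_mx R p) : \bar R :=
  (Phi (fun i => G i z.1) (upd (fun i => H i z.1) j z.2))%:E.

Let mfH j Phi : env_measurable Phi -> measurable_fun setT (@fH j Phi).
Proof.
move=> mPhi; apply/measurable_EFinP.
apply: (mPhi _ (T1 (inr j) * borel_mx R p)%type (fun i z => G i z.1)
   (fun i z => upd (fun k => H k z.1) j z.2 i)) => i.
  apply/measurable_borel_mx.
  apply: (@measurableT_comp _ _ _ _ _ _ (G i : T1 (inr j) -> borel_mx R n)) => //.
  apply: (@measurable_others _ _ _ _ _ FT (inl i)) => //.
  exact: g_sigma_algebra_preimage_in.
rewrite /upd; case: eqP => ij; apply/measurable_borel_mx; first exact: measurable_snd.
apply: (@measurableT_comp _ _ _ _ _ _ (H i : T1 (inr j) -> borel_mx R p)) => //.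
apply: (@measurable_others _ _ _ _ _ FT (inr i)) => //.
  by apply/eqP => -[].
exact: g_sigma_algebra_preimage_in.
Qed.

Let fG j Phi (z : T1 (inl j) * borel_mx R n) : \bar R :=
  (Phi (upd (fun i => G i z.1) j z.2) (fun i => H i z.1))%:E.

Let mfG j Phi : env_measurable Phi -> measurable_fun setT (@fG j Phi).
Proof.
move=> mPhi; apply/measurable_EFinP.
apply: (mPhi _ (T1 (inl j) * borel_mx R n)%type
   (fun i z => upd (fun k => G k z.1) j z.2 i) (fun i z => H i z.1)) => i.
  rewrite /upd; case: eqP => ij; apply/measurable_borel_mx; first exact: measurable_snd.
  apply: (@measurableT_comp _ _ _ _ _ _ (G i : T1 (inl j) -> borel_mx R n)) => //.
  apply: (@measurable_others _ _ _ _ _ FT (inl i)) => //.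
    by apply/eqP => -[].
  exact: g_sigma_algebra_preimage_in.
apply/measurable_borel_mx.
apply: (@measurableT_comp _ _ _ _ _ _ (H i : T1 (inl j) -> borel_mx R p)) => //.
apply: (@measurable_others _ _ _ _ _ FT (inr i)) => //.
exact: g_sigma_algebra_preimage_in.
Qed.

Lemma Ex_freezeH_eq j Phi : env_measurable Phi -> (forall g h, 0 <= Phi g h) ->
  Ex Phi = (\int[P]_w \int[distribution P (H j)]_x
    (Phi (fun i => G i w) (upd (fun i => H i w) j x))%:E)%E.
Proof.
move=> mPhi Phi0.
rewrite -(@freezing R _ T P _ F (inr j) FM FT FI hind _ (borel_mx R p) (H j)
  (@fH j Phi)).
- by apply: eq_integral => w _; rewrite /fH /= upd_same.
- exact: g_sigma_algebra_preimage_in.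
- exact: mfH.
- by move=> z; rewrite lee_fin.
Qed.

Lemma Ex_freezeG_eq j Phi : env_measurable Phi -> (forall g h, 0 <= Phi g h) ->
  Ex Phi = (\int[P]_w \int[distribution P (G j)]_x
    (Phi (upd (fun i => G i w) j x) (fun i => H i w))%:E)%E.
Proof.
move=> mPhi Phi0.
rewrite -(@freezing R _ T P _ F (inl j) FM FT FI hind _ (borel_mx R n) (G j)
  (@fG j Phi)).
- by apply: eq_integral => w _; rewrite /fG /= upd_same.
- exact: g_sigma_algebra_preimage_in.
- exact: mfG.
- by move=> z; rewrite lee_fin.
Qed.

Lemma Ex_freezeH j Phi Psi : env_measurable Phi -> env_measurable Psi ->
  (forall g h, 0 <= Phi g h) -> (forall g h, 0 <= Psi g h) ->
  (forall g h, (forall i, h i \is unitarymx) ->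
    (\int[distribution P (H j)]_x (Phi g (upd h j x))%:E <= (Psi g h)%:E)%E) ->
  (Ex Phi <= Ex Psi)%E.
Proof.
move=> mPhi mPsi Phi0 Psi0 le; rewrite (Ex_freezeH_eq j) //.
apply: ae_ge0_le_integral => //.
- by move=> w _; apply: integral_ge0 => x _; rewrite lee_fin.
- apply: (@measurable_freezing _ _ _ P _ _ _ FM _ _ (H j) _ (@mfH j _ mPhi)) => z.
  by rewrite lee_fin.
- by move=> w _; rewrite lee_fin.
- exact/measurable_EFinP/Ex_measurable.
- by apply: filterS ae_unitary => w uw _; exact: le.
Qed.

Lemma Ex_freezeG j Phi Psi : env_measurable Phi -> env_measurable Psi ->
  (forall g h, 0 <= Phi g h) -> (forall g h, 0 <= Psi g h) ->
  (forall g h, (forall i, h i \is unitarymx) ->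
    (\int[distribution P (G j)]_x (Phi (upd g j x) h)%:E <= (Psi g h)%:E)%E) ->
  (Ex Phi <= Ex Psi)%E.
Proof.
move=> mPhi mPsi Phi0 Psi0 le; rewrite (Ex_freezeG_eq j) //.
apply: ae_ge0_le_integral => //.
- by move=> w _; apply: integral_ge0 => x _; rewrite lee_fin.
- apply: (@measurable_freezing _ _ _ P _ _ _ FM _ _ (G j) _ (@mfG j _ mPhi)) => z.
  by rewrite lee_fin.
- by move=> w _; rewrite lee_fin.
- exact/measurable_EFinP/Ex_measurable.
- by apply: filterS ae_unitary => w uw _; exact: le.
Qed.

Lemma Ex_indep (r : seq 'I_m) (phi : 'I_m -> 'M[C]_n -> R) : uniq r ->
  (forall i, measurable_fun [set: borel_mx R n] (phi i)) ->
  (forall i x, 0 <= phi i x) ->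
  Ex (fun g _ => \prod_(i <- r) phi i (g i)) =
  (\prod_(i <- r) \int[distribution P (G i)]_x (phi i x)%:E)%E.
Proof.
move=> + mphi phi0; elim: r => [_|j r IH].
  by rewrite big_nil -(Ex_cst 1); congr Ex; apply/funext => g; apply/funext => h;
    rewrite big_nil.
have mS s : env_measurable (fun (g : genv) (_ : henv) => \prod_(i <- s) phi i (g i)).
  apply: env_measurable_prod => i d D g h mg mh.
  apply: (@measurableT_comp _ _ _ _ _ _ (phi i : borel_mx R n -> R)) => //.
  by apply/measurable_borel_mx; exact: mg.
have S0 s (g : genv) (_ : henv) : 0 <= \prod_(i <- s) phi i (g i).
  by apply: prodr_ge0 => i _.
move=> /= /andP[jr ur]; rewrite (Ex_freezeG_eq j (mS _) (S0 _)) big_cons -IH //.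
have c0 : (0 <= \int[distribution P (G j)]_x (phi j x)%:E)%E.
  by apply: integral_ge0 => x _; rewrite lee_fin.
rewrite /Ex -ge0_integralZl //; last 2 first.
- exact/measurable_EFinP/(Ex_measurable (mS r)).
- by move=> w _; rewrite lee_fin; exact: (S0 r _ (fun i => H i w)).
apply: eq_integral => w _.
rewrite -ge0_integralZr //; last 3 first.
- exact/measurable_EFinP.
- by move=> x _; rewrite lee_fin.
- by rewrite lee_fin; exact: (S0 r _ (fun i => H i w)).
apply: eq_integral => x _; rewrite big_cons /upd eqxx EFinM; congr (_ * _%:E)%E.
apply: eq_big_seq => i ir; case: eqP => [ij|//]; by rewrite -ij ir in jr.
Qed.

End EnvExpectation.

(** * Haar moments *)

Section HaarState.
Context (R : realType) (p : nat) (mu : probability (borel_mx R p) R).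
Hypothesis hmu : haar_unitary mu.
Local Notation C := R[i].
Local Notation D := [set U : borel_mx R p | U \is unitarymx].
Implicit Types f g : 'M[C]_p -> R.

Definition bdd_meas f : Prop := measurable_fun [set: borel_mx R p] f /\
  exists c, forall U, U \is unitarymx -> `|f U| <= c.

(** On the unitary group polynomials in the entries are bounded, so restricting the integral to it
    gives a real linear functional that also accepts functions without a sign. *)
Definition haarE f : R := \int[mu]_(U in D) f U.

Lemma haarE_integrable f : bdd_meas f -> mu.-integrable D (EFin \o f).
Proof.
move=> [mf [c hc]]; apply: measurable_bounded_integrable.
- exact: measurable_unitary.
- apply: (@le_lt_trans _ _ 1%E); last exact: ltry.
  by apply: probability_le1; exact: measurable_unitary.
- exact: measurable_funTS.
- exists c; split; first exact: num_real.
  by move=> x cx U uU /=; apply: le_trans (hc _ uU) (ltW cx).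
Qed.

Lemma bdd_meas_cst (c : R) : bdd_meas (fun=> c).
Proof. by split; [exact: measurable_cst|exists `|c|]. Qed.

Lemma bdd_measD f g : bdd_meas f -> bdd_meas g -> bdd_meas (fun U => f U + g U).
Proof.
move=> [mf [c hc]] [mg [c' hc']]; split; first exact: measurable_funD.
exists (c + c') => U uU; apply: le_trans (ler_normD _ _) _.
by rewrite lerD ?hc ?hc'.
Qed.

Lemma bdd_measM f g : bdd_meas f -> bdd_meas g -> bdd_meas (fun U => f U * g U).
Proof.
move=> [mf [c hc]] [mg [c' hc']]; split; first exact: measurable_funM.
by exists (c * c') => U uU; rewrite normrM ler_pM ?hc ?hc'.
Qed.

Lemma bdd_measZ c f : bdd_meas f -> bdd_meas (fun U => c * f U).
Proof. by apply: bdd_measM; exact: bdd_meas_cst. Qed.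

Lemma bdd_meas_sum (I : Type) (r : seq I) (Q : pred I) (f : I -> 'M[C]_p -> R) :
  (forall i, bdd_meas (f i)) -> bdd_meas (fun U => \sum_(i <- r | Q i) f i U).
Proof.
move=> bf; elim: r => [|i r IH].
  by under eq_fun do rewrite big_nil; exact: bdd_meas_cst.
under eq_fun do rewrite big_cons.
by case: (Q i) => //; exact: bdd_measD.
Qed.

Lemma bdd_meas_ext f g : f =1 g -> bdd_meas f -> bdd_meas g.
Proof. by move=> /funext ->. Qed.

Lemma bdd_meas_comp (V : 'M[C]_p) f : V \is unitarymx -> bdd_meas f ->
  bdd_meas (fun U => f (U *m V)).
Proof.
move=> uV [mf [c hc]]; split; last first.
  by exists c => U uU; apply: hc; exact: mul_unitarymx.
apply: (@measurableT_comp _ _ _ _ _ _ (f : borel_mx R p -> R)) => //.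
apply/measurable_borel_mx; apply: cmeas_mul; last exact: cmeas_cst.
exact/measurable_borel_mx.
Qed.

Lemma haarE_cst (c : R) : haarE (fun=> c) = c.
Proof.
rewrite /haarE Rintegral_cst; last exact: measurable_unitary.
by rewrite -[RHS]mulr1 -[1]/(fine 1%E); congr (_ * fine _); case: hmu.
Qed.

Lemma haarED f g : bdd_meas f -> bdd_meas g ->
  haarE (fun U => f U + g U) = haarE f + haarE g.
Proof.
by move=> bf bg; apply: RintegralD;
  [exact: measurable_unitary|exact: haarE_integrable|exact: haarE_integrable].
Qed.

Lemma haarEZ c f : bdd_meas f -> haarE (fun U => c * f U) = c * haarE f.
Proof.
by move=> bf; apply: RintegralZl; [exact: measurable_unitary|exact: haarE_integrable].
Qed.

Lemma haarE_sum (I : Type) (r : seq I) (Q : pred I) (f : I -> 'M[C]_p -> R) :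
  (forall i, bdd_meas (f i)) ->
  haarE (fun U => \sum_(i <- r | Q i) f i U) = \sum_(i <- r | Q i) haarE (f i).
Proof.
move=> bf; elim: r => [|i r IH].
  by under eq_fun do rewrite big_nil; rewrite haarE_cst big_nil.
under eq_fun do rewrite big_cons.
rewrite big_cons; case: (Q i) => //; rewrite haarED ?IH //.
exact: bdd_meas_sum.
Qed.

Lemma haarE_eq f g : (forall U, U \is unitarymx -> f U = g U) -> haarE f = haarE g.
Proof. by move=> fg; apply: eq_Rintegral => U; rewrite inE; exact: fg. Qed.

Lemma haarE_ge0 f : (forall U, U \is unitarymx -> 0 <= f U) -> 0 <= haarE f.
Proof. by move=> f0; apply: Rintegral_ge0 => U; exact: f0. Qed.

Lemma haarE_inv f (V : 'M[C]_p) : V \is unitarymx -> bdd_meas f ->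
  haarE (fun U => f (U *m V)) = haarE f.
Proof.
move=> uV bf; rewrite /haarE /Rintegral; congr fine.
pose phi (U : borel_mx R p) : borel_mx R p := U *m V.
have mphi : measurable_fun setT phi.
  apply/measurable_borel_mx; apply: cmeas_mul; last exact: cmeas_cst.
  exact/measurable_borel_mx.
have phiD : phi @^-1` D = D.
  apply/seteqP; split => U; last by move=> uU; exact: mul_unitarymx.
  rewrite /phi /= => h; have := mul_unitarymx h (_ : V^t* \is unitarymx).
  by rewrite trmxC_unitary => /(_ uV); rewrite -mulmxA (unitarymxP uV) mulmx1.
have -> : (\int[mu]_(x in D) (f (x *m V))%:E =
    \int[mu]_(x in phi @^-1` D) ((EFin \o f) \o phi) x)%E by rewrite phiD.
have mf : measurable_fun [set: borel_mx R p] (EFin \o f).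
  by apply/measurable_EFinP; case: bf.
have fi : mu.-integrable (phi @^-1` D) ((EFin \o f) \o phi).
  by rewrite phiD; exact: (haarE_integrable (bdd_meas_comp uV bf)).
rewrite -(integral_pushforward mphi mf fi (@measurable_unitary R p)).
apply: eq_measure_integral => A mA _.
by have [_ /(_ _ _ uV mA)[_ h]] := hmu; first [exact: h | exact: esym h].
Qed.

(** The quadratic polynomial in [t] given by the mean of [(f - t g) ^+ 2] is nonnegative, and
    [b / c] is its minimum. *)
Lemma haarE_CauchySchwarz f g : bdd_meas f -> bdd_meas g ->
  haarE (fun U => f U * g U) ^+ 2 <=
  haarE (fun U => f U ^+ 2) * haarE (fun U => g U ^+ 2).
Proof.
move=> bf bg.
set a := haarE (fun U => f U ^+ 2); set c := haarE (fun U => g U ^+ 2).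
set b := haarE _.
have bff : bdd_meas (fun U => f U ^+ 2) by exact: bdd_measM.
have bgg : bdd_meas (fun U => g U ^+ 2) by exact: bdd_measM.
have bfg : bdd_meas (fun U => f U * g U) by exact: bdd_measM.
have c0 : 0 <= c by apply: haarE_ge0 => U _; exact: sqr_ge0.
have H t : 0 <= a + - (2 * t) * b + t ^+ 2 * c.
  rewrite -haarEZ // -(haarEZ _ bgg) -!haarED //; try exact: bdd_measZ.
    apply: haarE_ge0 => U _; have := sqr_ge0 (f U - t * g U).
    by congr (0 <= _); ring.
  by apply: bdd_measD => //; exact: bdd_measZ.
have [cz|cn] := eqVneq c 0.
  have [bz|bn] := eqVneq b 0; first by rewrite bz cz expr0n /= mulr0.
  (* For [c = 0] the polynomial is affine in [t]; at this point it would equal -1. *)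
  have := H ((a + 1) / (2 * b)); rewrite cz mulr0 addr0.
  have -> : a + - (2 * ((a + 1) / (2 * b))) * b = -1 by field.
  lra.
have cp : 0 < c by rewrite lt_neqAle eq_sym cn.
have := H (b / c).
have -> : a + - (2 * (b / c)) * b + (b / c) ^+ 2 * c = (a * c - b ^+ 2) / c by field.
by rewrite pmulr_lge0 ?invr_gt0 // subr_ge0.
Qed.

(** Second moments of Haar matrices are computed by symmetry, but the estimates of words use first
    absolute moments; this converts one into the other. *)
Lemma haarE_le_sqrt f (c : R) : bdd_meas f -> 0 <= c ->
  (forall U, 0 <= f U) -> haarE (fun U => f U ^+ 2) <= c ^+ 2 ->
  (\int[mu]_U (f U)%:E <= c%:E)%E.
Proof.
move=> bf c0 f0 h.
rewrite (@ge0_negligible_integral _ _ _ mu setT (~` D)) //; last 4 first.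
- by apply: measurableC; exact: measurable_unitary.
- by apply/measurable_EFinP; case: bf.
- by move=> U _; rewrite lee_fin.
- rewrite [LHS]probability_setC; last exact: measurable_unitary.
  by rewrite (_ : mu _ = 1%E) ?subee //; case: hmu.
rewrite setTD setCK -[X in (X <= _)%E]fineK; last first.
  apply: (@integrable_fin_num _ _ _ mu D (@measurable_unitary R p) (EFin \o f)).
  exact: haarE_integrable.
rewrite lee_fin -/(haarE f).
have := haarE_CauchySchwarz bf (bdd_meas_cst 1).
rewrite expr1n haarE_cst mulr1.
have -> : haarE (fun U => f U * 1) = haarE f.
  by congr haarE; apply/funext => U; rewrite mulr1.
move=> h2; rewrite -(ler_pXn2r (n := 2)) ?nnegrE //; first exact: le_trans h2 h.
exact: haarE_ge0.
Qed.

End HaarState.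

Section UnitaryExamples.
Context (R : rcfType) (p : nat).
Local Notation C := R[i].

Lemma perm_unitary (s : 'S_p) : (perm_mx s : 'M[C]_p) \is unitarymx.
Proof.
apply/unitarymxP; rewrite tr_perm_mx map_perm_mx -perm_mxM.
by rewrite mulgV perm_mx1.
Qed.

Lemma mul_perm_mx_entry k (A : 'M[C]_(k, p)) (s : 'S_p) i j :
  (A *m perm_mx s^-1%g) i j = A i (s j).
Proof. by rewrite -col_permE mxE. Qed.

(** Invariance under this sign change forces mixed second moments of the coordinates to vanish. *)
Definition flip_mx (i : 'I_p) : 'M[C]_p := diag_mx (\row_k ((-1) ^+ (k == i))).

Lemma flip_unitary i : flip_mx i \is unitarymx.
Proof.
apply/unitarymxP; rewrite tr_diag_mx map_diag_mx mulmx_diag.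
apply/matrixP => k l; rewrite !mxE; congr (_ *+ _).
by case: eqP => _; rewrite ?expr0 ?expr1 ?rmorphN ?rmorph1 ?mulrNN mulr1.
Qed.

Lemma mul_flip_entry k (A : 'M[C]_(k, p)) i j l :
  (A *m flip_mx i) l j = A l j * (-1) ^+ (j == i).
Proof. by rewrite mul_mx_diag !mxE. Qed.

(* The reflection I - 2 z z^* / |z|^2 for |z|^2 = 5: with z = e_k + 2 w e_l it
   mixes two coordinates with rational coefficients 3/5 and 4/5. *)
Definition householder (z : 'cV[C]_p) : 'M[C]_p := 1%:M - (2 / 5) *: (z *m z^t*).

Lemma householder_unitary z : z^t* *m z = 5%:M -> householder z \is unitarymx.
Proof.
move=> z5; apply/unitarymxP; rewrite /householder.
have -> : (1%:M - (2 / 5) *: (z *m z^t*))^t* = 1%:M - (2 / 5) *: (z *m z^t*).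
  rewrite linearB /= map_mxB trmx1 map_mx1 linearZ /= map_mxZ trmx_mul map_mxM /= trmxCK.
  by rewrite fmorph_div !rmorph_nat.
rewrite mulmxBl mul1mx mulmxBr mulmx1 -scalemxAl -!scalemxAr.
rewrite -mulmxA [_^t* *m _]mulmxA z5 mul_scalar_mx -scalemxAr !scalerA.
rewrite -addrA -opprD -scalerBl -scalerDl.
have -> : 2 / 5 + (2 / 5 - 2 / 5 * (2 / 5 * 5)) = 0 :> C by field.
by rewrite scale0r subr0.
Qed.

Lemma mul_householder_entry (r : 'rV[C]_p) (i j : 'I_p) (w : C) : i != j ->
  (r *m householder (delta_mx i 0 + (2 * w) *: delta_mx j 0)) 0 i =
  (3 * r 0 i - 4 * w * r 0 j) / 5.
Proof.
move=> ij; rewrite /householder mulmxBr mulmx1 -scalemxAr mulmxA mulmxDr.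
rewrite -scalemxAr -!colE !mxE big_ord1 !mxE !eqxx (negbTE ij) /=.
by rewrite mulr0 addr0 conjC1 mulr1; field.
Qed.

Lemma householder_vec (i j : 'I_p) (w : C) : i != j -> w * w^* = 1 ->
  let z : 'cV[C]_p := delta_mx i 0 + (2 * w) *: delta_mx j 0 in z^t* *m z = 5%:M.
Proof.
move=> ij w1 z; apply/matrixP => a b; rewrite !ord1 !mxE (bigD1 i) //= (bigD1 j) 1?eq_sym //=.
rewrite big1 ?addr0 => [|k /andP[ki kj]]; last first.
  by rewrite !mxE (negbTE ki) (negbTE kj) /= mulr0 addr0 mulr0.
rewrite !mxE !eqxx [j == i]eq_sym (negbTE ij) /= !mulr0 !addr0 add0r !mulr1.
rewrite conjC1 rmorphM rmorph_nat mulrACA [w^* * w]mulrC w1 mulr1n; ring.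
Qed.

End UnitaryExamples.

Section HaarMoments.
Context (R : realType) (p : nat) (mu : probability (borel_mx R p) R).
Hypothesis hmu : haar_unitary mu.
Local Notation C := R[i].
Local Notation haarE := (haarE mu).
Implicit Types (z w : 'M[C]_p -> C) (r s : 'rV[C]_p).

Definition cbdd z : Prop :=
  bdd_meas (fun U => complex.Re (z U)) /\ bdd_meas (fun U => complex.Im (z U)).

Lemma cbdd_cst (c : C) : cbdd (fun=> c).
Proof. by split; exact: bdd_meas_cst. Qed.

Lemma cbddD z w : cbdd z -> cbdd w -> cbdd (fun U => z U + w U).
Proof.
move=> [rz iz] [rw iw]; split.
  by have := bdd_measD rz rw; apply: bdd_meas_ext => U; rewrite cReD.
by have := bdd_measD iz iw; apply: bdd_meas_ext => U; rewrite cImD.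
Qed.

Lemma cbddM z w : cbdd z -> cbdd w -> cbdd (fun U => z U * w U).
Proof.
move=> [rz iz] [rw iw]; split.
  have := bdd_measD (bdd_measM rz rw) (bdd_measZ (-1) (bdd_measM iz iw)).
  by apply: bdd_meas_ext => U; rewrite cReM mulN1r.
have := bdd_measD (bdd_measM rz iw) (bdd_measM iz rw).
by apply: bdd_meas_ext => U; rewrite cImM.
Qed.

Lemma cbdd_conj z : cbdd z -> cbdd (fun U => (z U)^*).
Proof.
move=> [rz iz]; split; first by apply: bdd_meas_ext rz => U; rewrite cRe_conj.
by have := bdd_measZ (-1) iz; apply: bdd_meas_ext => U; rewrite cIm_conj mulN1r.
Qed.

Lemma cbdd_sum (I : Type) (t : seq I) (Q : pred I) (z : I -> 'M[C]_p -> C) :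
  (forall i, cbdd (z i)) -> cbdd (fun U => \sum_(i <- t | Q i) z i U).
Proof.
move=> bz; split.
  have := bdd_meas_sum t Q (fun i => (bz i).1).
  by apply: bdd_meas_ext => U; rewrite cRe_sum.
have := bdd_meas_sum t Q (fun i => (bz i).2).
by apply: bdd_meas_ext => U; rewrite cIm_sum.
Qed.

Lemma cbdd_nrm2 z : cbdd z -> bdd_meas (fun U => nrm2 (z U)).
Proof. by move=> [rz iz]; apply: bdd_measD; apply: bdd_measM. Qed.

Lemma cbdd_entry r i : cbdd (fun U => (r *m U) 0 i).
Proof.
have hb (U : 'M[C]_p) : U \is unitarymx -> cabs ((r *m U) 0 i) <= fro r.
  by move=> uU; rewrite -(fro_unitary r uU) cabs_le_fro.
have cm : cmeas (fun U : borel_mx R p => r *m (U : 'M[C]_p)).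
  by apply: cmeas_mul; [exact: cmeas_cst|exact/measurable_borel_mx].
have [mr mi] := cm 0 i.
split; split => //; exists (fro r) => U uU; apply: le_trans (hb U uU);
  rewrite /cabs -sqrtr_sqr ler_sqrt ?nrm2_ge0 // /nrm2 ?lerDl ?lerDr sqr_ge0 //.
Qed.

Lemma nrm2_sum (I : finType) (z : I -> C) :
  nrm2 (\sum_i z i) = \sum_i \sum_j complex.Re (z i * (z j)^*).
Proof.
rewrite /nrm2 cRe_sum cIm_sum !expr2 !mulr_suml -big_split /=.
apply: eq_bigr => i _; rewrite !mulr_sumr -big_split /=.
by apply: eq_bigr => j _; rewrite cReM cRe_conj cIm_conj mulrN opprK.
Qed.

(** By permutation invariance the coordinates of [r *m U] have equal second moments, and these add
    up to [fro2 r]. *)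
Lemma haarE_nrm2_entry r i : haarE (fun U => nrm2 ((r *m U) 0 i)) = fro2 r / p%:R.
Proof.
have b k : bdd_meas (fun U => nrm2 ((r *m U) 0 k)) by exact/cbdd_nrm2/cbdd_entry.
have p0 : (p%:R : R) != 0.
  by rewrite pnatr_eq0; case: (p) i => // -[].
have same k : haarE (fun U => nrm2 ((r *m U) 0 k)) = haarE (fun U => nrm2 ((r *m U) 0 i)).
  rewrite -(haarE_inv hmu (perm_unitary R (tperm i k)^-1%g) (b i)).
  congr haarE; apply/funext => U.
  by rewrite mulmxA mul_perm_mx_entry tpermL.
have : \sum_k haarE (fun U => nrm2 ((r *m U) 0 k)) = fro2 r.
  rewrite -haarE_sum // -[RHS](haarE_cst hmu); apply: haarE_eq => U uU.
  by rewrite -(fro2_unitary r uU) /fro2 big_ord1.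
under eq_bigr do rewrite same.
rewrite sumr_const card_ord -[_ *+ p]mulr_natl => <-.
by rewrite mulrC mulKf.
Qed.

(** After expanding in coordinates, flipping the sign of coordinate [i] turns each cross term into
    its negative; only the diagonal terms survive. *)
Lemma haarE_word1 r (s : 'cV[C]_p) :
  haarE (fun U => nrm2 ((r *m U *m s) 0 0)) = fro2 r * fro2 s / p%:R.
Proof.
pose z i U := (r *m U) 0 i * s i 0.
have bz i : cbdd (z i) by apply: cbddM; [exact: cbdd_entry|exact: cbdd_cst].
have bzz i j : bdd_meas (fun U => complex.Re (z i U * (z j U)^*)).
  exact: (cbddM (bz i) (cbdd_conj (bz j))).1.
transitivity (haarE (fun U => \sum_i \sum_j complex.Re (z i U * (z j U)^*))).
  by apply: haarE_eq => U _; rewrite -nrm2_sum mxE.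
rewrite haarE_sum //; last by move=> i; exact: bdd_meas_sum.
transitivity (\sum_i fro2 r / p%:R * nrm2 (s i 0)).
  apply: eq_bigr => i _; rewrite haarE_sum // (bigD1 i) //= big1 ?addr0.
    transitivity (haarE (fun U => nrm2 (s i 0) * nrm2 ((r *m U) 0 i))).
      by congr haarE; apply/funext => U; rewrite mul_conj_nrm2 /= nrm2M mulrC.
    rewrite haarEZ ?haarE_nrm2_entry; first by rewrite mulrC.
    exact/cbdd_nrm2/cbdd_entry.
  move=> j ji; have := haarE_inv hmu (flip_unitary R i) (bzz i j).
  have -> : (fun U => complex.Re (z i (U *m flip_mx R i) * (z j (U *m flip_mx R i))^*)) =
      (fun U => -1 * complex.Re (z i U * (z j U)^*)).
    apply/funext => U; rewrite /z !mulmxA !mul_flip_entry eqxx (negbTE ji).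
    by rewrite expr1 expr0 mulr1 !mulrN1 !mulNr cReN mul1r.
  by rewrite haarEZ //; lra.
rewrite -mulr_sumr mulrAC; congr (_ * _ / _).
by apply: eq_bigr => i _; rewrite big_ord1.
Qed.

(** Let b be the fourth absolute moment of a coordinate and e the mixed moment of two. Invariance
    under the reflections gives 625 b = 337 b + 576 e, so e = b/2. Summing over all pairs of
    coordinates, p b + p (p - 1) b/2 equals [fro2 r ^+ 2]. Such rational reflections avoid any
    parametrization of the unitary group. *)
Lemma haarE_nrm2_sqr r i : (1 < p)%N ->
  haarE (fun U => nrm2 ((r *m U) 0 i) ^+ 2) = 2 * fro2 r ^+ 2 / (p%:R * (p%:R + 1)).
Proof.
move=> p1.
pose X (k : 'I_p) (U : 'M[C]_p) := nrm2 ((r *m U) 0 k).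
have bX k : bdd_meas (X k) by exact/cbdd_nrm2/cbdd_entry.
have bXX k l : bdd_meas (fun U => X k U * X l U) by exact: bdd_measM.
have bX2 k : bdd_meas (fun U => X k U ^+ 2) by exact: bdd_measM.
pose b := haarE (fun U => X i U ^+ 2).
have same k : haarE (fun U => X k U ^+ 2) = b.
  rewrite /b -(haarE_inv hmu (perm_unitary R (tperm i k)^-1%g) (bX2 i)).
  congr haarE; apply/funext => U.
  by rewrite /X mulmxA mul_perm_mx_entry tpermL.
have off k l : k != l -> haarE (fun U => X k U * X l U) = b / 2.
  move=> kl.
  pose rot (w : C) (U : 'M[C]_p) := nrm2 ((3 * (r *m U) 0 k - 4 * w * (r *m U) 0 l) / 5) ^+ 2.
  have rotE (w : C) : w * w^* = 1 -> haarE (rot w) = b /\ bdd_meas (rot w).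
    move=> w1; have uW := householder_unitary (householder_vec kl w1).
    have e : rot w = (fun U => X k (U *m householder
        (delta_mx k 0 + (2 * w) *: delta_mx l 0)) ^+ 2).
      by apply/funext => U; rewrite /X mulmxA mul_householder_entry.
    rewrite e; split; last exact: (bdd_meas_comp uW (bX2 k)).
    by rewrite (haarE_inv hmu uW (bX2 k)).
  have i1 : ('i%C : C) * 'i%C^* = 1.
    by apply/eqP; rewrite eq_complex /=; apply/andP; split; apply/eqP; ring.
  have i2 : (- 'i%C : C) * (- 'i%C)^* = 1.
    by apply/eqP; rewrite eq_complex /=; apply/andP; split; apply/eqP; ring.
  have i3 : (1 : C) * 1^* = 1 by rewrite conjC1 mulr1.
  have i4 : (- 1 : C) * (- 1)^* = 1 by rewrite conjCN1 mulrNN mulr1.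
  have [e1 b1] := rotE _ i1; have [e2 b2] := rotE _ i2.
  have [e3 b3] := rotE _ i3; have [e4 b4] := rotE _ i4.
  (* Averaging over the four phases only leaves even powers. *)
  have : haarE (fun U => rot 'i%C U + rot (- 'i%C) U + (rot 1 U + rot (- 1) U)) = b *+ 4.
    rewrite !haarED ?e1 ?e2 ?e3 ?e4 //; try exact: bdd_measD.
    by ring.
  have -> : (fun U => rot 'i%C U + rot (- 'i%C) U + (rot 1 U + rot (- 1) U)) =
     (fun U => 4 * 81 / 625 * X k U ^+ 2 + 4 * 256 / 625 * X l U ^+ 2 +
        4 * 576 / 625 * (X k U * X l U)).
    apply/funext => U; rewrite /rot /X.
    case: ((r *m U) 0 k) => x y; case: ((r *m U) 0 l) => a c.
    have n5 : nrm2 (5 : C)^-1 = 25%:R^-1.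
      by rewrite -[5]/(5%:R) -(rmorph_nat (real_complex R)) -fmorphV nrm2_real; field.
    by rewrite !nrm2M !n5 /nrm2 !cReD !cImD !cReN !cImN !cReM !cImM /=; field.
  rewrite haarED; [|by apply: bdd_measD; exact: bdd_measZ|exact: bdd_measZ].
  rewrite haarED; [|exact: bdd_measZ|exact: bdd_measZ].
  by rewrite !haarEZ // !same; lra.
have p0 : (p%:R : R) != 0 by rewrite pnatr_eq0 -lt0n ltnW.
have p10 : (p%:R + 1 : R) != 0 by rewrite natr1 pnatr_eq0.
have tot : \sum_k \sum_l haarE (fun U => X k U * X l U) = fro2 r ^+ 2.
  rewrite -[RHS](haarE_cst hmu).
  transitivity (haarE (fun U => \sum_k \sum_l X k U * X l U)).
    rewrite haarE_sum //; last by move=> k; exact: bdd_meas_sum.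
    by apply: eq_bigr => k _; rewrite haarE_sum.
  apply: haarE_eq => U uU; rewrite -(fro2_unitary r uU) /fro2 big_ord1 expr2 mulr_suml.
  by apply: eq_bigr => k _; rewrite mulr_sumr.
have row k : \sum_l haarE (fun U => X k U * X l U) = b * (p%:R + 1) / 2.
  rewrite (bigD1 k) //= -/(X k) (same k : haarE (fun U => X k U * X k U) = b).
  under eq_bigr => l lk do rewrite off 1?eq_sym //.
  rewrite sumr_const (_ : #|_| = p.-1); last first.
    by rewrite (cardC1 k) card_ord.
  by rewrite -[_ *+ p.-1]mulr_natl -subn1 natrB ?(ltnW p1) //; field.
move: tot; under eq_bigr do rewrite row.
rewrite sumr_const card_ord -[_ *+ p]mulr_natl -/b => <-; field.
by rewrite p0 p10.
Qed.

Lemma haarE_diag_moment r s i : (1 < p)%N ->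
  haarE (fun U => nrm2 ((r *m U) 0 i * ((s *m U) 0 i)^*)) <=
  2 * (fro2 r * fro2 s) / (p%:R * (p%:R + 1)).
Proof.
move=> p1.
have br : bdd_meas (fun U => nrm2 ((r *m U) 0 i)) by exact/cbdd_nrm2/cbdd_entry.
have bs : bdd_meas (fun U => nrm2 ((s *m U) 0 i)) by exact/cbdd_nrm2/cbdd_entry.
have -> : (fun U => nrm2 ((r *m U) 0 i * ((s *m U) 0 i)^*)) =
    (fun U => nrm2 ((r *m U) 0 i) * nrm2 ((s *m U) 0 i)).
  by apply/funext => U; rewrite nrm2M nrm2_conj.
have P0 : 0 <= (p%:R * (p%:R + 1))^-1 :> R by rewrite invr_ge0 mulr_ge0 ?addr_ge0.
rewrite -(ler_pXn2r (n := 2)) ?nnegrE ?mulr_ge0 ?fro2_ge0 //; last first.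
  by apply: haarE_ge0 => U _; rewrite mulr_ge0 ?nrm2_ge0.
apply: le_trans (haarE_CauchySchwarz mu br bs) _.
by rewrite !haarE_nrm2_sqr // le_eqVlt; apply/orP; left; apply/eqP; ring.
Qed.

(** Conjugation by a Haar unitary averages [B] to its normalized trace [t]. In an eigenbasis of [B]
    the deviation is a sum of the products [zeta i] with weights [lam i - t] of sum zero, so only
    the difference of the two possible covariances enters, and it is of order [p ^- 2]. *)
Lemma haarE_word2 r s (B : 'M[C]_p) (t : R) : (1 < p)%N -> psd B ->
  t = complex.Re (\tr B) / p%:R ->
  haarE (fun U => nrm2 ((r *m U *m B *m U^t* *m s^t*) 0 0 - t%:C%C * (r *m s^t*) 0 0))
  <= 4 * (fro2 r * fro2 s) * fro2 B / p%:R ^+ 2.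
Proof.
move=> p1 /psd_spectral[V [lam [uV lam0 eB]]] tE.
have p0 : (0 : R) < p%:R by rewrite ltr0n ltnW.
pose zeta i (U : 'M[C]_p) := (r *m U) 0 i * ((s *m U) 0 i)^*.
have bz i : cbdd (zeta i).
  by apply: cbddM; [exact: cbdd_entry|apply: cbdd_conj; exact: cbdd_entry].
have bzz i j : bdd_meas (fun U => complex.Re (zeta i U * (zeta j U)^*)).
  exact: (cbddM (bz i) (cbdd_conj (bz j))).1.
pose l' i := lam i - t.
pose f U := nrm2 (\sum_i (l' i)%:C%C * zeta i U).
have bf : bdd_meas f.
  by apply: cbdd_nrm2; apply: cbdd_sum => i; apply: cbddM => //; exact: cbdd_cst.
have uVt : V^t* \is unitarymx by rewrite trmxC_unitary.
have dotE (x y : 'rV[C]_p) : (x *m y^t*) 0 0 = \sum_i x 0 i * (y 0 i)^*.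
  by rewrite mxE; apply: eq_bigr => i _; rewrite !mxE.
have mdE (x : 'rV[C]_p) i :
    (x *m diag_mx (\row_i (lam i)%:C%C)) 0 i = x 0 i * (lam i)%:C%C.
  by rewrite mul_mx_diag !mxE.
have -> : haarE (fun U => nrm2 ((r *m U *m B *m U^t* *m s^t*) 0 0
    - t%:C%C * (r *m s^t*) 0 0)) = haarE f.
  (* Right invariance makes the eigenbasis of [B] the standard basis. *)
  rewrite -(haarE_inv hmu uVt bf); apply: haarE_eq => U uU; congr nrm2.
  have -> : r *m s^t* = (r *m (U *m V^t*)) *m (s *m (U *m V^t*))^t*.
    rewrite trmx_mul map_mxM /= mulmxA.
    have uUV : U *m V^t* \is unitarymx by rewrite mul_unitarymx.
    by rewrite mulmxtVK.
  have -> : r *m U *m B *m U^t* *m s^t* = (r *m (U *m V^t*)) *m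
      diag_mx (\row_i (lam i)%:C%C) *m (s *m (U *m V^t*))^t*.
    by rewrite eB !trmx_mul !map_mxM /= trmxCK !mulmxA.
  rewrite !dotE mulr_sumr -sumrB; apply: eq_bigr => i _.
  by rewrite mdE /zeta /l' rmorphB /=; ring.
have sl : \sum_i lam i = t * p%:R.
  rewrite tE divfK ?gt_eqF // -(tr_conj_unitary _ uV) eB !mulmxA mulmxtVK //.
  rewrite (unitarymxP uV) mul1mx.
  rewrite /mxtrace cRe_sum; apply: eq_bigr => i _; by rewrite !mxE eqxx mulr1n.
have sl' : \sum_i l' i = 0.
  by rewrite sumrB sl sumr_const card_ord -[t *+ p]mulr_natr subrr.
have sl2 : \sum_i l' i ^+ 2 <= fro2 B.
  have -> : fro2 B = \sum_i lam i ^+ 2.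
    rewrite eB fro2_unitary // -fro2_adj trmx_mul map_mxM /= trmxCK fro2_unitary //.
    rewrite fro2_adj /fro2; apply: eq_bigr => i _; rewrite (bigD1 i) //= big1 ?addr0.
      by rewrite !mxE eqxx mulr1n nrm2_real.
    by move=> j ji; rewrite !mxE eq_sym (negbTE ji) mulr0n nrm20.
  have -> : \sum_i l' i ^+ 2 = \sum_i lam i ^+ 2 - t ^+ 2 * p%:R.
    transitivity (\sum_i (lam i ^+ 2 - (2 * t) * lam i + t ^+ 2)).
      by apply: eq_bigr => i _; rewrite /l'; ring.
    rewrite big_split sumrB /= -mulr_sumr sl sumr_const card_ord -[_ *+ p]mulr_natr.
    by ring.
  by rewrite gerBl mulr_ge0 ?sqr_ge0 ?ltW.
(* By permutation invariance these covariances take one value [al] on the diagonal and one value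
   [be] off it. The quadratic form is therefore determined by the sum of the squares and the square
   of the sum of the weights. *)
pose c i j := haarE (fun U => complex.Re (zeta i U * (zeta j U)^*)).
have cperm (sg : 'S_p) i j : c (sg i) (sg j) = c i j.
  rewrite /c -(haarE_inv hmu (perm_unitary R sg^-1%g) (bzz i j)).
  by congr haarE; apply/funext => U; rewrite /zeta !mulmxA !mul_perm_mx_entry.
pose i0 := Ordinal (ltnW p1); pose i1 := Ordinal p1.
pose al := c i0 i0; pose be := c i0 i1.
have cd i : c i i = al by rewrite /al -(cperm (tperm i i0)) tpermL.
have co i j : i != j -> c i j = be.
  move=> ij; have i10 : i1 != i0 by [].
  pose sg := (tperm i0 i * tperm (tperm i0 i i1) j)%g.
  have h1 : sg i1 = j by rewrite permM tpermL.
  have h0 : sg i0 = i.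
    rewrite permM tpermL tpermD 1?eq_sym //.
    by rewrite -{1}(tpermL i0 i) (inj_eq perm_inj) eq_sym.
  by rewrite /be -(cperm sg i0 i1) h1 h0.
have expand (a : 'I_p -> R) : \sum_i \sum_j a i * a j * c i j =
    (\sum_i a i ^+ 2) * (al - be) + (\sum_i a i) ^+ 2 * be.
  transitivity (\sum_i \sum_j (a i * a j * be + (a i ^+ 2 * (al - be)) *+ (j == i))).
    apply: eq_bigr => i _; apply: eq_bigr => j _.
    case: eqVneq => [->|ij]; first by rewrite cd mulr1n; ring.
    by rewrite co 1?eq_sym // mulr0n addr0.
  transitivity (\sum_i (a i * (\sum_j a j) * be + a i ^+ 2 * (al - be))).
    apply: eq_bigr => i _; rewrite big_split /=; congr (_ + _).
      by rewrite mulr_sumr mulr_suml.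
    rewrite (bigD1 i) //= eqxx mulr1n big1 ?addr0 // => j ji.
    by rewrite (negbTE ji).
  by rewrite big_split /= -!mulr_suml -expr2 addrC.
have cf (a : 'I_p -> R) : haarE (fun U => nrm2 (\sum_i (a i)%:C%C * zeta i U)) =
    \sum_i \sum_j a i * a j * c i j.
  transitivity (haarE (fun U => \sum_i \sum_j
      a i * a j * complex.Re (zeta i U * (zeta j U)^*))).
    congr haarE; apply/funext => U; rewrite nrm2_sum; apply: eq_bigr => i _.
    apply: eq_bigr => j _; set x := zeta i U; set y := zeta j U.
    by rewrite !cReM !cRe_conj !cIm_conj !cReM !cImM /=; ring.
  rewrite haarE_sum //; last by move=> i; apply: bdd_meas_sum => j; exact: bdd_measZ.
  apply: eq_bigr => i _; rewrite haarE_sum //; last by move=> j; exact: bdd_measZ.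
  by apply: eq_bigr => j _; rewrite haarEZ.
have al_le : al <= 2 * (fro2 r * fro2 s) / (p%:R * (p%:R + 1)).
  rewrite (_ : al = haarE (fun U => nrm2 (zeta i0 U))); first exact: haarE_diag_moment.
  by congr haarE; apply/funext => U; rewrite mul_conj_nrm2.
have al0 : 0 <= al.
  by apply: haarE_ge0 => U _; rewrite mul_conj_nrm2 /= nrm2_ge0.
(* Positivity of the form with all weights 1. It bounds [- be] by [al / (p - 1)], hence [al - be] by
   [2 * al]. *)
have be_ge : 0 <= al + (p%:R - 1) * be.
  have : 0 <= \sum_i \sum_j (1 * 1 * c i j).
    by rewrite -(cf (fun=> 1)); apply: haarE_ge0 => U _; exact: nrm2_ge0.
  rewrite (expand (fun=> 1)) expr1n sumr_const card_ord.
  rewrite (_ : _ + _ = p%:R * (al + (p%:R - 1) * be)) ?pmulr_rge0 //; ring.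
have abe : al - be <= 2 * al.
  have p2 : 2 <= p%:R :> R by rewrite ler_nat.
  nra.
rewrite cf expand sl' expr0n /= mul0r addr0.
have fB := fro2_ge0 B.
apply: (@le_trans _ _ (fro2 B * (2 * al))).
  have [h|h] := leP 0 (al - be).
    by rewrite ler_pM // sumr_ge0 // => i _; exact: sqr_ge0.
  apply: (@le_trans _ _ 0); last by rewrite mulr_ge0 ?mulr_ge0.
  by rewrite nmulr_lle0 // sumr_ge0 // => i _; exact: sqr_ge0.
have rs0 : 0 <= fro2 r * fro2 s by rewrite mulr_ge0 ?fro2_ge0.
have al_le2 : al <= 2 * (fro2 r * fro2 s) / p%:R ^+ 2.
  apply: le_trans al_le _; rewrite ler_wpM2l ?mulr_ge0 ?fro2_ge0 //.
  have pp : 0 < p%:R * (p%:R + 1) :> R by rewrite mulr_gt0 ?addr_gt0.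
  by rewrite lef_pV2 ?posrE ?exprn_gt0 // expr2 ler_pM2l // lerDl.
rewrite [X in _ <= X](_ : _ = fro2 B * (2 * (2 * (fro2 r * fro2 s) / p%:R ^+ 2))); last by ring.
by rewrite ler_wpM2l // ler_wpM2l.
Qed.

Lemma bdd_meas_cabs z : cbdd z -> bdd_meas (fun U => cabs (z U)).
Proof.
move=> /cbdd_nrm2[mz [c hc]]; split; first exact: measurable_sqrt.
exists (Num.sqrt c) => U uU; rewrite ger0_norm ?cabs_ge0 //.
apply: ler_wsqrtr; apply: le_trans (hc U uU); exact: ler_norm.
Qed.

Lemma haar_word1_le r (s : 'cV[C]_p) :
  (\int[mu]_U (cabs ((r *m U *m s) 0 0))%:E <= (fro r * fro s / Num.sqrt p%:R)%:E)%E.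
Proof.
apply: haarE_le_sqrt => //.
- apply: bdd_meas_cabs.
  have h : cbdd (fun U => \sum_i (r *m U) 0 i * s i 0).
    by apply: cbdd_sum => i; apply: cbddM; [exact: cbdd_entry|exact: cbdd_cst].
  by under eq_fun do rewrite mxE.
- by rewrite divr_ge0 ?mulr_ge0 ?fro_ge0 ?sqrtr_ge0.
- by move=> U; exact: cabs_ge0.
under eq_fun do rewrite sqr_cabs.
by rewrite haarE_word1 expr_div_n exprMn !sqr_fro sqr_sqrtr.
Qed.

Lemma cbdd_quad r (s : 'cV[C]_p) (B : 'M[C]_p) :
  cbdd (fun U => (r *m U *m B *m U^t* *m s) 0 0).
Proof.
suff -> : (fun U => (r *m U *m B *m U^t* *m s) 0 0) =
  (fun U => \sum_i \sum_j (r *m U) 0 i * B i j * ((s^t* *m U) 0 j)^*).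
  apply: cbdd_sum => i; apply: cbdd_sum => j.
  apply: cbddM; last by apply: cbdd_conj; exact: cbdd_entry.
  by apply: cbddM; [exact: cbdd_entry|exact: cbdd_cst].
apply/funext => U; rewrite -mulmxA (_ : U^t* *m s = (s^t* *m U)^t*); last first.
  by rewrite trmx_mul map_mxM /= trmxCK.
rewrite mxE exchange_big /=; apply: eq_bigr => j _.
by rewrite mxE mulr_suml; apply: eq_bigr => i _; rewrite !mxE.
Qed.

Lemma haar_word2_le r (s : 'cV[C]_p) (B : 'M[C]_p) (t : R) : (1 < p)%N -> psd B ->
  t = complex.Re (\tr B) / p%:R ->
  (\int[mu]_U (cabs ((r *m U *m B *m U^t* *m s) 0 0
      - t%:C%C * (r *m U *m U^t* *m s) 0 0))%:E
    <= (2 * (fro r * fro s) * fro B / p%:R)%:E)%E.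
Proof.
move=> p1 pB tE; apply: haarE_le_sqrt => //.
- apply: bdd_meas_cabs; apply: cbddD; first exact: cbdd_quad.
  have := cbddM (cbdd_cst (- t%:C%C)) (cbdd_quad r s 1%:M).
  by under eq_fun do rewrite mulNr mulmx1.
- by rewrite divr_ge0 ?mulr_ge0 ?fro_ge0.
- by move=> U; exact: cabs_ge0.
have -> : (2 * (fro r * fro s) * fro B / p%:R) ^+ 2 =
    4 * (fro2 r * fro2 (s^t*)) * fro2 B / p%:R ^+ 2.
  by rewrite fro2_adj -!sqr_fro expr_div_n; congr (_ / _); ring.
apply: le_trans (haarE_word2 r (s^t*) p1 pB tE).
rewrite le_eqVlt; apply/orP; left; apply/eqP; apply: haarE_eq => U uU.
by rewrite sqr_cabs trmxCK mulmxtVK.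
Qed.

End HaarMoments.

(** * Words in the random matrices *)

Section OrderedProducts.
Context (m : nat).

Lemma sorted_filter_index_enum (P : pred 'I_m) :
  sorted (fun a b : 'I_m => (a < b)%N) [seq k <- index_enum 'I_m | P k].
Proof.
rewrite [index_enum _]unlock -enumT.
apply: sorted_filter => [a b c|]; first exact: ltn_trans.
have := iota_ltn_sorted 0 m; rewrite -val_enum_ord sorted_map.
exact.
Qed.

Lemma filter_index_enum_max (S : {set 'I_m}) i : i \in S ->
  (forall k, k \in S -> (k <= i)%N) ->
  [seq k <- index_enum 'I_m | k \in S] =
  rcons [seq k <- index_enum 'I_m | k \in (S :\ i)%SET] i.
Proof.
move=> iS imax.
have tr : transitive (fun a b : 'I_m => (a < b)%N) by move=> a b c; exact: ltn_trans.
apply: (irr_sorted_eq tr).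
- by move=> a; rewrite /= ltnn.
- exact: sorted_filter_index_enum.
- rewrite (sorted_pairwise tr) pairwise_rcons -(sorted_pairwise tr).
  rewrite sorted_filter_index_enum andbT.
  apply/allP => k; rewrite mem_filter !inE => /andP[/andP[ki kS] _].
  by rewrite ltn_neqAle imax // andbT.
- move=> k; rewrite mem_rcons !(inE, mem_filter) mem_index_enum !andbT.
  by case: eqVneq => [->|].
Qed.

(** Products run in increasing order, so the largest letter is the last factor. In a product of a
    word and an adjoint word it stands in the middle, where its unitary either cancels or is
    averaged. *)
Lemma prod_set_max (R : pzRingType) (S : {set 'I_m}) i (X : 'I_m -> R) : i \in S ->
  (forall k, k \in S -> (k <= i)%N) ->
  \prod_(k in S) X k = (\prod_(k in (S :\ i)%SET) X k) * X i.
Proof.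
move=> iS imax; rewrite -[LHS]big_filter -[X in _ = X * _]big_filter.
by rewrite (filter_index_enum_max iS imax) -cats1 big_cat big_seq1.
Qed.

End OrderedProducts.

Section EnvMatrix.
Context (R : realType) (m n p : nat).
Local Notation C := R[i].
Local Notation genv := ('I_m -> 'M[C]_n).
Local Notation henv := ('I_m -> 'M[C]_p).

Definition env_cmeas a b (Phi : genv -> henv -> 'M[C]_(a, b)) : Prop :=
  forall (d : measure_display) (D : measurableType d)
    (g : 'I_m -> D -> 'M[C]_n) (h : 'I_m -> D -> 'M[C]_p),
    (forall i, cmeas (g i)) -> (forall i, cmeas (h i)) ->
    cmeas (fun x => Phi (g ^~ x) (h ^~ x)).

Lemma env_cmeas_cst a b (A : 'M[C]_(a, b)) : env_cmeas (fun _ _ => A).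
Proof. by move=> d D g h mg mh; exact: cmeas_cst. Qed.

Lemma env_cmeas_mul a b c (Phi : genv -> henv -> 'M[C]_(a, b))
    (Psi : genv -> henv -> 'M[C]_(b, c)) : env_cmeas Phi -> env_cmeas Psi ->
  env_cmeas (fun g h => Phi g h *m Psi g h).
Proof. by move=> mP mQ d D g h mg mh; apply: cmeas_mul; [exact: mP|exact: mQ]. Qed.

Lemma env_cmeasB a b (Phi Psi : genv -> henv -> 'M[C]_(a, b)) :
  env_cmeas Phi -> env_cmeas Psi -> env_cmeas (fun g h => Phi g h - Psi g h).
Proof. by move=> mP mQ d D g h mg mh; apply: cmeasB; [exact: mP|exact: mQ]. Qed.

Lemma env_cmeas_adj a b (Phi : genv -> henv -> 'M[C]_(a, b)) :
  env_cmeas Phi -> env_cmeas (fun g h => (Phi g h)^t*).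
Proof. by move=> mP d D g h mg mh; apply: cmeas_adj; exact: mP. Qed.

Lemma env_cmeas_sum a b (I : Type) (r : seq I) (Q : pred I)
    (Phi : I -> genv -> henv -> 'M[C]_(a, b)) : (forall i, env_cmeas (Phi i)) ->
  env_cmeas (fun g h => \sum_(i <- r | Q i) Phi i g h).
Proof. by move=> mP d D g h mg mh; apply: cmeas_sum => i; exact: mP. Qed.

Lemma env_cmeas_prod a (I : Type) (r : seq I) (Q : pred I)
    (Phi : I -> genv -> henv -> 'M[C]_a) : (forall i, env_cmeas (Phi i)) ->
  env_cmeas (fun g h => \prod_(i <- r | Q i) Phi i g h).
Proof. by move=> mP d D g h mg mh; apply: cmeas_prod => i; exact: mP. Qed.

Lemma env_cmeas_exp a k (Phi : genv -> henv -> 'M[C]_a) :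
  env_cmeas Phi -> env_cmeas (fun g h => Phi g h ^+ k).
Proof. by move=> mP d D g h mg mh; apply: cmeas_exp; exact: mP. Qed.

Lemma env_cmeas_scale a b (f : genv -> henv -> R) (Phi : genv -> henv -> 'M[C]_(a, b)) :
  env_measurable f -> env_cmeas Phi -> env_cmeas (fun g h => (f g h)%:C%C *: Phi g h).
Proof. by move=> mf mP d D g h mg mh; apply: cmeas_scale; [exact: mf|exact: mP]. Qed.

Lemma env_cmeas_tens i : (n %| p)%N -> env_cmeas (fun g _ => tens_idmx p (g i)).
Proof. by move=> np d D g h mg mh; apply: cmeas_tens. Qed.

Lemma env_cmeas_g i : env_cmeas (fun g _ => g i).
Proof. by move=> d D g h mg mh. Qed.

Lemma env_cmeas_h i : env_cmeas (fun _ h => h i).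
Proof. by move=> d D g h mg mh. Qed.

Lemma env_measurable_cabs a b (Phi : genv -> henv -> 'M[C]_(a, b)) i j :
  env_cmeas Phi -> env_measurable (fun g h => cabs (Phi g h i j)).
Proof. by move=> mP d D g h mg mh; apply: measurable_cabs; exact: mP. Qed.

Lemma env_measurable_cabs_tr a (Phi : genv -> henv -> 'M[C]_a) :
  env_cmeas Phi -> env_measurable (fun g h => cabs (\tr (Phi g h))).
Proof. by move=> mP d D g h mg mh; apply: measurable_cabs_tr; exact: mP. Qed.

Lemma env_measurable_Re_tr a (Phi : genv -> henv -> 'M[C]_a) :
  env_cmeas Phi -> env_measurable (fun g h => complex.Re (\tr (Phi g h))).
Proof. by move=> mP d D g h mg mh; apply: measurable_Re_tr; exact: mP. Qed.

Lemma env_measurable_fro a b (Phi : genv -> henv -> 'M[C]_(a, b)) :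
  env_cmeas Phi -> env_measurable (fun g h => fro (Phi g h)).
Proof. by move=> mP d D g h mg mh; apply: measurable_fro; exact: mP. Qed.

Lemma env_measurable_fro2 a b (Phi : genv -> henv -> 'M[C]_(a, b)) :
  env_cmeas Phi -> env_measurable (fun g h => fro2 (Phi g h)).
Proof. by move=> mP d D g h mg mh; apply: measurable_fro2; exact: mP. Qed.

End EnvMatrix.

Section Words.
Context (R : realType) (m n p : nat).
Hypothesis hdvd : (n %| p)%N.
Local Notation C := R[i].
Local Notation genv := ('I_m -> 'M[C]_n).
Local Notation henv := ('I_m -> 'M[C]_p).
Implicit Types (g : genv) (h : henv) (S : {set 'I_m}).

Definition word g h S : 'M[C]_p := \prod_(i in S) (tens_idmx p (g i) *m h i).

Definition wnorm g S : R := \prod_(i in S) fro (g i).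

Lemma word0 g h : word g h finset.set0 = 1%:M.
Proof. by rewrite /word big_set0. Qed.

Lemma word_max g h S i : i \in S -> (forall k, k \in S -> (k <= i)%N) ->
  word g h S = word g h (S :\ i)%SET *m tens_idmx p (g i) *m h i.
Proof. by move=> iS imax; rewrite /word (prod_set_max _ iS imax) -mulmxA. Qed.

Lemma wnormD1 g S i : i \in S -> wnorm g S = wnorm g (S :\ i)%SET * fro (g i).
Proof. by move=> iS; rewrite /wnorm (big_setD1 i) //= mulrC. Qed.

Lemma wnorm_ge0 g S : 0 <= wnorm g S.
Proof. by apply: prodr_ge0 => i _; exact: fro_ge0. Qed.

Lemma word_updh g h S j x : j \notin S -> word g (upd h j x) S = word g h S.
Proof.
move=> jS; apply: eq_bigr => i iS; rewrite /upd; case: eqP => // ij.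
by rewrite -ij iS in jS.
Qed.

Lemma word_updg g h S j x : j \notin S -> word (upd g j x) h S = word g h S.
Proof.
move=> jS; apply: eq_bigr => i iS; rewrite /upd; case: eqP => // ij.
by rewrite -ij iS in jS.
Qed.

Lemma env_cmeas_word S : env_cmeas (fun g h => word g h S).
Proof.
apply: env_cmeas_prod => i; apply: env_cmeas_mul; last exact: env_cmeas_h.
exact: env_cmeas_tens.
Qed.

Lemma env_measurable_wnorm S : env_measurable (fun g (_ : henv) => wnorm g S).
Proof.
by apply: env_measurable_prod => i; apply: env_measurable_fro; exact: env_cmeas_g.
Qed.

Lemma fro_mul_word k (A : 'M[C]_(k, p)) g h S : (forall i, h i \is unitarymx) ->
  fro (A *m word g h S) <= fro A * wnorm g S.
Proof.
move=> uh; rewrite /word /wnorm.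
have : forall r : seq 'I_m, fro (A *m \prod_(i <- r | i \in S) (tens_idmx p (g i) *m h i))
   <= fro A * \prod_(i <- r | i \in S) fro (g i).
  move=> r; elim: r A => [|i r IH] A; first by rewrite !big_nil mulmx1 mulr1.
  rewrite !big_cons; case: ifP => _ //.
  rewrite !mulmxA mulrA; apply: le_trans (IH _) _.
  rewrite ler_wpM2r ?prodr_ge0 // => [? _|]; first exact: fro_ge0.
  by rewrite fro_unitary // fro_mul_tens.
exact.
Qed.

Lemma fro_row_word g h S x : (forall i, h i \is unitarymx) ->
  fro (row x (word g h S)) <= wnorm g S.
Proof.
move=> uh; rewrite rowE; apply: le_trans (fro_mul_word _ _ _ uh) _.
have -> : fro (delta_mx 0 x : 'rV[C]_p) = 1; last by rewrite mul1r.
rewrite /fro /fro2 big_ord1 (bigD1 x) //= big1 ?addr0.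
  by rewrite mxE !eqxx /= -[X in nrm2 X](rmorph1 (real_complex R)) nrm2_real expr1n sqrtr1.
by move=> y yx; rewrite mxE (negbTE yx) andbF nrm20.
Qed.

Lemma word_pair_entry g h S T (B : 'M[C]_p) x y :
  (word g h S *m B *m (word g h T)^t*) x y =
  (row x (word g h S) *m B *m (row y (word g h T))^t*) 0 0.
Proof.
by rewrite -row_mul !mxE; apply: eq_bigr => k _; rewrite !mxE.
Qed.

Lemma word_pair_le g h S T x y : (forall i, h i \is unitarymx) ->
  cabs ((word g h S *m (word g h T)^t*) x y) <= wnorm g S * wnorm g T.
Proof.
move=> uh; rewrite -[word g h S]mulmx1 word_pair_entry mulmx1.
apply: le_trans (cabs_le_fro _ _ _) _; apply: le_trans (fro_mul _ _) _.
by rewrite fro_adj ler_pM ?fro_ge0 ?fro_row_word.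
Qed.

End Words.

(** * Integrating out one Haar unitary *)

Section WordLimits.
Context (R : realType) (m n p : nat) (disp : measure_display)
  (T : measurableType disp) (P : probability T R)
  (G : 'I_m -> {RV P >-> borel_mx R n}) (H : 'I_m -> {RV P >-> borel_mx R p}).
Hypothesis hH : forall i : 'I_m, haar_unitary (distribution P (H i)).
Hypothesis hind : mutually_independent P (fun k : 'I_m + 'I_m =>
       match k with
       | inl i => g_sigma_algebra_preimage (G i)
       | inr i => g_sigma_algebra_preimage (H i)
       end).
Hypotheses (hn : (0 < n)%N) (hnp : (n < p)%N) (hdvd : (n %| p)%N).
Local Notation C := R[i].
Local Notation genv := ('I_m -> 'M[C]_n).
Local Notation henv := ('I_m -> 'M[C]_p).
Local Notation E := (Ex G H).
Implicit Types (g : genv) (h : henv) (S V : {set 'I_m}) (F : genv -> R).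

Let p1 : (1 < p)%N. Proof. exact: leq_ltn_trans hn hnp. Qed.

Definition env_gmeas F : Prop := env_measurable (fun g (_ : henv) => F g).

(** The unitary of index [j] occurs in one of the two words only, so the entry is linear in it and
    [haar_word1_le] applies. The middle factor [B] is the identity or the letter left over after a
    cancellation, and [beta] bounds its action on vectors. *)
Lemma word_single S V j (B : genv -> 'M[C]_p) (beta : genv -> R) F x y :
  j \in S -> (forall k, k \in S -> (k <= j)%N) -> j \notin V ->
  env_cmeas (fun g (_ : henv) => B g) -> env_gmeas beta -> env_gmeas F ->
  (forall g, 0 <= beta g) -> (forall g, 0 <= F g) ->
  (forall g (v : 'rV[C]_p), fro (v *m (B g)^t*) <= beta g * fro v) ->
  (E (fun g h => F g * cabs ((word g h S *m B g *m (word g h V)^t*) x y))%R <=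
   E (fun g _ => F g * (beta g * (wnorm g S * wnorm g V)) / Num.sqrt p%:R)%R)%E.
Proof.
move=> jS jmax jV mB mbeta mF beta0 F0 hB.
apply: (Ex_freezeH hH hind (j := j)).
- apply: env_measurableM => //; apply: env_measurable_cabs.
  apply: env_cmeas_mul; last by apply: env_cmeas_adj; exact: env_cmeas_word.
  by apply: env_cmeas_mul => //; exact: env_cmeas_word.
- apply: env_measurableM; last exact: env_measurable_cst.
  apply: env_measurableM => //; apply: env_measurableM => //.
  by apply: env_measurableM; exact: env_measurable_wnorm.
- by move=> g h; rewrite mulr_ge0 ?cabs_ge0.
- by move=> g h; rewrite divr_ge0 ?sqrtr_ge0 ?mulr_ge0 ?wnorm_ge0.
move=> g h uh.
pose r := row x (word g h (S :\ j)%SET) *m tens_idmx p (g j).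
pose s := B g *m (row y (word g h V))^t*.
have jS' : j \notin (S :\ j)%SET by rewrite !inE eqxx.
have e (U : 'M[C]_p) : F g * cabs ((word g (upd h j U) S *m B g *m
    (word g (upd h j U) V)^t*) x y) = F g * cabs ((r *m U *m s) 0 0).
  rewrite word_pair_entry (word_updh _ _ _ jV) (word_max _ _ jS jmax).
  rewrite (word_updh _ _ _ jS').
  by rewrite /upd eqxx !row_mul /s !mulmxA.
under eq_integral do rewrite e EFinM.
rewrite ge0_integralZl_EFin //; last 2 first.
- by move=> U _; rewrite lee_fin cabs_ge0.
- apply/measurable_EFinP; apply: measurable_cabs.
  apply: cmeas_mul; last exact: cmeas_cst.
  by apply: cmeas_mul; [exact: cmeas_cst|exact/measurable_borel_mx].
apply: le_trans (lee_wpmul2l _ (haar_word1_le (hH j) r s)) _; first by rewrite lee_fin.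
rewrite -EFinM lee_fin [X in X <= _]mulrA ler_wpM2r ?invr_ge0 ?sqrtr_ge0 // ler_wpM2l //.
have hr : fro r <= wnorm g S.
  rewrite (wnormD1 g jS); apply: le_trans (fro_mul_tens _ _ _) _ => //.
  by rewrite ler_wpM2r ?fro_ge0 // fro_row_word.
have hs : fro s <= beta g * wnorm g V.
  rewrite -fro_adj /s trmx_mul map_mxM /= trmxCK.
  by apply: le_trans (hB _ _) _; rewrite ler_wpM2l // fro_row_word.
by rewrite mulrCA ler_pM ?fro_ge0.
Qed.

Let i0 : 'I_n := Ordinal hn.

Definition hh (A : 'M[C]_n) : R := fro2 (row i0 A).
Definition gg (A : 'M[C]_n) : R := fro2 A / n%:R.

Lemma hh_ge0 A : 0 <= hh A. Proof. exact: fro2_ge0. Qed.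
Lemma gg_ge0 A : 0 <= gg A. Proof. by rewrite divr_ge0 ?fro2_ge0. Qed.

Lemma hh_le A : hh A <= fro A ^+ 2.
Proof.
rewrite sqr_fro /hh /fro2 big_ord1 [X in _ <= X](bigD1 i0) //=.
rewrite (_ : \sum_j nrm2 (row i0 A 0 j) = \sum_j nrm2 (A i0 j)); last first.
  by apply: eq_bigr => j _; rewrite mxE.
by rewrite lerDl sumr_ge0 // => i _; apply: sumr_ge0 => j _; exact: nrm2_ge0.
Qed.

Lemma gg_le A : gg A <= fro A ^+ 2.
Proof.
rewrite sqr_fro /gg ler_pdivrMr ?ltr0n //.
by rewrite ler_peMr ?fro2_ge0 // ler1n.
Qed.

Lemma env_gmeas_hh i : env_gmeas (fun g => hh (g i)).
Proof.
move=> d D g h mg mh; apply: measurable_fro2 => a b.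
have [r s] := mg i i0 b; split; by under eq_fun do rewrite mxE.
Qed.

Lemma env_gmeas_gg i : env_gmeas (fun g => gg (g i)).
Proof.
apply: env_measurableM; last exact: env_measurable_cst.
by apply: env_measurable_fro2; exact: env_cmeas_g.
Qed.

Definition is_min S (i : 'I_m) : bool := [forall k in S, (i <= k)%N].

(* The scalar a_S. The indices of the upper left n x n block of G (x) I_(p/n)
   lie in the first block row as soon as n <= p/n, whence hh, which only sees
   row 0, for the first letter; a later letter is averaged by the Haar unitary
   on its left, whence the normalized trace gg. *)
Definition aw g S : R :=
  \prod_(i in S) (if is_min S i then hh (g i) else gg (g i)).

Lemma aw_ge0 g S : 0 <= aw g S.
Proof. by apply: prodr_ge0 => i _; case: ifP => _; rewrite ?hh_ge0 ?gg_ge0. Qed.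

Lemma aw_le g S : aw g S <= wnorm g S ^+ 2.
Proof.
rewrite /aw /wnorm -prodrXl; apply: ler_prod => i _.
by case: ifP => _; rewrite ?hh_ge0 ?gg_ge0 ?hh_le ?gg_le.
Qed.

Lemma env_gmeas_aw S : env_gmeas (aw ^~ S).
Proof.
apply: env_measurable_prod => i.
by case: is_min; [exact: env_gmeas_hh|exact: env_gmeas_gg].
Qed.

Lemma aw0 g : aw g finset.set0 = 1.
Proof. by rewrite /aw big_set0. Qed.

Lemma aw1 g i : aw g [set i]%SET = hh (g i).
Proof.
rewrite /aw big_set1 (_ : is_min _ _ = true) //.
by apply/forallP => k; rewrite inE; apply/implyP => /eqP ->.
Qed.

(** If another letter is left, the largest index is not the smallest one, so its factor is [gg], and
    deleting it does not change which index is smallest. *)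
Lemma aw_max g S i : i \in S -> (forall k, k \in S -> (k <= i)%N) ->
  (S :\ i)%SET != finset.set0 -> aw g S = aw g (S :\ i)%SET * gg (g i).
Proof.
move=> iS imax /set0Pn[k0]; rewrite !inE => /andP[k0i k0S].
rewrite /aw (big_setD1 i) //= mulrC; congr (_ * _).
  apply: eq_bigr => k; rewrite !inE => /andP[ki kS].
  rewrite (_ : is_min S k = is_min (S :\ i)%SET k) //.
  apply/forallP/forallP => h l; apply/implyP.
    by rewrite !inE => /andP[_ lS]; exact: (implyP (h l)).
  move=> lS; have [->|li] := eqVneq l i; first exact: imax.
  by apply: (implyP (h l)); rewrite !inE li.
rewrite (_ : is_min S i = false) //; apply/negP => /forallP/(_ k0); rewrite k0S /=.
rewrite leqNgt => /negP; apply; rewrite ltn_neqAle imax // andbT.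
by [].
Qed.

Lemma set_max S : S != finset.set0 ->
  exists2 i, i \in S & forall k, k \in S -> (k <= i)%N.
Proof.
move=> /set0Pn[k0 k0S].
by case: (@arg_maxnP _ k0 (mem S) (fun k : 'I_m => k : nat) k0S) => i iS im; exists i.
Qed.

(** Both words end with the unitary of index [j], which conjugates the middle matrix; by
    [haar_word2_le] that matrix may be replaced by its normalized trace, which is [gg (g i)]. *)
Lemma word_double S V i j F x y :
  j \in S -> (forall k, k \in S -> (k <= j)%N) ->
  j \in V -> (forall k, k \in V -> (k <= j)%N) ->
  env_gmeas F -> (forall g, 0 <= F g) ->
  (E (fun g h => F g * cabs ((word g h S *m tens_idmx p (g i *m (g i)^t*) *m
        (word g h V)^t*) x y - (gg (g i))%:C%C * (word g h S *m (word g h V)^t*) x y))%R <=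
   E (fun g _ => F g * (fro (g i) ^+ 2 * (wnorm g S * wnorm g V)) * (2 / Num.sqrt p%:R))%R)%E.
Proof.
move=> jS jmax jV jmaxV mF F0.
have mti : env_cmeas (fun g (_ : henv) => tens_idmx p (g i *m (g i)^t*)).
  move=> d D g h mg mh; apply: cmeas_tens => //.
  by apply: cmeas_mul; [exact: mg|apply: cmeas_adj; exact: mg].
have mw : env_cmeas (fun g h => word g h S *m tens_idmx p (g i *m (g i)^t*) *m
        (word g h V)^t* - (gg (g i))%:C%C *: (word g h S *m (word g h V)^t*)).
  apply: env_cmeasB.
    apply: env_cmeas_mul; last by apply: env_cmeas_adj; exact: env_cmeas_word.
    by apply: env_cmeas_mul => //; exact: env_cmeas_word.
  apply: env_cmeas_scale; first exact: env_gmeas_gg.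
  by apply: env_cmeas_mul; [exact: env_cmeas_word|apply: env_cmeas_adj; exact: env_cmeas_word].
have mcw : env_measurable (fun g h => cabs ((word g h S *m tens_idmx p (g i *m (g i)^t*) *m
        (word g h V)^t*) x y - (gg (g i))%:C%C * (word g h S *m (word g h V)^t*) x y)).
  move=> d D g h mg mh; have := env_measurable_cabs x y mw mg mh.
  by under eq_fun do rewrite mxE [X in cabs (_ + X)]mxE [X in cabs (_ - X)]mxE.
apply: (Ex_freezeH hH hind (j := j)).
- exact: env_measurableM.
- apply: env_measurableM; last exact: env_measurable_cst.
  apply: env_measurableM => //; apply: env_measurableM.
    by apply: env_measurableX; apply: env_measurable_fro; exact: env_cmeas_g.
  by apply: env_measurableM; exact: env_measurable_wnorm.
- by move=> g h; rewrite mulr_ge0 ?cabs_ge0.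
- move=> g h; rewrite !mulr_ge0 ?divr_ge0 ?sqrtr_ge0 ?wnorm_ge0 ?exprn_ge0 ?fro_ge0 //.
move=> g h uh.
pose r := row x (word g h (S :\ j)%SET) *m tens_idmx p (g j).
pose s := (row y (word g h (V :\ j)%SET) *m tens_idmx p (g j))^t*.
pose B := tens_idmx p (g i *m (g i)^t*).
have jS' : j \notin (S :\ j)%SET by rewrite !inE eqxx.
have jV' : j \notin (V :\ j)%SET by rewrite !inE eqxx.
have e (U : 'M[C]_p) : F g * cabs ((word g (upd h j U) S *m B *m
    (word g (upd h j U) V)^t*) x y -
    (gg (g i))%:C%C * (word g (upd h j U) S *m (word g (upd h j U) V)^t*) x y) =
    F g * cabs ((r *m U *m B *m U^t* *m s) 0 0 - (gg (g i))%:C%C * (r *m U *m U^t* *m s) 0 0).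
  rewrite -[X in _ * (X *m _) x y]mulmx1 !word_pair_entry mulmx1.
  rewrite (word_max _ _ jS jmax) (word_max _ _ jV jmaxV).
  rewrite (word_updh _ _ _ jS') (word_updh _ _ _ jV') /upd eqxx !row_mul -/r.
  by rewrite trmx_mul map_mxM /= -/s !mulmxA.
under eq_integral do rewrite e EFinM.
have pB : psd B.
  by rewrite /B tens_idmxM // tens_idmx_adj //; exact: psd_mul_adj.
have tB : gg (g i) = complex.Re (\tr B) / p%:R.
  rewrite /B tr_tens // tr_mul_adj -(rmorph_nat (real_complex R)) -rmorphM /= /gg.
  have hq : (p%:R : R) = n%:R * (p %/ n)%:R by rewrite -natrM tens_dim.
  rewrite hq; have q0 : ((p %/ n)%:R : R) != 0.
    by rewrite pnatr_eq0 -lt0n divn_gt0 // ltnW.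
  have n0 : (n%:R : R) != 0 by rewrite pnatr_eq0 -lt0n.
  by field; rewrite n0 q0.
rewrite ge0_integralZl_EFin //; last 2 first.
- by move=> U _; rewrite lee_fin cabs_ge0.
- apply/measurable_EFinP; apply: (bdd_meas_cabs (z := fun U =>
    (r *m U *m B *m U^t* *m s) 0 0 - (gg (g i))%:C%C * (r *m U *m U^t* *m s) 0 0) _).1.
  apply: cbddD; first exact: cbdd_quad.
  have := cbddM (cbdd_cst _ (- (gg (g i))%:C%C)) (cbdd_quad r s 1%:M).
  by under eq_fun do rewrite mulNr mulmx1.
apply: le_trans (lee_wpmul2l _ (haar_word2_le (hH j) r s p1 pB tB)) _; first by rewrite lee_fin.
rewrite -EFinM lee_fin -[X in _ <= X]mulrA ler_wpM2l //.
have hr : fro r <= wnorm g S.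
  rewrite (wnormD1 g jS); apply: le_trans (fro_mul_tens _ _ _) _ => //.
  by rewrite ler_wpM2r ?fro_ge0 // fro_row_word.
have hs : fro s <= wnorm g V.
  rewrite fro_adj (wnormD1 g jV); apply: le_trans (fro_mul_tens _ _ _) _ => //.
  by rewrite ler_wpM2r ?fro_ge0 // fro_row_word.
have sp : 0 < Num.sqrt p%:R :> R by rewrite sqrtr_gt0 ltr0n ltnW.
(* Tensoring with the identity costs the square root of [p %/ n]. Against the factor [1 / p] of
   [haar_word2_le] this leaves the rate [p ^ (-1/2)]. *)
have hB : fro B <= Num.sqrt p%:R * fro (g i) ^+ 2.
  rewrite /fro /B fro2_tens // sqrtrM //.
  rewrite ler_pM ?sqrtr_ge0 //; first by rewrite ler_wsqrtr // ler_nat leq_div.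
  rewrite expr2 -sqrtrM ?fro2_ge0 // ler_wsqrtr //.
  by apply: le_trans (fro2_mul _ _) _; rewrite fro2_adj.
have -> : p%:R^-1 = (Num.sqrt p%:R)^-1 * (Num.sqrt p%:R)^-1 :> R.
  by rewrite -invfM -expr2 sqr_sqrtr.
rewrite [X in _ <= X](_ : _ = 2 * (wnorm g S * wnorm g V) * (Num.sqrt p%:R * fro (g i) ^+ 2) *
   ((Num.sqrt p%:R)^-1 * (Num.sqrt p%:R)^-1)); last by field; rewrite gt_eqF.
rewrite ler_wpM2r ?mulr_ge0 ?invr_ge0 ?sqrtr_ge0 //.
apply: ler_pM => //; rewrite ?mulr_ge0 ?fro_ge0 //.
by rewrite ler_wpM2l // ler_pM ?fro_ge0.
Qed.

End WordLimits.

(** * Distance of words from their scalar limits *)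

Section WordDistance.
Context (R : realType) (m n p : nat) (disp : measure_display)
  (T : measurableType disp) (P : probability T R)
  (G : 'I_m -> {RV P >-> borel_mx R n}) (H : 'I_m -> {RV P >-> borel_mx R p}).
Hypothesis hH : forall i : 'I_m, haar_unitary (distribution P (H i)).
Hypothesis hind : mutually_independent P (fun k : 'I_m + 'I_m =>
       match k with
       | inl i => g_sigma_algebra_preimage (G i)
       | inr i => g_sigma_algebra_preimage (H i)
       end).
Hypotheses (hn : (0 < n)%N) (hnp : (n < p)%N) (hdvd : (n %| p)%N).
Local Notation C := R[i].
Local Notation genv := ('I_m -> 'M[C]_n).
Local Notation henv := ('I_m -> 'M[C]_p).
Local Notation E := (Ex G H).
Local Notation env_gmeas F := (@env_gmeas R m n p F).
Local Notation aw := (aw hn).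
Implicit Types (g : genv) (h : henv) (S V : {set 'I_m}) (F : genv -> R).

Definition wdiff g h S V (x y : 'I_p) : C :=
  (word g h S *m (word g h V)^t*) x y
  - (if (S == V) && (x == y) then (aw g S)%:C%C else 0).

Lemma wdiff_sym g h S V x y : cabs (wdiff g h S V x y) = cabs (wdiff g h V S y x).
Proof.
rewrite -[RHS]cabs_conj; congr cabs; rewrite /wdiff rmorphB /=; congr (_ - _).
  have -> : word g h S *m (word g h V)^t* = (word g h V *m (word g h S)^t*)^t*.
    by rewrite trmx_mul map_mxM /= trmxCK.
  by rewrite !mxE.
rewrite [V == S]eq_sym [y == x]eq_sym; case: ifP => [/andP[/eqP -> _]|_].
  by apply/eqP; rewrite eq_complex /= oppr0 !eqxx.
by rewrite conjC0.
Qed.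

Lemma env_measurable_wdiff S V x y : env_measurable (fun g h => cabs (wdiff g h S V x y)).
Proof.
have mw : env_cmeas (fun g h => word g h S *m (word g h V)^t* -
    (aw g S)%:C%C *: (if (S == V) then 1%:M else 0) : 'M[C]_p).
  apply: env_cmeasB.
    by apply: env_cmeas_mul; [exact: env_cmeas_word|apply: env_cmeas_adj; exact: env_cmeas_word].
  apply: env_cmeas_scale; first exact: env_gmeas_aw.
  by case: ifP => _; exact: env_cmeas_cst.
move=> d D g h mg mh; have := env_measurable_cabs x y mw mg mh.
congr measurable_fun; apply/funext => w; rewrite /wdiff; congr cabs.
rewrite mxE [X in _ + X]mxE [X in _ - X]mxE; congr (_ - _).
by case: eqP => _; rewrite mxE /= ?mulr0 //; case: eqP => _; rewrite ?mulr1 ?mulr0.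
Qed.

Lemma wdiff_le g h S V x y : (forall i, h i \is unitarymx) ->
  cabs (wdiff g h S V x y) <= 2 * (wnorm g S * wnorm g V).
Proof.
move=> uh; apply: le_trans (cabsD _ _) _; rewrite cabsN mulr2n mulrDl !mul1r lerD //.
  exact: word_pair_le.
case: ifP => [/andP[/eqP -> _]|_]; last by rewrite cabs0 mulr_ge0 ?wnorm_ge0.
by rewrite cabs_real ger0_norm ?aw_ge0 // -expr2 aw_le.
Qed.

Lemma eq_Ex Phi Psi : (forall g h, Phi g h = Psi g h) -> E Phi = E Psi.
Proof. by move=> e; congr Ex; apply/funext => g; apply/funext => h. Qed.

Lemma word_pair_same_max g h S V i : (forall k, h k \is unitarymx) ->
  i \in S -> (forall k, k \in S -> (k <= i)%N) ->
  i \in V -> (forall k, k \in V -> (k <= i)%N) ->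
  word g h S *m (word g h V)^t* =
  word g h (S :\ i)%SET *m tens_idmx p (g i *m (g i)^t*) *m (word g h (V :\ i)%SET)^t*.
Proof.
move=> uh iS imax iV imaxV.
rewrite (word_max _ _ iS imax) (word_max _ _ iV imaxV) !trmx_mul !map_mxM /= !mulmxA.
by rewrite mulmxtVK // tens_idmxM // tens_idmx_adj // !mulmxA.
Qed.

Let sp0 : 0 <= (Num.sqrt p%:R)^-1 :> R.
Proof. by rewrite invr_ge0 sqrtr_ge0. Qed.

Let env_gmeasM F F' : env_gmeas F -> env_gmeas F' -> env_gmeas (fun g => F g * F' g).
Proof. exact: env_measurableM. Qed.

Let env_gmeas_wnorm S : env_gmeas (fun g => wnorm g S).
Proof. exact: env_measurable_wnorm. Qed.

Lemma word_single_le S V j F x y : S != V ->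
  j \in S -> (forall k, k \in S -> (k <= j)%N) -> j \notin V ->
  env_gmeas F -> (forall g, 0 <= F g) ->
  (E (fun g h => F g * cabs (wdiff g h S V x y))%R <=
   E (fun g _ => F g * (wnorm g S * wnorm g V) / Num.sqrt p%:R)%R)%E.
Proof.
move=> SV jS jmax jV mF F0.
have eL : E (fun g h => F g * cabs (wdiff g h S V x y)) = E (fun g h =>
    F g * cabs ((word g h S *m 1%:M *m (word g h V)^t*) x y)).
  by apply: eq_Ex => g h; rewrite /wdiff (negbTE SV) subr0 mulmx1.
have eR : E (fun g _ => F g * (wnorm g S * wnorm g V) / Num.sqrt p%:R) = E (fun g _ =>
    F g * (1 * (wnorm g S * wnorm g V)) / Num.sqrt p%:R).
  by apply: eq_Ex => g h; rewrite mul1r.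
rewrite eL eR.
apply: (word_single hH hind hdvd x y jS jmax jV (B := fun=> 1%:M) (beta := fun=> 1)) => //.
by move=> g v; rewrite trmx1 map_mx1 mulmx1 mul1r.
Qed.

Lemma word_single_mid_le S V i j F x y :
  j \in S -> (forall k, k \in S -> (k <= j)%N) -> j \notin V ->
  env_gmeas F -> (forall g, 0 <= F g) ->
  (E (fun g h => F g * cabs ((word g h S *m tens_idmx p (g i *m (g i)^t*) *m
       (word g h V)^t*) x y))%R <=
   E (fun g _ => F g * (fro (g i) ^+ 2 * (wnorm g S * wnorm g V)) / Num.sqrt p%:R)%R)%E.
Proof.
move=> jS jmax jV mF F0.
apply: (word_single hH hind hdvd x y jS jmax jV (B := fun g => tens_idmx p (g i *m (g i)^t*))) => //.
- move=> d D g h mg mh; apply: cmeas_tens => //.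
  by apply: cmeas_mul; [exact: mg|apply: cmeas_adj; exact: mg].
- by apply: env_measurableX; apply: env_measurable_fro; exact: env_cmeas_g.
- by move=> g; exact: sqr_ge0.
move=> g v; rewrite tens_idmxM // tens_idmx_adj // trmx_mul map_mxM /= trmxCK.
rewrite -tens_idmx_adj // mulmxA.
apply: le_trans (fro_mul_tens _ _ _) _ => //.
apply: le_trans (ler_wpM2r (fro_ge0 _) (fro_mul_tens _ _ _)) _ => //.
by rewrite ?fro_adj le_eqVlt; apply/orP; left; apply/eqP; ring.
Qed.

Lemma word_pair_mid_sym g h S V i x y :
  cabs ((word g h S *m tens_idmx p (g i *m (g i)^t*) *m (word g h V)^t*) x y) =
  cabs ((word g h V *m tens_idmx p (g i *m (g i)^t*) *m (word g h S)^t*) y x).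
Proof.
rewrite -[RHS]cabs_conj; congr cabs.
have -> : word g h S *m tens_idmx p (g i *m (g i)^t*) *m (word g h V)^t* =
    (word g h V *m tens_idmx p (g i *m (g i)^t*) *m (word g h S)^t*)^t*.
  rewrite !trmx_mul !map_mxM /= trmxCK -tens_idmx_adj // trmx_mul map_mxM /= trmxCK.
  by rewrite mulmxA.
by rewrite !mxE.
Qed.

Let mbound S V F (c : R) : env_gmeas F ->
  env_gmeas (fun g => F g * (wnorm g S * wnorm g V) * c).
Proof.
move=> mF; apply: env_gmeasM; last exact: env_measurable_cst.
by apply: env_gmeasM => //; apply: env_gmeasM; exact: env_gmeas_wnorm.
Qed.

Let bound0 S V F (c : R) g : (forall g, 0 <= F g) -> 0 <= c ->
  0 <= F g * (wnorm g S * wnorm g V) * c.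
Proof. by move=> F0 c0; rewrite !mulr_ge0 ?wnorm_ge0. Qed.

Let weaken k S V F (X : \bar R) : env_gmeas F -> (forall g, 0 <= F g) ->
  (X <= E (fun g _ => F g * (wnorm g S * wnorm g V) / Num.sqrt p%:R)%R)%E ->
  (X <= E (fun g _ => F g * (wnorm g S * wnorm g V) * (2 * k.+1%:R / Num.sqrt p%:R))%R)%E.
Proof.
move=> mF F0 /le_trans; apply; apply: Ex_le => //.
- exact: mbound.
- exact: mbound.
- by move=> g h; exact: bound0.
- by move=> g h; rewrite bound0 // mulr_ge0 // mulr_ge0.
- move=> g h _; rewrite ler_wpM2l ?mulr_ge0 ?wnorm_ge0 //.
  by rewrite ler_peMl // -natrM ler1n.
Qed.

Let mFw S V F x y : env_gmeas F ->
  env_measurable (fun g h => F g * cabs (wdiff g h S V x y)).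
Proof. by move=> mF; apply: env_measurableM => //; exact: env_measurable_wdiff. Qed.

Let mmid S V i F x y : env_gmeas F ->
  env_measurable (fun g h => F g * cabs ((word g h S *m tens_idmx p (g i *m (g i)^t*) *m
       (word g h V)^t*) x y)).
Proof.
move=> mF; apply: env_measurableM => //; apply: env_measurable_cabs.
apply: env_cmeas_mul; last by apply: env_cmeas_adj; exact: env_cmeas_word.
apply: env_cmeas_mul; first exact: env_cmeas_word.
move=> d D g h mg mh; apply: cmeas_tens => //.
by apply: cmeas_mul; [exact: mg|apply: cmeas_adj; exact: mg].
Qed.

Let wnormsq g S V i : i \in S -> i \in V ->
  fro (g i) ^+ 2 * (wnorm g (S :\ i)%SET * wnorm g (V :\ i)%SET) = wnorm g S * wnorm g V.
Proof. by move=> iS iV; rewrite (wnormD1 g iS) (wnormD1 g iV); ring. Qed.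

(** Under this size condition the upper left block of a tensored matrix lies inside its first tensor
    block, which is a multiple of the identity. *)
Lemma tens_corner (A : 'M[C]_n) (x y : 'I_p) : (n <= p %/ n)%N -> (x < n)%N -> (y < n)%N ->
  tens_idmx p (A *m A^t*) x y = if x == y then (hh hn A)%:C%C else 0.
Proof.
move=> nq xn yn.
have [a [b [xE a0 bx]]] := tens_idx_val hdvd nq xn.
have [a' [b' [yE a0' by_]]] := tens_idx_val hdvd nq yn.
have ai : a = Ordinal hn by apply: val_inj.
have ai' : a' = Ordinal hn by apply: val_inj.
have -> : (x == y) = (b == b') by rewrite -!val_eqE /= bx by_.
rewrite {1}xE {1}yE tens_idmxE ai ai' /hh; case: eqP => _ //.
rewrite mulr1n -tr_mul_adj /mxtrace big_ord1 !mxE.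
by apply: eq_bigr => k _; rewrite !mxE.
Qed.

(** Let [i] be the largest index of the two sets. If only one set contains it, a single estimate
    ends the proof. Otherwise its unitary cancels and leaves the letter of [i] in the middle, and
    the next largest index [j] decides: in one set only, again a single estimate; in both, the
    middle becomes a scalar and the induction continues without [i]. Each round costs
    [2 / Num.sqrt p]. *)
Lemma word_dist_near S V F (x y : 'I_p) : (n <= p %/ n)%N -> (x < n)%N -> (y < n)%N ->
  env_gmeas F -> (forall g, 0 <= F g) ->
  (E (fun g h => F g * cabs (wdiff g h S V x y))%R <=
   E (fun g _ => F g * (wnorm g S * wnorm g V) * (2 * #|S|.+1%:R / Num.sqrt p%:R))%R)%E.
Proof.
move=> nq xn yn; have [N] := ubnP #|S|; elim: N S V F => // N IH S V F SN mF F0.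
have zero : (forall g h, (forall i, h i \is unitarymx) -> wdiff g h S V x y = 0) ->
  (E (fun g h => F g * cabs (wdiff g h S V x y))%R <=
   E (fun g _ => F g * (wnorm g S * wnorm g V) * (2 * #|S|.+1%:R / Num.sqrt p%:R))%R)%E.
  move=> w0; apply: Ex_le => //.
  - exact: mFw.
  - exact: mbound.
  - by move=> g h; rewrite mulr_ge0 ?cabs_ge0.
  - by move=> g h; rewrite bound0 // mulr_ge0 // mulr_ge0.
  - by move=> g h uh; rewrite w0 // cabs0 mulr0 bound0 // mulr_ge0 // mulr_ge0.
have [U0|Un] := eqVneq (S :|: V)%SET finset.set0.
  move/eqP: U0; rewrite finset.setU_eq0 => /andP[/eqP S0 /eqP V0].
  apply: zero => g h _; rewrite /wdiff S0 V0 eqxx word0 trmx1 map_mx1 mulmx1 mxE /=.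
  by rewrite aw0; case: eqP => _; rewrite subrr.
have [i + imax] := set_max Un; rewrite inE => iU.
have imS k : k \in S -> (k <= i)%N by move=> kS; apply: imax; rewrite inE kS.
have imV k : k \in V -> (k <= i)%N by move=> kV; apply: imax; rewrite inE kV orbT.
have neq j : (j \in S) != (j \in V) -> S != V.
  by move=> h; apply: contra_neq h => ->.
case iS : (i \in S); case iV : (i \in V); last by rewrite iS iV in iU.
- pose S' := (S :\ i)%SET; pose V' := (V :\ i)%SET.
  have SS' : #|S| = #|S'|.+1 by rewrite (cardsD1 i) iS.
  have mid g h : (forall k, h k \is unitarymx) ->
      word g h S *m (word g h V)^t* =
      word g h S' *m tens_idmx p (g i *m (g i)^t*) *m (word g h V')^t*.
    by move=> uh; exact: word_pair_same_max.
  (* Both sets are the singleton of [i]: no unitary is left and the limit is attained exactly. This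
     is where [n <= p %/ n] enters. *)
  have [U0|Un'] := eqVneq (S' :|: V')%SET finset.set0.
    move/eqP: U0; rewrite finset.setU_eq0 => /andP[/eqP S0 /eqP V0].
    have Si : S = [set i]%SET by rewrite -(finset.setD1K iS) -/S' S0 finset.setU0.
    have Vi : V = [set i]%SET by rewrite -(finset.setD1K iV) -/V' V0 finset.setU0.
    apply: zero => g h uh; rewrite /wdiff mid // S0 V0 !word0 mul1mx trmx1 map_mx1 mulmx1.
    by rewrite Si Vi eqxx aw1 tens_corner //=; case: eqP => _; rewrite subrr.
  have [j + jmax] := set_max Un'; rewrite inE => jU.
  have jmS k : k \in S' -> (k <= j)%N by move=> kS; apply: jmax; rewrite inE kS.
  have jmV k : k \in V' -> (k <= j)%N by move=> kV; apply: jmax; rewrite inE kV orbT.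
  case jS : (j \in S'); case jV : (j \in V'); last by rewrite jS jV in jU.
  + pose c1 : R := 2 / Num.sqrt p%:R.
    pose c2 : R := 2 * #|S'|.+1%:R / Num.sqrt p%:R.
    have c10 : 0 <= c1 by rewrite mulr_ge0.
    have c20 : 0 <= c2 by rewrite mulr_ge0 ?mulr_ge0.
    (* The scalar produced by the averaging moves into the weight, which is why the induction is
       over arbitrary weights. *)
    pose F' g := F g * gg (g i).
    have mF' : env_gmeas F' by apply: env_gmeasM => //; exact: env_gmeas_gg.
    have F'0 g : 0 <= F' g by rewrite mulr_ge0 ?gg_ge0.
    pose D g h := cabs ((word g h S' *m tens_idmx p (g i *m (g i)^t*) *m
        (word g h V')^t*) x y - (gg (g i))%:C%C * (word g h S' *m (word g h V')^t*) x y).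
    have mD : env_measurable D.
      have mw : env_cmeas (fun g h => word g h S' *m tens_idmx p (g i *m (g i)^t*) *m
          (word g h V')^t* - (gg (g i))%:C%C *: (word g h S' *m (word g h V')^t*)).
        apply: env_cmeasB.
          apply: env_cmeas_mul; last by apply: env_cmeas_adj; exact: env_cmeas_word.
          apply: env_cmeas_mul; first exact: env_cmeas_word.
          move=> d DD g h mg mh; apply: cmeas_tens => //.
          by apply: cmeas_mul; [exact: mg|apply: cmeas_adj; exact: mg].
        apply: env_cmeas_scale; first exact: env_gmeas_gg.
        by apply: env_cmeas_mul; [exact: env_cmeas_word
          |apply: env_cmeas_adj; exact: env_cmeas_word].
      move=> d DD g h mg mh; have := env_measurable_cabs x y mw mg mh.
      by under eq_fun do rewrite mxE [X in cabs (_ + X)]mxE [X in cabs (_ - X)]mxE.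
    have D0 g h : 0 <= D g h by exact: cabs_ge0.
    apply: (@le_trans _ _ (E (fun g h => F g * D g h + F' g * cabs (wdiff g h S' V' x y)))).
      apply: Ex_le => //.
      - exact: mFw.
      - by apply: env_measurableD; [exact: env_measurableM|exact: mFw].
      - by move=> g h; rewrite mulr_ge0 ?cabs_ge0.
      - by move=> g h; rewrite addr_ge0 // mulr_ge0 ?cabs_ge0.
      move=> g h uh; rewrite /F' -mulrA -mulrDr ler_wpM2l //.
      have -> : gg (g i) * cabs (wdiff g h S' V' x y) =
          cabs ((gg (g i))%:C%C * wdiff g h S' V' x y).
        by rewrite cabsM cabs_real ger0_norm ?gg_ge0.
      apply: le_trans (cabsD _ _); rewrite le_eqVlt; apply/orP; left; apply/eqP.
      congr cabs; rewrite /wdiff mid // [in RHS]mulrBr addrA subrK; congr (_ - _).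
      have -> : (S == V) = (S' == V').
        apply/eqP/eqP => [e|e]; first by rewrite /S' /V' e.
        by rewrite -(finset.setD1K iS) -(finset.setD1K iV) -/S' -/V' e.
      case: eqP => [e|_] /=; last by rewrite mulr0.
      case: eqP => _; last by rewrite mulr0.
      rewrite (aw_max hn g iS imS); first by rewrite rmorphM mulrC.
      by apply/set0Pn; exists j; rewrite jS.
    rewrite ExD //; last 4 first.
    - exact: env_measurableM.
    - exact: mFw.
    - by move=> g h; rewrite mulr_ge0.
    - by move=> g h; rewrite mulr_ge0 ?cabs_ge0.
    have S'N : (#|S'| < N)%N by rewrite -ltnS -SS'.
    apply: (le_trans (leeD (word_double hH hind hn hnp hdvd i x y jS jmS jV jmV mF F0)
      (IH S' V' F' S'N mF' F'0))).
    have mA : env_gmeas (fun g => F g * (fro (g i) ^+ 2 * (wnorm g S' * wnorm g V')) * c1).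
      apply: env_gmeasM; last exact: env_measurable_cst.
      apply: env_gmeasM => //; apply: env_gmeasM.
        by apply: env_measurableX; apply: env_measurable_fro; exact: env_cmeas_g.
      by apply: env_gmeasM; exact: env_gmeas_wnorm.
    have A0 g (h : henv) : 0 <= F g * (fro (g i) ^+ 2 * (wnorm g S' * wnorm g V')) * c1.
      by rewrite !mulr_ge0 ?wnorm_ge0 ?sqr_ge0 ?fro_ge0.
    have B0 g (h : henv) : 0 <= F' g * (wnorm g S' * wnorm g V') * c2.
      exact: bound0.
    rewrite -(ExD G H mA (@mbound S' V' F' c2 mF') A0 B0).
    apply: Ex_le => //.
    - by apply: env_measurableD => //; exact: mbound.
    - exact: mbound.
    - by move=> g h; rewrite addr_ge0 ?A0 ?B0.
    - by move=> g h; rewrite bound0 // mulr_ge0 // mulr_ge0.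
    move=> g h _; rewrite -/c1 -/c2.
    have -> : 2 * #|S|.+1%:R / Num.sqrt p%:R = c1 + c2 :> R.
      by rewrite SS' /c1 /c2 -natr1; ring.
    rewrite wnormsq // mulrDr lerD2l /F' ler_wpM2r // -mulrA ler_wpM2l //.
    rewrite -(wnormsq g iS iV) ler_wpM2r ?mulr_ge0 ?wnorm_ge0 //.
    exact: gg_le.
  (* Now [j] lies in one set only, and the letter of [i] stays as the middle factor of a single
     estimate. *)
  + have SV : S != V.
      apply: (neq j); move: jS jV; rewrite !inE; case: eqP => //= _ -> ->; by [].
    apply: weaken => //.
    apply: (@le_trans _ _ (E (fun g h => F g * cabs ((word g h S' *m
       tens_idmx p (g i *m (g i)^t*) *m (word g h V')^t*) x y)))).
      apply: Ex_le => //.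
      - exact: mFw.
      - exact: mmid.
      - by move=> g h; rewrite mulr_ge0 ?cabs_ge0.
      - by move=> g h; rewrite mulr_ge0 ?cabs_ge0.
      by move=> g h uh; rewrite /wdiff (negbTE SV) subr0 mid.
    apply: le_trans (word_single_mid_le i x y jS jmS (negbT jV) mF F0) _.
    rewrite (eq_Ex (Psi := fun g _ => F g * (wnorm g S * wnorm g V) / Num.sqrt p%:R)) //.
    by move=> g h; rewrite wnormsq.
  + have SV : S != V.
      apply: (neq j); move: jS jV; rewrite !inE; case: eqP => //= _ -> ->; by [].
    apply: weaken => //.
    apply: (@le_trans _ _ (E (fun g h => F g * cabs ((word g h V' *m
       tens_idmx p (g i *m (g i)^t*) *m (word g h S')^t*) y x)))).
      apply: Ex_le => //.
      - exact: mFw.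
      - exact: mmid.
      - by move=> g h; rewrite mulr_ge0 ?cabs_ge0.
      - by move=> g h; rewrite mulr_ge0 ?cabs_ge0.
      by move=> g h uh; rewrite /wdiff (negbTE SV) subr0 mid // word_pair_mid_sym.
    apply: le_trans (word_single_mid_le i y x jV jmV (negbT jS) mF F0) _.
    rewrite (eq_Ex (Psi := fun g _ => F g * (wnorm g S * wnorm g V) / Num.sqrt p%:R)) //.
    by move=> g h; rewrite wnormsq // [wnorm g V * _]mulrC.
- apply: weaken => //; apply: (word_single_le x y _ iS imS (negbT iV)) => //.
  by apply: (neq i); rewrite iS iV.
- apply: weaken => //.
  rewrite (eq_Ex (Psi := fun g h => F g * cabs (wdiff g h V S y x))); last first.
    by move=> g h; rewrite wdiff_sym.
  apply: le_trans (word_single_le y x _ iV imV (negbT iS) mF F0) _.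
    by rewrite eq_sym; apply: (neq i); rewrite iS iV.
  rewrite (eq_Ex (Psi := fun g _ => F g * (wnorm g S * wnorm g V) / Num.sqrt p%:R)) //.
  by move=> g h; rewrite [wnorm g V * _]mulrC.
Qed.

(** The summand [m] covers the length of the induction, the summand [n] the case [p %/ n < n]. *)
Definition dist_cst : R := 2 * (m + n).+1%:R.

Lemma word_dist S V F (x y : 'I_p) : (x < n)%N -> (y < n)%N ->
  env_gmeas F -> (forall g, 0 <= F g) ->
  (E (fun g h => F g * cabs (wdiff g h S V x y))%R <=
   E (fun g _ => F g * (wnorm g S * wnorm g V) * (dist_cst / Num.sqrt p%:R))%R)%E.
Proof.
move=> xn yn mF F0.
have cst0 : 0 <= dist_cst by rewrite mulr_ge0.
have [nq|qn] := leqP n (p %/ n)%N.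
  apply: le_trans (word_dist_near S V nq xn yn mF F0) _; apply: Ex_le => //.
  - exact: mbound.
  - exact: mbound.
  - by move=> g h; rewrite bound0 // mulr_ge0 // mulr_ge0.
  - by move=> g h; rewrite bound0 // mulr_ge0.
  move=> g h _; rewrite ler_wpM2l ?mulr_ge0 ?wnorm_ge0 // ler_wpM2r // ler_wpM2l // ler_nat.
  by rewrite ltnS (leq_trans (max_card _)) // card_ord leq_addr.
apply: Ex_le => //.
- exact: mFw.
- exact: mbound.
- by move=> g h; rewrite mulr_ge0 ?cabs_ge0.
- by move=> g h; rewrite bound0 // mulr_ge0.
(* Here [p] is at most [n ^ 2], so the trivial bound on [wdiff] is already of the claimed order. *)
move=> g h uh; rewrite -mulrA ler_wpM2l //.
apply: le_trans (wdiff_le _ _ _ _ _ uh) _; rewrite mulrC ler_wpM2l ?mulr_ge0 ?wnorm_ge0 //.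
have sp : 0 < Num.sqrt p%:R :> R by rewrite sqrtr_gt0 ltr0n (leq_trans _ hnp).
rewrite ler_pdivlMr // /dist_cst ler_wpM2l //.
apply: (@le_trans _ _ (Num.sqrt (n%:R ^+ 2))).
  by rewrite ler_wsqrtr // -natrX ler_nat -(tens_dim hdvd) expnS expn1 leq_mul2l (ltnW qn) orbT.
by rewrite sqrtr_sqr ger0_norm // ler_nat leqW // leq_addl.
Qed.

End WordDistance.

(** * Expansion of the trace *)

Section Corner.
Context (R : realType) (n p : nat).
Hypothesis hnp : (n <= p)%N.
Local Notation C := R[i].

(** Its adjoint is an isometric embedding, and padding [A] with zeros is [corner^T *m A *m corner];
    this form makes the reduction of traces to size [n] an algebraic identity. *)
Definition corner : 'M[C]_(n, p) := \matrix_(i, x) ((i : nat) == x)%:R.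

Lemma corner_adj : corner^t* = corner^T.
Proof.
by apply/matrixP => i j; rewrite !mxE; case: eqP => _; rewrite ?conjC1 ?conjC0.
Qed.

Lemma corner_mul k (Z : 'M[C]_(p, k)) i y : (corner *m Z) i y = Z (widen_ord hnp i) y.
Proof.
rewrite mxE (bigD1 (widen_ord hnp i)) //= mxE /= eqxx mul1r big1 ?addr0 // => x xi.
rewrite mxE; case: eqP => [e|_]; last by rewrite mul0r.
by case/eqP: xi; apply: val_inj.
Qed.

Lemma corner_conj (Z : 'M[C]_p) i j :
  (corner *m Z *m corner^T) i j = Z (widen_ord hnp i) (widen_ord hnp j).
Proof.
rewrite -[corner *m Z]trmxK -trmx_mul mxE corner_mul mxE corner_mul.
by [].
Qed.

Lemma corner_mulT : corner *m corner^T = 1%:M.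
Proof.
apply/matrixP => i j; rewrite corner_mul !mxE /=.
by rewrite eq_sym.
Qed.

Lemma fro_mul_corner k (A : 'M[C]_(k, n)) : fro (A *m corner) = fro A.
Proof.
rewrite /fro; congr Num.sqrt; apply: (@complexI R); rewrite -!tr_mul_adj.
by rewrite trmx_mul map_mxM /= corner_adj -mulmxA [corner *m _]mulmxA corner_mulT mul1mx.
Qed.

Lemma iotamx_corner (A : 'M[C]_n) : iotamx p A = corner^T *m A *m corner.
Proof.
rewrite /iotamx; have e : (n + (p - n) = p)%N by rewrite subnKC.
rewrite -(conform_castmx (e, e)) conform_mx_id.
have gen (a b : nat) (ab : a = b) (X : 'M[C]_(n, a)) :
    castmx (ab, ab) (X^T *m A *m X) =
    (castmx (erefl, ab) X)^T *m A *m castmx (erefl, ab) X.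
  by case: b / ab; rewrite !castmx_id.
have -> : corner = castmx (erefl, e) (row_mx 1%:M 0).
  apply/matrixP => i x; rewrite castmxE /= cast_ord_id !mxE.
  case: splitP => [k|k] /= ->; rewrite mxE -?val_eqE //.
  by case: eqP => // ik; have := ltn_ord i; rewrite ik ltnNge leq_addr.
rewrite -gen; congr castmx; rewrite tr_row_mx trmx1 trmx0 mul_col_mx mul1mx mul0mx.
by rewrite mul_col_row mulmx1 mulmx0 !mul0mx.
Qed.

End Corner.

Section TraceExpansion.
Context (R : realType).
Local Notation C := R[i].

Lemma tr_abs_powE n K (A : 'M[C]_n) :
  tr_abs_pow (2 * K) A = complex.Re (\tr ((A *m A^t*) ^+ K)).
Proof. by have [_ <-] := absmxP A; rewrite /tr_abs_pow exprM. Qed.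

Lemma exp_sum n (I : finType) (B : I -> 'M[C]_n) K :
  (\sum_i B i) ^+ K = \sum_(f : {ffun 'I_K -> I}) \prod_(k < K) B (f k).
Proof.
rewrite -(bigA_distr_bigA (fun (_ : 'I_K) i => B i)).
by rewrite prodr_const card_ord.
Qed.

Lemma tr_exp_sum n (I : finType) (B : I -> 'M[C]_n) K :
  \tr ((\sum_i B i) ^+ K) = \sum_(f : {ffun 'I_K -> I}) \tr (\prod_(k < K) B (f k)).
Proof. by rewrite exp_sum raddf_sum. Qed.

Lemma cabs_tr_prod n (I : Type) (r : seq I) (A : I -> 'M[C]_n) (a : I -> R) :
  (forall i, fro (A i) <= a i) ->
  cabs (\tr (\prod_(i <- r) A i)) <= n%:R * \prod_(i <- r) a i.
Proof.
case: r => [|i r] hA.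
  rewrite !big_nil mulr1 mxtrace1 -(rmorph_nat (real_complex R)) cabs_real.
  by rewrite ger0_norm.
apply: le_trans (cabs_tr _) _; rewrite ler_wpM2l // !big_cons.
exact: fro_prod.
Qed.

(** Telescoping, one factor at a time. A common bound [c] for both families makes the remaining
    product the same for all terms. *)
Lemma fro_prodB n (I : eqType) (r : seq I) (A B : I -> 'M[C]_n) (c : I -> R) : uniq r ->
  (forall i, fro (A i) <= c i) -> (forall i, fro (B i) <= c i) ->
  fro (\prod_(i <- r) A i - \prod_(i <- r) B i) <=
  \sum_(i <- r) fro (A i - B i) * \prod_(j <- r | j != i) c j.
Proof.
move=> + hA hB.
have c0 i : 0 <= c i by exact: le_trans (fro_ge0 _) (hA i).
elim: r => [|i r IH]; first by rewrite !big_nil subrr fro0.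
move=> /= /andP[ir ur]; rewrite !big_cons eqxx /=.
have -> : A i * (\prod_(j <- r) A j) - B i * (\prod_(j <- r) B j) =
   (A i - B i) * (\prod_(j <- r) A j) +
   B i * (\prod_(j <- r) A j - \prod_(j <- r) B j).
  by rewrite mulrBl mulrBr addrA subrK.
apply: le_trans (froD _ _) _; apply: lerD.
  rewrite (_ : \prod_(j <- r | j != i) c j = \prod_(j <- r) c j).
    by apply: fro_prod.
  rewrite big_seq_cond [RHS]big_seq; apply: eq_bigl => j.
  by case jr : (j \in r) => //=; apply: contraNneq ir => <-.
apply: le_trans (fro_mul _ _) _.
apply: (@le_trans _ _ (c i * \sum_(j <- r) fro (A j - B j) * \prod_(l <- r | l != j) c l)).
  by rewrite ler_pM ?fro_ge0 ?IH.
rewrite mulr_sumr !big_seq; apply: ler_sum => j jr.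
have ij : i != j by apply: contraNneq ir => ->.
by rewrite big_cons ij mulrCA.
Qed.

Lemma cabs_tr_prodB n K (A B : 'I_K -> 'M[C]_n) (c : 'I_K -> R) :
  (forall i, fro (A i) <= c i) -> (forall i, fro (B i) <= c i) ->
  cabs (\tr (\prod_(i < K) A i) - \tr (\prod_(i < K) B i)) <=
  n%:R * \sum_(i < K) fro (A i - B i) * \prod_(j < K | j != i) c j.
Proof.
move=> hA hB; rewrite -raddfB /=; apply: le_trans (cabs_tr _) _.
by rewrite ler_wpM2l // fro_prodB // index_enum_uniq.
Qed.

End TraceExpansion.

Section Reduction.
Context (R : realType) (m n p : nat).
Hypotheses (hnp : (n <= p)%N) (hdvd : (n %| p)%N).
Local Notation C := R[i].
Local Notation genv := ('I_m -> 'M[C]_n).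
Local Notation henv := ('I_m -> 'M[C]_p).
Variable Q : ncpoly R m n.
Implicit Types (g : genv) (h : henv) (S V : {set 'I_m}).

Definition cword g h S : 'M[C]_(n, p) := Q S *m corner R n p *m word g h S.

Definition Ymx g h : 'M[C]_n :=
  \sum_(SV : {set 'I_m} * {set 'I_m}) cword g h SV.1 *m (cword g h SV.2)^t*.

Lemma tr_abs_pow_iota K g h : (0 < K)%N ->
  tr_abs_pow (2 * K) (nceval (ncpoly_iota p Q) (fun i => tens_idmx p (g i) *m h i)) =
  complex.Re (\tr (Ymx g h ^+ K)).
Proof.
case: K => // K _; rewrite tr_abs_powE.
set J := corner R n p; pose M := \sum_S cword g h S.
have -> : nceval (ncpoly_iota p Q) (fun i => tens_idmx p (g i) *m h i) = J^T *m M.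
  rewrite /nceval mulmx_sumr; apply: eq_bigr => S _.
  by rewrite /ncpoly_iota iotamx_corner // /cword !mulmxA.
have JJ : J *m J^T = 1%:M by exact: corner_mulT.
have Jc : J^T^t* = J by rewrite -corner_adj trmxCK.
have -> : J^T *m M *m (J^T *m M)^t* = J^T *m (M *m M^t*) *m J.
  by rewrite trmx_mul map_mxM /= Jc !mulmxA.
have pw : (J^T *m (M *m M^t*) *m J) ^+ K.+1 = J^T *m (M *m M^t*) ^+ K.+1 *m J.
  elim: K => [|K IH]; first by rewrite !expr1.
  rewrite exprS IH [in RHS]exprS -![_ * _]/(_ *m _).
  by rewrite !mulmxA -[_ *m J *m J^T]mulmxA JJ mulmx1.
rewrite pw mxtrace_mulC mulmxA JJ mul1mx; congr (complex.Re (\tr (_ ^+ _))).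
rewrite /Ymx /M -(pair_bigA _ (fun S V => cword g h S *m (cword g h V)^t*)) /=.
rewrite mulmx_suml; apply: eq_bigr => S _.
by rewrite linear_sum /= map_mx_sum mulmx_sumr.
Qed.

Lemma fro_cword g h S : (forall i, h i \is unitarymx) ->
  fro (cword g h S) <= fro (Q S) * wnorm g S.
Proof.
by move=> uh; apply: le_trans (fro_mul_word _ _ _ _ uh) _; rewrite // fro_mul_corner.
Qed.

Lemma env_cmeas_cword S : env_cmeas (fun g h => cword g h S).
Proof. by apply: env_cmeas_mul; [exact: env_cmeas_cst|exact: env_cmeas_word]. Qed.

End Reduction.

(** * Moments of the random coefficients *)

Section OperatorNorm.
Context (R : realType).
Local Notation C := R[i].

Lemma l2norm_fro n (v : 'cV[C]_n) : l2norm v = fro v.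
Proof.
rewrite /l2norm /fro /fro2; congr Num.sqrt; apply: eq_bigr => i _.
by rewrite big_ord1 normc_def /= -/(cabs (v i 0)) sqr_cabs.
Qed.

Lemma fro_mul_opnorm n (A : 'M[C]_n) (v : 'cV[C]_n) : fro (A *m v) <= opnorm A * fro v.
Proof.
have [v0|vn0] := eqVneq (fro v) 0.
  by rewrite v0 mulr0; apply: le_trans (fro_mul _ _) _; rewrite v0 mulr0.
have vp : 0 < fro v by rewrite lt_neqAle eq_sym vn0 fro_ge0.
rewrite -ler_pdivrMr //.
have -> : fro (A *m v) / fro v = fro (A *m ((fro v)^-1%:C%C *: v)).
  by rewrite -scalemxAr froZ ger0_norm ?invr_ge0 ?fro_ge0 // mulrC.
rewrite -l2norm_fro /opnorm; apply: ub_le_sup.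
  exists (fro A) => _ [w /= w1 <-]; rewrite !l2norm_fro in w1 *.
  apply: le_trans (fro_mul _ _) _; by rewrite ler_piMr ?fro_ge0.
exists ((fro v)^-1%:C%C *: v) => //=.
by rewrite l2norm_fro froZ ger0_norm ?invr_ge0 ?fro_ge0 // mulVf.
Qed.

Lemma tr_le_opnorm k n (V : 'M[C]_(k, n)) (A : 'M[C]_n) :
  complex.Re (\tr (V *m A *m V^t*)) <= opnorm A * fro2 V.
Proof.
rewrite /mxtrace cRe_sum /fro2 mulr_sumr; apply: ler_sum => i _.
have -> : (V *m A *m V^t*) i i = (row i V *m (A *m (row i V)^t*)) 0 0.
  rewrite mulmxA -row_mul !mxE; apply: eq_bigr => j _; by rewrite !mxE.
apply: le_trans (Re_le_cabs _) _; apply: le_trans (cabs_le_fro _ _ _) _.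
apply: le_trans (fro_mul _ _) _.
apply: le_trans (ler_wpM2l (fro_ge0 _) (fro_mul_opnorm _ _)) _.
rewrite fro_adj mulrCA -expr2 sqr_fro le_eqVlt; apply/orP; left; apply/eqP.
by congr (_ * _); rewrite /fro2 big_ord1; apply: eq_bigr => j _; rewrite mxE.
Qed.

End OperatorNorm.

Section MatrixMoments.
Context (R : realType) (n : nat) (nu : probability (borel_mx R n) R).
Local Notation C := R[i].

Definition has_mean (f : borel_mx R n -> R) (r : R) : Prop :=
  nu.-integrable setT (EFin \o f) /\ (\int[nu]_x (f x)%:E = r%:E)%E.

Lemma has_meanD f g r s : has_mean f r -> has_mean g s ->
  has_mean (fun x => f x + g x) (r + s).
Proof.
move=> [fi fr] [gi gs]; split.
  by apply: (eq_integrable measurableT _ _ _ (integrableD measurableT fi gi)).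
by have := integralD_EFin measurableT fi gi; rewrite fr gs EFinD.
Qed.

Lemma has_meanZ c f r : has_mean f r -> has_mean (fun x => c * f x) (c * r).
Proof.
move=> [fi fr]; split.
  by apply: (eq_integrable measurableT _ _ _ (integrableZl measurableT c fi)).
by have := integralZl measurableT fi c; rewrite /= fr EFinM.
Qed.

Lemma has_mean0 : has_mean (fun=> 0) 0.
Proof. by split; [exact: integrable0|rewrite integral0]. Qed.

Lemma has_mean_sum (I : Type) (t : seq I) (f : I -> borel_mx R n -> R) (r : I -> R) :
  (forall i, has_mean (f i) (r i)) ->
  has_mean (fun x => \sum_(i <- t) f i x) (\sum_(i <- t) r i).
Proof.
move=> h; elim: t => [|i t IH].
  by under eq_fun do rewrite big_nil; rewrite big_nil; exact: has_mean0.
by under eq_fun do rewrite big_cons; rewrite big_cons; exact: has_meanD.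
Qed.

Lemma has_mean_tr k (V : 'M[C]_(k, n)) (Z : borel_mx R n -> 'M[C]_n) :
  mx_integrable nu Z ->
  has_mean (fun x => complex.Re (\tr (V *m Z x *m V^t*)))
    (complex.Re (\tr (V *m mx_mean nu Z *m V^t*))).
Proof.
move=> Zi; pose M := V^t* *m V.
have trE (B : 'M[C]_n) : complex.Re (\tr (V *m B *m V^t*)) =
    \sum_i \sum_j (complex.Re (M j i) * complex.Re (B i j)
      + (- complex.Im (M j i)) * complex.Im (B i j)).
  rewrite mxtrace_mulC mulmxA -/M mxtrace_mulC /mxtrace cRe_sum.
  apply: eq_bigr => i _; rewrite mxE cRe_sum; apply: eq_bigr => j _.
  by rewrite cReM; ring.
rewrite trE; under eq_fun do rewrite trE.
apply: has_mean_sum => i; apply: has_mean_sum => j; have [ri ii] := Zi i j.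
apply: has_meanD; apply: has_meanZ; split => //; rewrite mxE /= unlock fineK //;
  exact: integrable_fin_num.
Qed.

Hypothesis hG2 : mx_integrable nu (fun G => G *m G^t*).
Hypothesis hG2E : mx_mean nu (fun G => G *m G^t*) = 1%:M.

Lemma has_mean_fro2 k (V : 'M[C]_(k, n)) : has_mean (fun x => fro2 (V *m x)) (fro2 V).
Proof.
have := has_mean_tr V hG2; rewrite hG2E mulmx1 tr_mul_adj /=.
congr has_mean; apply/funext => x.
have -> : V *m (x *m x^t*) *m V^t* = (V *m x) *m (V *m x)^t*.
  by rewrite trmx_mul map_mxM /= !mulmxA.
by rewrite tr_mul_adj.
Qed.

Variables (K : nat) (c : R).
Hypothesis hK : (0 < K)%N.
Hypothesis hGK : mx_integrable nu (fun G => (G *m G^t*) ^+ K).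
Hypothesis hGKE : opnorm (mx_mean nu (fun G => (G *m G^t*) ^+ K)) <= c.

Let mfro2 k (V : 'M[C]_(k, n)) : measurable_fun [set: borel_mx R n] (fun x => fro2 (V *m x)).
Proof.
apply: measurable_fro2; apply: cmeas_mul; first exact: cmeas_cst.
exact/measurable_borel_mx.
Qed.

(** [trace_Jensen] moves the power inside the trace, where it becomes linear in the [K]-th moment
    matrix, whose norm is at most [c]. No power of [n] is lost. *)
Lemma mean_fro2_pow k (V : 'M[C]_(k, n)) :
  (\int[nu]_x (fro2 (V *m x) ^+ K)%:E <= (c * fro2 V ^+ K)%:E)%E.
Proof.
have [hi hm] := has_meanZ (fro2 V ^+ K.-1) (has_mean_tr V hGK).
apply: (@le_trans _ _ (\int[nu]_x (fro2 V ^+ K.-1 *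
    complex.Re (\tr (V *m (x *m x^t*) ^+ K *m V^t*)))%:E)%E).
  apply: ge0_le_integral => //.
  - by move=> x _; rewrite lee_fin exprn_ge0 ?fro2_ge0.
  - by apply/measurable_EFinP; apply: measurable_funX.
  - exact: measurable_int hi.
  move=> x _; rewrite lee_fin.
  have := trace_Jensen K.-1 V (psd_mul_adj x); rewrite prednK //.
  have -> : V *m (x *m x^t*) *m V^t* = (V *m x) *m (V *m x)^t*.
    by rewrite trmx_mul map_mxM /= !mulmxA.
  by rewrite tr_mul_adj.
rewrite hm lee_fin -{3}(prednK hK) exprSr mulrCA ler_wpM2l ?exprn_ge0 ?fro2_ge0 //.
by apply: le_trans (tr_le_opnorm _ _) _; rewrite ler_wpM2r ?fro2_ge0.
Qed.

(** The same argument for the tensored matrix, with the moment matrix estimated slice by slice, so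
    that the constant does not depend on [p]. *)
Lemma mean_fro2_tens_pow p k (V : 'M[C]_(k, p)) : (n %| p)%N ->
  (\int[nu]_x (fro2 (V *m tens_idmx p x) ^+ K)%:E <= (c * fro2 V ^+ K)%:E)%E.
Proof.
move=> hdvd.
have [hi hm] := has_meanZ (fro2 V ^+ K.-1) (has_mean_sum (index_enum _)
  (fun b => has_mean_tr (slice hdvd V b) hGK)).
apply: (@le_trans _ _ (\int[nu]_x (fro2 V ^+ K.-1 * \sum_b
    complex.Re (\tr (slice hdvd V b *m (x *m x^t*) ^+ K *m (slice hdvd V b)^t*)))%:E)%E).
  apply: ge0_le_integral => //.
  - by move=> x _; rewrite lee_fin exprn_ge0 ?fro2_ge0.
  - apply/measurable_EFinP; apply: measurable_funX; apply: measurable_fro2.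
    apply: cmeas_mul; first exact: cmeas_cst.
    by apply: cmeas_tens => //; exact/measurable_borel_mx.
  - exact: measurable_int hi.
  move=> x _; rewrite lee_fin.
  have := trace_Jensen K.-1 V (psd_mul_adj (tens_idmx p x)); rewrite prednK //.
  have -> : V *m (tens_idmx p x *m (tens_idmx p x)^t*) *m V^t* =
      (V *m tens_idmx p x) *m (V *m tens_idmx p x)^t*.
    by rewrite trmx_mul map_mxM /= !mulmxA.
  have eX : tens_idmx p (x *m x^t*) ^+ K = tens_idmx p ((x *m x^t*) ^+ K).
    by rewrite -(prednK hK) tens_idmxX.
  by rewrite tr_mul_adj -tens_idmx_adj // -tens_idmxM // eX tr_mul_tens cRe_sum.
rewrite hm lee_fin -{3}(prednK hK) exprSr mulrCA ler_wpM2l ?exprn_ge0 ?fro2_ge0 //.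
rewrite (fro2_slice hdvd V) mulr_sumr; apply: ler_sum => b _.
by apply: le_trans (tr_le_opnorm _ _) _; rewrite ler_wpM2r ?fro2_ge0.
Qed.

End MatrixMoments.

Section ProductMoments.
Context (R : realType) (d : measure_display) (T : measurableType d)
  (nu : probability T R).

Lemma agm_pow (L : finType) (y : L -> R) : (0 < #|L|)%N -> (forall l, 0 <= y l) ->
  \prod_l y l <= #|L|%:R^-1 * \sum_l y l ^+ #|L|.
Proof.
move=> L0 y0; set M := #|L|.
have M0 : (M%:R : R) != 0 by rewrite pnatr_eq0 -lt0n.
have h1 : \prod_l y l <= (\sum_l M%:R^-1 * y l) ^+ M.
  have := leif_AGM (A := L) (E := y) (fun l _ => y0 l).
  by move=> /= [+ _]; rewrite -mulr_sumr mulrC.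
have Mi (l : L) : 0 <= (fun _ : L => M%:R^-1) l :> R by rewrite invr_ge0.
have h2 := power_mean M.-1 Mi y0.
have e1 : \sum_(l : L) M%:R^-1 = 1 :> R.
  by rewrite sumr_const -/M -(mulr_natr (M%:R^-1) M) mulVf.
rewrite /= prednK // e1 expr1n mul1r in h2.
by apply: le_trans h1 (le_trans h2 _); rewrite mulr_sumr.
Qed.

(** Hölder's inequality for several factors, by dividing each factor by [lam] and applying the
    inequality of the arithmetic and geometric means pointwise. Factors outside [J] are set to 1,
    which keeps the exponent [#|L|] fixed. *)
Lemma moment_prod (L : finType) (J : {set L}) (y : L -> T -> R) (lam : R) :
  0 < lam -> (0 < #|L|)%N ->
  (forall l x, 0 <= y l x) -> (forall l, measurable_fun setT (y l)) ->
  (forall l, l \in J -> \int[nu]_x (y l x ^+ #|L|)%:E <= (lam ^+ #|L|)%:E)%E ->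
  (\int[nu]_x (\prod_(l in J) y l x)%:E <= (lam ^+ #|J|)%:E)%E.
Proof.
move=> lam0 L0 y0 my hy; set M := #|L|.
have lamM : 0 < lam ^+ M by rewrite exprn_gt0.
pose z l x := if l \in J then (lam ^+ M)^-1 * y l x ^+ M else 1.
have z0 l x : 0 <= z l x.
  by rewrite /z; case: ifP => _ //; rewrite mulr_ge0 ?invr_ge0 ?exprn_ge0 // ltW.
have mz l : measurable_fun setT (z l).
  rewrite /z; case: (l \in J); last exact: measurable_cst.
  by apply: measurable_funM; [exact: measurable_cst|exact: measurable_funX].
have hz l : (\int[nu]_x (z l x)%:E <= 1%:E)%E.
  rewrite /z; case: (boolP (l \in J)) => lJ; last by rewrite integral_cst //= probability_setT mule1.
  under eq_integral do rewrite EFinM.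
  rewrite ge0_integralZl_EFin //; last 3 first.
  - by move=> x _; rewrite lee_fin exprn_ge0.
  - by apply/measurable_EFinP; exact: measurable_funX.
  - by rewrite invr_ge0 ltW.
  apply: le_trans (lee_wpmul2l _ (hy l lJ)) _; first by rewrite lee_fin invr_ge0 ltW.
  by rewrite -EFinM mulVf ?gt_eqF.
have key x : \prod_(l in J) y l x <= lam ^+ #|J| * (M%:R^-1 * \sum_l z l x).
  have e : \prod_(l in J) y l x = lam ^+ #|J| * \prod_l (if l \in J then y l x / lam else 1).
    rewrite -big_mkcond /= big_split /= prodr_const exprVn mulrCA mulfV ?mulr1 //.
    by rewrite expf_neq0 // gt_eqF.
  rewrite e ler_wpM2l ?exprn_ge0 ?(ltW lam0) //.
  apply: le_trans (agm_pow L0 _) _.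
    by move=> l; case: ifP => _ //; rewrite divr_ge0 // ltW.
  rewrite ler_wpM2l ?invr_ge0 //; apply: ler_sum => l _; rewrite /z.
  by case: ifP => _; rewrite ?expr1n // expr_div_n mulrC.
apply: (@le_trans _ _ (\int[nu]_x ((lam ^+ #|J| * M%:R^-1)%:E * \sum_l (z l x)%:E))%E).
  apply: ge0_le_integral => //.
  - by move=> x _; rewrite lee_fin prodr_ge0.
  - apply/measurable_EFinP; under eq_fun do rewrite big_mkcond /=.
    by apply: measurable_prod => l _; case: (l \in J).
  - apply: emeasurable_funM => //.
    by apply: emeasurable_sum => l; exact/measurable_EFinP.
  by move=> x _; rewrite sumEFin -EFinM lee_fin -mulrA.
rewrite ge0_integralZl_EFin //; last 3 first.
- by move=> x _; apply: sume_ge0 => l _; rewrite lee_fin.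
- by apply: emeasurable_sum => l; exact/measurable_EFinP.
- by rewrite mulr_ge0 ?exprn_ge0 ?invr_ge0 // ltW.
rewrite ge0_integral_sum //; last 2 first.
- by move=> l; exact/measurable_EFinP.
- by move=> l x _; rewrite lee_fin.
apply: (@le_trans _ _ ((lam ^+ #|J| * M%:R^-1)%:E * \sum_(l : L) 1%:E)%E).
  apply: lee_wpmul2l; first by rewrite lee_fin mulr_ge0 ?exprn_ge0 ?invr_ge0 // ltW.
  by apply: lee_sum => l _.
rewrite sumEFin sumr_const -/M -EFinM lee_fin -mulrA mulVf ?mulr1 //.
by rewrite pnatr_eq0 -lt0n.
Qed.

End ProductMoments.

(** * The Rademacher side *)

Section Rademacher.
Context (R : realType) (m n : nat).
Local Notation C := R[i].
Variable Q : ncpoly R m n.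
Implicit Types (S V : {set 'I_m}) (b : {ffun 'I_m -> bool}).

Definition chi b S : R := \prod_(i in S) (-1) ^+ b i.

Definition Wmx S : 'M[C]_n := Q S *m (Q S)^t*.

Lemma nceval_signE b : nceval_sign Q b = \sum_S (chi b S)%:C%C *: Q S.
Proof.
apply: eq_bigr => S _.
have -> : \prod_(i in S) (((-1) ^+ b i)%:M : 'M[C]_n) = ((chi b S)%:C%C)%:M.
  rewrite /chi rmorph_prod /=; apply/esym; rewrite (big_morph _ (@scalar_mxM _ _) erefl).
  by apply: eq_bigr => i _; rewrite rmorphXn rmorphN rmorph1.
by rewrite -mul_mx_scalar.
Qed.

Lemma chi_orth S V : \sum_b chi b S * chi b V = if S == V then (2 ^ m)%:R else 0.
Proof.
pose F (i : 'I_m) (x : bool) : R :=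
  (if i \in S then (-1) ^+ x else 1) * (if i \in V then (-1) ^+ x else 1).
have -> : \sum_b chi b S * chi b V = \prod_i \sum_x F i x.
  rewrite bigA_distr_bigA; apply: eq_bigr => b _.
  by rewrite big_split /= -!big_mkcond.
have e i : \sum_x F i x = if (i \in S) == (i \in V) then 2 else 0.
  rewrite big_bool /F; case: (i \in S); case: (i \in V); rewrite /= ?expr1 ?expr0; ring.
under eq_bigr do rewrite e.
have [->|nSV] := eqVneq S V.
  under eq_bigr do rewrite eqxx.
  by rewrite prodr_const card_ord natrX.
have [i hi] : exists i, (i \in S) != (i \in V).
  apply/existsP; apply: contraR nSV; rewrite negb_exists => /forallP h.
  by apply/eqP/setP => i; apply/eqP; move: (h i); rewrite negbK.
by rewrite (bigD1 i) //= (negbTE hi) mul0r.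
Qed.

(** Orthogonality of the Walsh characters [chi], kept at the level of matrices: convexity of the
    trace is then applied to this average. *)
Lemma parseval_mx :
  \sum_S Wmx S = \sum_b ((2 ^ m)%:R^-1)%:C%C *: (nceval_sign Q b *m (nceval_sign Q b)^t*).
Proof.
have e b : nceval_sign Q b *m (nceval_sign Q b)^t* =
    \sum_S \sum_V (chi b S * chi b V)%:C%C *: (Q S *m (Q V)^t*).
  rewrite nceval_signE mulmx_suml; apply: eq_bigr => S _.
  rewrite linear_sum /= map_mx_sum mulmx_sumr; apply: eq_bigr => V _.
  rewrite linearZ /= map_mxZ /= -scalemxAl -scalemxAr scalerA.
  congr (_ *: _); rewrite rmorphM /=; congr (_ * _).
  by apply/eqP; rewrite eq_complex /= oppr0 !eqxx.
under [RHS]eq_bigr do rewrite e scaler_sumr.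
rewrite exchange_big /=; apply: eq_bigr => S _.
under eq_bigr do rewrite scaler_sumr.
rewrite exchange_big /= (bigD1 S) //= [X in _ + X]big1 ?addr0.
  rewrite -scaler_sumr -scaler_suml -rmorph_sum chi_orth eqxx scalerA -rmorphM.
  by rewrite mulVf ?rmorph1 ?scale1r // pnatr_eq0 -lt0n expn_gt0.
move=> V VS; rewrite -scaler_sumr -scaler_suml -rmorph_sum chi_orth.
by rewrite eq_sym (negbTE VS) rmorph0 scale0r scaler0.
Qed.

Lemma psd_W S : psd (Wmx S).
Proof. exact: psd_mul_adj. Qed.

Lemma sign_mean_ge K : (0 < K)%N ->
  n%:R^-1 * complex.Re (\tr ((\sum_S Wmx S) ^+ K)) <=
  sign_mean (fun b => n%:R^-1 * tr_abs_pow (2 * K) (nceval_sign Q b)).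
Proof.
case: K => // K _; rewrite /sign_mean -mulr_sumr mulrCA ler_wpM2l ?invr_ge0 // mulr_sumr.
under [leRHS]eq_bigr do rewrite tr_abs_powE.
apply: (tr_exp_convex K _ _ _ _ parseval_mx).
- by move=> b; rewrite invr_ge0.
- rewrite sumr_const card_ffun card_ord card_bool -[LHS]mulr_natr mulVf //.
- by move=> b; exact: psd_mul_adj.
- by apply: psd_sum => S; exact: psd_W.
Qed.

Lemma tr_W_exp_ge K S : (0 < K)%N ->
  complex.Re (\tr (Wmx S ^+ K)) <= complex.Re (\tr ((\sum_V Wmx V) ^+ K)).
Proof.
case: K => // K _; have psum := psd_sum (index_enum {set 'I_m}) _ psd_W.
apply: (tr_exp_mono K (psum predT) (psd_W S)).
rewrite (bigD1 S) //= addrAC subrr add0r.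
exact: psum.
Qed.

Hypothesis hQ1 : forall b : {ffun 'I_m -> bool}, opnorm (nceval_sign Q b) <= 1.

Lemma fro2_le_opnorm (A : 'M[C]_n) : opnorm A <= 1 -> fro2 A <= n%:R.
Proof.
move=> A1; have -> : fro2 A = \sum_j fro (A *m delta_mx j (0 : 'I_1)) ^+ 2.
  rewrite /fro2 exchange_big; apply: eq_bigr => j _; rewrite sqr_fro /fro2.
  apply: eq_bigr => i _; rewrite big_ord1 -colE mxE.
  by [].
apply: (@le_trans _ _ (\sum_(j < n) 1)); last by rewrite sumr_const card_ord.
apply: ler_sum => j _; rewrite expr_le1 ?fro_ge0 //.
apply: le_trans (fro_mul_opnorm _ _) _.
have -> : fro (delta_mx j (0 : 'I_1) : 'cV[C]_n) = 1; last by rewrite mulr1.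
rewrite /fro /fro2 (bigD1 j) //= [X in _ + X]big1 ?addr0.
  rewrite big_ord1 mxE !eqxx /= -[X in nrm2 X](rmorph1 (real_complex R)) nrm2_real.
  by rewrite expr1n sqrtr1.
by move=> y yx; rewrite big_ord1 mxE (negbTE yx) /= nrm20.
Qed.

Lemma sum_fro2_le : \sum_S fro2 (Q S) <= n%:R.
Proof.
have -> : \sum_S fro2 (Q S) = complex.Re (\tr (\sum_S Wmx S)).
  rewrite (raddf_sum (@mxtrace C n)) cRe_sum.
  by apply: eq_bigr => S _; rewrite /= /Wmx tr_mul_adj.
rewrite parseval_mx (raddf_sum (@mxtrace C n)) cRe_sum.
apply: (@le_trans _ _ (\sum_b (2 ^ m)%:R^-1 * n%:R)).
  apply: ler_sum => b _; rewrite /= mxtraceZ tr_mul_adj -rmorphM /=.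
  by rewrite ler_wpM2l ?invr_ge0 // fro2_le_opnorm.
rewrite sumr_const card_ffun card_ord card_bool -[leLHS]mulr_natl mulrA mulfV ?mul1r //.
Qed.

Lemma fro2_coef_le S : fro2 (Q S) <= n%:R.
Proof.
apply: le_trans sum_fro2_le; rewrite (bigD1 S) //= lerDl.
by apply: sumr_ge0 => V _; exact: fro2_ge0.
Qed.

Lemma influenceE i : influence Q i = \sum_(S : {set 'I_m} | i \in S) fro2 (Q S).
Proof. by apply: eq_bigr => S _; rewrite tr_mul_adj. Qed.

Lemma influence_ge0 i : 0 <= influence Q i.
Proof. by rewrite influenceE; apply: sumr_ge0 => S _; exact: fro2_ge0. Qed.

Lemma influence_le_max i : influence Q i <= max_influence Q.
Proof. by rewrite /max_influence; apply: le_bigmax_cond. Qed.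

Lemma fro2_le_influence i S : i \in S -> fro2 (Q S) <= influence Q i.
Proof.
move=> iS; rewrite influenceE (bigD1 S) //= lerDl.
by apply: sumr_ge0 => V _; exact: fro2_ge0.
Qed.

Lemma fro2_le_max_influence S : S != finset.set0 -> fro2 (Q S) <= max_influence Q.
Proof.
move=> /set0Pn[i iS].
exact: le_trans (fro2_le_influence iS) (influence_le_max i).
Qed.

Lemma max_influence_le : max_influence Q <= n%:R.
Proof.
apply/bigmax_leP; split => // i _; rewrite influenceE.
apply: le_trans sum_fro2_le; rewrite big_mkcond /=; apply: ler_sum => S _.
by case: ifP => // _; exact: fro2_ge0.
Qed.

(** Each coefficient is counted once for every index of its set, hence at most [d] times. *)
Lemma sum_influence_le d : ncdeg_le d Q -> \sum_i influence Q i <= d%:R * n%:R.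
Proof.
move=> hd; under eq_bigr do rewrite influenceE.
rewrite (exchange_big_dep predT) //=.
apply: (@le_trans _ _ (\sum_S d%:R * fro2 (Q S))); last first.
  by rewrite -mulr_sumr ler_wpM2l // sum_fro2_le.
apply: ler_sum => S _; rewrite sumr_const -(mulr_natl (fro2 _)).
have [Sd|Sd] := leqP #|S| d; first by rewrite ler_wpM2r ?fro2_ge0 ?ler_nat.
by rewrite (hd _ Sd) -sqr_fro fro0 expr0n /= !mulr0.
Qed.

End Rademacher.

Section ProductsAndRoots.
Context (R : realType).

Lemma lee_prod (I : Type) (r : seq I) (P : pred I) (a b : I -> \bar R) :
  (forall i, P i -> 0 <= a i)%E -> (forall i, P i -> a i <= b i)%E ->
  (0 <= \prod_(i <- r | P i) a i <= \prod_(i <- r | P i) b i)%E.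
Proof.
move=> a0 ab; elim: r => [|i r /andP[IH0 IH]]; first by rewrite !big_nil lee01 lexx.
rewrite !big_cons; case: ifP => Pi; last by rewrite IH0.
by rewrite mule_ge0 ?a0 //= lee_pmul ?a0 ?ab.
Qed.

Lemma root_exists (x : R) k : 1 <= x -> (0 < k)%N -> exists2 y, 1 <= y & y ^+ k = x.
Proof.
move=> x1 k0; have x0 : 0 <= x by apply: le_trans x1.
exists (x `^ k%:R^-1).
  by rewrite -[leLHS](powRr0 x) ler_powR // invr_ge0.
by rewrite -powR_mulrn ?powR_ge0 // -powRrM mulVf ?powRr1 // pnatr_eq0 -lt0n.
Qed.

End ProductsAndRoots.

(** * Moments of products of letters *)

Section RandomMoments.
Context (R : realType) (m n p : nat) (disp : measure_display)
  (T : measurableType disp) (P : probability T R)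
  (G : 'I_m -> {RV P >-> borel_mx R n}) (H : 'I_m -> {RV P >-> borel_mx R p}).
Hypothesis hH : forall i : 'I_m, haar_unitary (distribution P (H i)).
Hypothesis hind : mutually_independent P (fun k : 'I_m + 'I_m =>
       match k with
       | inl i => g_sigma_algebra_preimage (G i)
       | inr i => g_sigma_algebra_preimage (H i)
       end).
Hypotheses (hn : (0 < n)%N) (hdvd : (n %| p)%N).
Variable cG : probability (borel_mx R n) R.
Hypothesis hG : forall (i : 'I_m) (A : set (borel_mx R n)), measurable A ->
       distribution P (G i) A = cG A.
Hypothesis hG2 : mx_integrable cG (fun G => G *m G^t*).
Hypothesis hG2E : mx_mean cG (fun G => G *m G^t*) = 1%:M.
Variables (K : nat) (c : R).
Hypotheses (hK : (0 < K)%N) (hc : 1 <= c).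
Hypothesis hGK : mx_integrable cG (fun G => (G *m G^t*) ^+ K).
Hypothesis hGKE : opnorm (mx_mean cG (fun G => (G *m G^t*) ^+ K)) <= c.
Local Notation C := R[i].
Local Notation genv := ('I_m -> 'M[C]_n).
Local Notation henv := ('I_m -> 'M[C]_p).
Local Notation E := (Ex G H).
Implicit Types (g : genv) (h : henv) (S V : {set 'I_m}).

Lemma integral_law i (f : borel_mx R n -> \bar R) :
  (\int[distribution P (G i)]_x f x = \int[cG]_x f x)%E.
Proof. by apply: eq_measure_integral => A mA _; exact: hG. Qed.

Section LetterProducts.
Context (L : finType).
Variables (S : L -> {set 'I_m}) (y : L -> 'I_m -> 'M[C]_n -> R).
Hypothesis my : forall l i, measurable_fun [set: borel_mx R n] (y l i).
Hypothesis y0 : forall l i x, 0 <= y l i x.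

(** Exchanging the two products collects the letters of each index. Different indices are
    independent, while the letters of one index are functions of the same matrix and have to be
    integrated together. *)
Lemma Ex_prod_sets :
  E (fun g _ => \prod_l \prod_(i in S l) y l i (g i)) =
  (\prod_i \int[cG]_x (\prod_(l | i \in S l) y l i x)%:E)%E.
Proof.
have -> : (fun (g : genv) (_ : henv) => \prod_l \prod_(i in S l) y l i (g i)) =
    (fun g _ => \prod_i \prod_(l | i \in S l) y l i (g i)).
  apply/funext => g; apply/funext => _.
  by rewrite (exchange_big_dep predT).
rewrite (Ex_indep hind (phi := fun i x => \prod_(l | i \in S l) y l i x)).
- by apply: eq_bigr => i _; rewrite integral_law.
- exact: index_enum_uniq.
- move=> i; under eq_fun do rewrite big_mkcond /=.
  by apply: measurable_prod => l _; case: (i \in S l).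
- by move=> i x; apply: prodr_ge0.
Qed.

Lemma integral_letters_le lam i : 0 < lam -> (0 < #|L|)%N ->
  (forall l j, \int[cG]_x (y l j x ^+ #|L|)%:E <= (lam ^+ #|L|)%:E)%E ->
  (\int[cG]_x (\prod_(l | i \in S l) y l i x)%:E <=
   (lam ^+ #|[set l | i \in S l]%SET|)%:E)%E.
Proof.
move=> lam0 L0 hy.
rewrite (_ : (fun x => _) = (fun x => (\prod_(l in [set l | i \in S l]%SET) y l i x)%:E)).
  by apply: moment_prod.
by apply/funext => x; congr EFin; apply: eq_bigl => l; rewrite inE.
Qed.

Lemma card_letters : (\sum_i #|[set l | i \in S l]%SET| = \sum_l #|S l|)%N.
Proof.
under eq_bigr do rewrite -sum1_card.
under [RHS]eq_bigr do rewrite -sum1_card.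
rewrite [RHS](exchange_big_dep predT) //=; apply: eq_bigr => i _.
by apply: eq_bigl => l; rewrite inE.
Qed.

Lemma Ex_prod_sets_le lam : 0 < lam -> (0 < #|L|)%N ->
  (forall l j, \int[cG]_x (y l j x ^+ #|L|)%:E <= (lam ^+ #|L|)%:E)%E ->
  (E (fun g _ => \prod_l \prod_(i in S l) y l i (g i))%R <=
   (lam ^+ (\sum_l #|S l|))%:E)%E.
Proof.
move=> lam0 L0 hy; rewrite Ex_prod_sets -card_letters expr_sum -prodEFin.
have nn i : (0 <= \int[cG]_x (\prod_(l | i \in S l) y l i x)%:E)%E.
  by apply: integral_ge0 => x _; rewrite lee_fin prodr_ge0.
by have /andP[_ ->] := @lee_prod R _ (index_enum 'I_m) predT
  (fun i => \int[cG]_x (\prod_(l | i \in S l) y l i x)%:E)%E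
  (fun i => (lam ^+ #|[set l | i \in S l]%SET|)%:E) (fun i _ => nn i)
  (fun i _ => integral_letters_le i lam0 L0 hy).
Qed.

(** A gain at a single index carries over to the whole product, the other indices being bounded as
    before. *)
Lemma Ex_prod_sets_le_small lam eps i0 : 0 < lam -> (0 < #|L|)%N ->
  (forall l j, \int[cG]_x (y l j x ^+ #|L|)%:E <= (lam ^+ #|L|)%:E)%E ->
  (\int[cG]_x (\prod_(l | i0 \in S l) y l i0 x)%:E <=
   (eps * lam ^+ #|[set l | i0 \in S l]%SET|)%:E)%E ->
  (E (fun g _ => \prod_l \prod_(i in S l) y l i (g i))%R <=
   (eps * lam ^+ (\sum_l #|S l|))%:E)%E.
Proof.
move=> lam0 L0 hy hi; rewrite Ex_prod_sets -card_letters expr_sum.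
rewrite (bigD1 i0) //= [X in (_ <= (_ * X)%:E)%E](bigD1 i0) //= mulrA EFinM -prodEFin.
have nn i : (0 <= \int[cG]_x (\prod_(l | i \in S l) y l i x)%:E)%E.
  by apply: integral_ge0 => x _; rewrite lee_fin prodr_ge0.
have /andP[h1 h2] := @lee_prod R _ (index_enum 'I_m) (fun i => i != i0)
  (fun i => \int[cG]_x (\prod_(l | i \in S l) y l i x)%:E)%E
  (fun i => (lam ^+ #|[set l | i \in S l]%SET|)%:E) (fun i _ => nn i)
  (fun i _ => integral_letters_le i lam0 L0 hy).
by apply: lee_pmul.
Qed.

End LetterProducts.

Let n0 : (n%:R : R) != 0. Proof. by rewrite pnatr_eq0 -lt0n. Qed.

Lemma fro2_1 : fro2 (1%:M : 'M[C]_n) = n%:R.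
Proof.
apply: (@complexI R); rewrite -tr_mul_adj mul1mx.
have -> : (1%:M : 'M[C]_n)^t* = 1%:M by rewrite trmx1 map_mx1.
by rewrite mxtrace1 (rmorph_nat (real_complex R)).
Qed.

Let V0 : 'rV[C]_n := row (Ordinal hn) 1%:M.

Lemma fro2_V0 : fro2 V0 = 1.
Proof.
rewrite /fro2 big_ord1 (bigD1 (Ordinal hn)) //= big1 ?addr0.
  by rewrite !mxE eqxx -[X in nrm2 X](rmorph1 (real_complex R)) nrm2_real expr1n.
by move=> j ji; rewrite !mxE eq_sym (negbTE ji) nrm20.
Qed.

Lemma hhE x : hh hn x = fro2 (V0 *m x).
Proof. by rewrite /hh /V0 -row_mul mul1mx. Qed.

Lemma measurable_hh : measurable_fun [set: borel_mx R n] (hh hn).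
Proof.
rewrite (_ : @hh R n hn = fun x => fro2 (V0 *m x)); last by apply/funext => x; rewrite hhE.
apply: measurable_fro2; apply: cmeas_mul; first exact: cmeas_cst.
exact/measurable_borel_mx.
Qed.

Lemma measurable_fro_mx : measurable_fun [set: borel_mx R n] (fun x => fro x).
Proof. by apply: measurable_fro; exact/measurable_borel_mx. Qed.

Lemma measurable_gg : measurable_fun [set: borel_mx R n] (@gg R n).
Proof.
apply: measurable_funM => //; apply: measurable_fro2; exact/measurable_borel_mx.
Qed.

Lemma integral_hh : (\int[cG]_x (hh hn x)%:E = 1)%E.
Proof.
under eq_integral do rewrite hhE.
by have [_ ->] := has_mean_fro2 hG2 hG2E V0; rewrite fro2_V0.
Qed.

Lemma integral_fro2 : (\int[cG]_x (fro2 x)%:E = n%:R%:E)%E.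
Proof.
have [_] := has_mean_fro2 hG2 hG2E 1%:M; rewrite fro2_1.
by under eq_integral do rewrite mul1mx.
Qed.

Lemma integral_gg : (\int[cG]_x (gg x)%:E = 1)%E.
Proof.
have := has_meanZ n%:R^-1 (has_mean_fro2 hG2 hG2E 1%:M); rewrite fro2_1 mulVf // => -[_ <-].
by apply: eq_integral => x _; rewrite mul1mx /gg mulrC.
Qed.

Lemma integral_hh_pow : (\int[cG]_x (hh hn x ^+ K)%:E <= c%:E)%E.
Proof.
under eq_integral do rewrite hhE.
apply: le_trans (mean_fro2_pow hK hGK hGKE V0) _.
by rewrite fro2_V0 expr1n mulr1.
Qed.

Lemma integral_fro2_pow : (\int[cG]_x (fro2 x ^+ K)%:E <= (n%:R ^+ K * c)%:E)%E.
Proof.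
have := mean_fro2_pow hK hGK hGKE 1%:M; rewrite fro2_1 mulrC.
by under eq_integral do rewrite mul1mx.
Qed.

Lemma integral_gg_pow : (\int[cG]_x (gg x ^+ K)%:E <= c%:E)%E.
Proof.
have -> : (\int[cG]_x (gg x ^+ K)%:E = (n%:R ^- K)%:E * \int[cG]_x (fro2 x ^+ K)%:E)%E.
  rewrite -ge0_integralZl_EFin //.
  - by apply: eq_integral => x _; rewrite -EFinM /gg expr_div_n mulrC.
  - by move=> x _; rewrite lee_fin exprn_ge0 ?fro2_ge0.
  - apply/measurable_EFinP; apply: measurable_funX; apply: measurable_fro2.
    exact/measurable_borel_mx.
apply: le_trans (lee_wpmul2l _ integral_fro2_pow) _; first by rewrite lee_fin invr_ge0 exprn_ge0.
by rewrite -EFinM mulrA mulVf ?mul1r // expf_neq0.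
Qed.

End RandomMoments.

(* The truncation level used in integral_fro_small: above it the e-th moment,
   0 < e < 2K, is at most eps times its bound by the 2K-th moment. *)
Definition small_cst (R : realType) (n K : nat) (eps : R) : R :=
  (2 / eps) ^+ (2 * K) * (1 + n%:R) * (2 / eps).

Lemma small_cst_ge0 (R : realType) (n K : nat) (eps : R) : 0 < eps -> 0 <= small_cst n K eps.
Proof.
move=> eps0; have e0 : 0 <= 2 / eps by rewrite divr_ge0 // ltW.
by apply: mulr_ge0 => //; apply: mulr_ge0; rewrite ?exprn_ge0 ?addr_ge0.
Qed.

Section WordMoments.
Context (R : realType) (m n p : nat) (disp : measure_display)
  (T : measurableType disp) (P : probability T R)
  (G : 'I_m -> {RV P >-> borel_mx R n}) (H : 'I_m -> {RV P >-> borel_mx R p}).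
Hypothesis hH : forall i : 'I_m, haar_unitary (distribution P (H i)).
Hypothesis hind : mutually_independent P (fun k : 'I_m + 'I_m =>
       match k with
       | inl i => g_sigma_algebra_preimage (G i)
       | inr i => g_sigma_algebra_preimage (H i)
       end).
Hypotheses (hn : (0 < n)%N) (hnp : (n < p)%N) (hdvd : (n %| p)%N).
Variable cG : probability (borel_mx R n) R.
Hypothesis hG : forall (i : 'I_m) (A : set (borel_mx R n)), measurable A ->
       distribution P (G i) A = cG A.
Hypothesis hG2 : mx_integrable cG (fun G => G *m G^t*).
Hypothesis hG2E : mx_mean cG (fun G => G *m G^t*) = 1%:M.
Variables (K : nat) (c : R).
Hypotheses (hK : (0 < K)%N) (hc : 1 <= c).
Hypothesis hGK : mx_integrable cG (fun G => (G *m G^t*) ^+ K).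
Hypothesis hGKE : opnorm (mx_mean cG (fun G => (G *m G^t*) ^+ K)) <= c.
Local Notation C := R[i].
Local Notation genv := ('I_m -> 'M[C]_n).
Local Notation henv := ('I_m -> 'M[C]_p).
Local Notation E := (Ex G H).
Implicit Types (g : genv) (h : henv) (S V : {set 'I_m}).

Let n1 : (1 : R) <= n%:R. Proof. by rewrite ler1n. Qed.

Let mfro := @measurable_fro_mx R n.

Let nc1 : 1 <= n%:R ^+ K * c.
Proof. by rewrite -[leLHS]mulr1 ler_pM ?exprn_ege1. Qed.

Lemma integral_fro_pow : (\int[cG]_x (fro x ^+ (2 * K))%:E <= (n%:R ^+ K * c)%:E)%E.
Proof.
under eq_integral do rewrite exprM sqr_fro.
exact: (integral_fro2_pow hK hGK hGKE).
Qed.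

(** Truncation of [u = s / lam] at level [B]: below it, [u ^+ e] is at most [B ^+ (2 * K) * u],
    which uses [0 < e]; above it, [u ^+ e] is at most [u ^+ (2 * K) / B], which uses [e < 2 * K]. *)
Lemma small_pow (s lam B : R) e : 0 <= s -> 0 < lam -> 1 <= B -> (0 < e < 2 * K)%N ->
  s ^+ e <= lam ^+ e * (B ^+ (2 * K) / lam * (1 + s ^+ 2) +
     (B * lam ^+ (2 * K))^-1 * s ^+ (2 * K)).
Proof.
move=> s0 lam0 B1 /andP[e0 eK]; pose u := s / lam.
have B0 : 0 < B by apply: lt_le_trans B1.
have su : s = lam * u by rewrite /u mulrCA mulfV ?mulr1 // gt_eqF.
have u0 : 0 <= u by rewrite divr_ge0 // ltW.
have hs : s <= 1 + s ^+ 2.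
  have : 0 <= (s - 2^-1) ^+ 2 by exact: sqr_ge0.
  lra.
rewrite {1}su exprMn ler_wpM2l ?exprn_ge0 ?(ltW lam0) //.
have e1 : (B * lam ^+ (2 * K))^-1 * s ^+ (2 * K) = u ^+ (2 * K) / B.
  by rewrite /u expr_div_n; field; rewrite expf_neq0 gt_eqF.
rewrite e1; have [uB|uB] := leP u B.
  rewrite -[leLHS]addr0 lerD ?divr_ge0 ?exprn_ge0 // ?(ltW B0) //.
  rewrite mulrAC -mulrA; apply: (@le_trans _ _ (B ^+ (2 * K) * u)); last first.
    by rewrite ler_wpM2l ?exprn_ge0 ?(ltW B0) // /u ler_wpM2r // invr_ge0 ltW.
  rewrite -(prednK e0) exprSr ler_wpM2r //.
  apply: (@le_trans _ _ (B ^+ e.-1)); first by rewrite lerXn2r ?nnegrE // ltW.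
  by apply: ler_weXn2l => //; apply: leq_trans (ltnW eK); exact: leq_pred.
rewrite -[leLHS]add0r lerD //.
  apply: mulr_ge0; last by rewrite addr_ge0 ?exprn_ge0.
  by apply: divr_ge0; rewrite ?exprn_ge0 ?(ltW lam0) ?(ltW B0).
rewrite ler_pdivlMr // -(subnKC (ltnW eK)) exprD ler_wpM2l ?exprn_ge0 //.
have u1 : 1 <= u by apply: le_trans (ltW uB).
apply: le_trans (ltW uB) _; rewrite -{1}[u]expr1 ler_weXn2l // subn_gt0 //.
Qed.

(** The second moment of the norm is [n] whatever [c] is, whereas [lam] grows with [c]. With
    [B = 2 / eps], each of the two parts of [small_pow] contributes at most [eps / 2]; the lower
    bound on [lam] is exactly what the first part asks for. *)
Lemma integral_fro_small lam eps e : 0 < eps -> eps <= 1 ->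
  lam ^+ (2 * K) = n%:R ^+ K * c -> 0 < lam -> small_cst n K eps <= lam ->
  (0 < e < 2 * K)%N ->
  (\int[cG]_x (fro x ^+ e)%:E <= (eps * lam ^+ e)%:E)%E.
Proof.
move=> eps0 eps1 lamE lam0 lamL eK.
pose B := 2 / eps.
have B1 : 1 <= B by rewrite ler_pdivlMr //; lra.
have B0 : 0 < B by apply: lt_le_trans B1.
pose a := B ^+ (2 * K) / lam; pose b := (B * lam ^+ (2 * K))^-1.
have a0 : 0 <= a by rewrite divr_ge0 ?exprn_ge0 // ltW.
have b0 : 0 <= b by rewrite invr_ge0 mulr_ge0 ?exprn_ge0 // ltW.
have m2 : measurable_fun [set: borel_mx R n] (fun x => fro x ^+ 2) by exact: measurable_funX.
have m2K : measurable_fun [set: borel_mx R n] (fun x => fro x ^+ (2 * K)).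
  exact: measurable_funX.
apply: (@le_trans _ _ (\int[cG]_x (lam ^+ e * (a * (1 + fro x ^+ 2) + b * fro x ^+ (2 * K)))%:E)%E).
  apply: ge0_le_integral => //.
  - by move=> x _; rewrite lee_fin exprn_ge0 ?fro_ge0.
  - by apply/measurable_EFinP; exact: measurable_funX.
  - apply/measurable_EFinP; apply: measurable_funM => //; apply: measurable_funD;
      apply: measurable_funM => //.
    exact: measurable_funD.
  move=> x _; rewrite lee_fin; apply: small_pow => //; exact: fro_ge0.
under eq_integral do rewrite EFinM.
rewrite ge0_integralZl_EFin //; last 3 first.
- move=> x _; rewrite lee_fin; apply: addr_ge0; apply: mulr_ge0 => //;
    by rewrite ?addr_ge0 // exprn_ge0 ?fro_ge0.
- apply/measurable_EFinP; apply: measurable_funD; apply: measurable_funM => //.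
  exact: measurable_funD.
- by rewrite exprn_ge0 // ltW.
rewrite [in leRHS]mulrC [leRHS]EFinM lee_wpmul2l //; first by rewrite lee_fin exprn_ge0 // ltW.
under eq_integral do rewrite EFinD.
rewrite ge0_integralD //; last 4 first.
- by move=> x _; rewrite lee_fin; apply: mulr_ge0 => //; rewrite addr_ge0 // exprn_ge0 ?fro_ge0.
- by apply/measurable_EFinP; apply: measurable_funM => //; exact: measurable_funD.
- by move=> x _; rewrite lee_fin; apply: mulr_ge0 => //; rewrite exprn_ge0 ?fro_ge0.
- by apply/measurable_EFinP; apply: measurable_funM.
have -> : (\int[cG]_x (a * (1 + fro x ^+ 2))%:E = (a * (1 + n%:R))%:E)%E.
  under eq_integral do rewrite EFinM.
  rewrite ge0_integralZl_EFin //; last 2 first.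
  - by move=> x _; rewrite lee_fin addr_ge0 ?exprn_ge0 ?fro_ge0.
  - by apply/measurable_EFinP; exact: measurable_funD.
  under eq_integral do rewrite EFinD sqr_fro.
  rewrite ge0_integralD //; last 2 first.
  - by move=> x _; rewrite lee_fin fro2_ge0.
  - by apply/measurable_EFinP; apply: measurable_fro2; exact/measurable_borel_mx.
  by rewrite integral_cst //= probability_setT mule1 (integral_fro2 hG2 hG2E).
have h2 : (\int[cG]_x (b * fro x ^+ (2 * K))%:E <= (B^-1)%:E)%E.
  under eq_integral do rewrite EFinM.
  rewrite ge0_integralZl_EFin //; last 2 first.
  - by move=> x _; rewrite lee_fin exprn_ge0 ?fro_ge0.
  - exact/measurable_EFinP.
  apply: le_trans (lee_wpmul2l _ integral_fro_pow) _; first by rewrite lee_fin.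
  rewrite -EFinM lee_fin -lamE /b invfM -mulrA mulVf ?mulr1 //.
  by rewrite expf_neq0 // gt_eqF.
apply: le_trans (leeD2l _ h2) _; rewrite -EFinD lee_fin.
have -> : B^-1 = eps / 2 by rewrite /B invf_div.
suff : a * (1 + n%:R) <= eps / 2 by lra.
have -> : eps / 2 = B^-1 by rewrite /B invf_div.
rewrite /a mulrAC ler_pdivrMr // -ler_pdivrMl ?invr_gt0 // invrK mulrC.
exact: lamL.
Qed.

(** Hölder with exponent [2 * K] and [lam] the corresponding root of the moment bound; as [lam] is
    at least 1, the number of letters may be raised to [2 * K * d]. *)
Lemma Ex_wnorm_le (L : finType) (S : L -> {set 'I_m}) d : #|L| = (2 * K)%N ->
  (forall l, #|S l| <= d)%N ->
  (E (fun g _ => \prod_l wnorm g (S l))%R <= ((n%:R ^+ K * c) ^+ d)%:E)%E.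
Proof.
move=> cL Sd.
have [lam lam1 lamE] : exists2 y, 1 <= y & y ^+ (2 * K) = n%:R ^+ K * c.
  by apply: root_exists => //; rewrite muln_gt0.
have lam0 : 0 < lam by apply: lt_le_trans lam1.
apply: le_trans (Ex_prod_sets_le hind hG S (y := fun _ _ x => fro x) _ _ lam0 _ _) _.
- by [].
- by move=> *; exact: fro_ge0.
- by rewrite cL muln_gt0.
- by move=> _ _; rewrite cL lamE; exact: integral_fro_pow.
rewrite lee_fin -lamE -exprM ler_weXn2l //.
by rewrite -cL -sum_nat_const; apply: leq_sum => l _.
Qed.

(** The index [i] occurs in some but not all of the [2 * K] sets, so its matrix enters with an
    intermediate exponent and [integral_fro_small] applies to it. *)
Lemma Ex_wnorm_small (L : finType) (S : L -> {set 'I_m}) d eps i l1 l2 :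
  #|L| = (2 * K)%N -> (forall l, #|S l| <= d)%N ->
  0 < eps -> eps <= 1 -> i \in S l1 -> i \notin S l2 ->
  (E (fun g _ => \prod_l wnorm g (S l))%R <=
   (eps * (n%:R ^+ K * c) ^+ d + (1 + small_cst n K eps) ^+ (2 * K * d))%:E)%E.
Proof.
move=> cL Sd eps0 eps1 il1 il2.
have [lam lam1 lamE] : exists2 y, 1 <= y & y ^+ (2 * K) = n%:R ^+ K * c.
  by apply: root_exists => //; rewrite muln_gt0.
have lam0 : 0 < lam by apply: lt_le_trans lam1.
have sc0 := small_cst_ge0 n K eps0.
(* A [lam] below the truncation level bounds [c] itself, and the plain estimate fits into the
   summand free of [c]. *)
have [lamL|lamL] := leP (small_cst n K eps) lam; last first.
  apply: le_trans (Ex_wnorm_le cL Sd) _.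
  rewrite lee_fin -[leLHS]add0r lerD ?mulr_ge0 ?exprn_ge0 ?(ltW eps0) //.
    by apply: le_trans nc1.
  rewrite -lamE -exprM lerXn2r ?nnegrE ?addr_ge0 // ?(ltW lam0) //.
  by rewrite -[leLHS]add0r lerD // ltW.
apply: (@le_trans _ _ (eps * lam ^+ (\sum_l #|S l|))%:E); last first.
  rewrite lee_fin -[leLHS]addr0 lerD ?exprn_ge0 ?addr_ge0 // ler_wpM2l ?(ltW eps0) //.
  rewrite -lamE -exprM ler_weXn2l //.
  by rewrite -cL -sum_nat_const; apply: leq_sum => l _.
apply: (@Ex_prod_sets_le_small _ _ _ _ _ _ _ _ _ hind _ hG _ S (fun _ _ x => fro x)
  _ _ _ _ i) => //.
- by move=> *; exact: fro_ge0.
- by rewrite cL muln_gt0.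
- by move=> _ _; rewrite cL lamE; exact: integral_fro_pow.
have e : #|[set l | i \in S l]%SET| = #|[pred l | i \in S l]| by rewrite cardsE.
under eq_integral do rewrite prodr_const.
rewrite e; apply: integral_fro_small => //; apply/andP; split.
  by apply/card_gt0P; exists l1.
rewrite -cL -cardsT -e proper_card //.
by apply/properP; split => //; exists l2; rewrite ?inE.
Qed.

(** The last letter is peeled off: its unitary does not change the norm, and the mean over its [G]
    costs a factor [c]. This gives constant tuples their bound with [c ^+ d] and no power of [n]. *)
Lemma Ex_fro2_word_pow k (B : 'M[C]_(k, p)) S :
  (E (fun g h => fro2 (B *m word g h S) ^+ K)%R <= (c ^+ #|S| * fro2 B ^+ K)%:E)%E.
Proof.
have mw V : env_measurable (fun g (h : henv) => fro2 (B *m word g h V) ^+ K).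
  apply: env_measurableX; apply: env_measurable_fro2; apply: env_cmeas_mul.
    exact: env_cmeas_cst.
  exact: env_cmeas_word.
have w0 V g h : 0 <= fro2 (B *m word g h V) ^+ K by rewrite exprn_ge0 ?fro2_ge0.
have c0 : 0 <= c by apply: le_trans hc.
have [N] := ubnP #|S|; elim: N S => // N IH S; rewrite ltnS => SN.
have [->|Sn0] := eqVneq S finset.set0.
  under eq_Ex do rewrite word0 mulmx1.
  by rewrite Ex_cst cards0 expr0 mul1r.
have [i iS imax] := set_max Sn0.
apply: (@le_trans _ _ (E (fun g h => c * fro2 (B *m word g h (S :\ i)%SET) ^+ K)%R)).
  apply: (Ex_freezeG hH hind (j := i)) => //.
  - by apply: env_measurableM => //; exact: env_measurable_cst.
  - by move=> g h; rewrite mulr_ge0.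
  move=> g h uh; rewrite (integral_law hG).
  apply: le_trans (mean_fro2_tens_pow hK hGK hGKE (B *m word g h (S :\ i)%SET) hdvd).
  rewrite le_eqVlt; apply/orP; left; apply/eqP; apply: eq_integral => x _.
  rewrite (word_max _ _ iS imax) word_updg ?inE ?eqxx //.
  by rewrite !mulmxA (fro2_unitary _ (uh i)) /upd eqxx.
rewrite ExZ //; apply: le_trans (lee_wpmul2l _ (IH _ _)) _; first by rewrite lee_fin.
  by apply: leq_trans SN; rewrite [X in (_ < X)%N](cardsD1 i) iS.
by rewrite -EFinM lee_fin mulrA -exprS [X in _ <= c ^+ X * _](cardsD1 i) iS.
Qed.

Section ExpectedWeights.
Variable s : 'I_K -> {set 'I_m}.

Let y (k : 'I_K) (i : 'I_m) (x : 'M[C]_n) := if is_min (s k) i then hh hn x else gg x.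
Let my k i : measurable_fun [set: borel_mx R n] (y k i).
Proof. by rewrite /y; case: is_min; [exact: measurable_hh|exact: measurable_gg]. Qed.
Let y0 k i x : 0 <= y k i x.
Proof. by rewrite /y; case: is_min; [exact: hh_ge0|exact: gg_ge0]. Qed.

(** The weights are quadratic in the letters, so Hölder runs over [K] factors, and a row or a
    normalized norm has [K]-th moment at most [c]. *)
Lemma Ex_aw_le d : (forall k, #|s k| <= d)%N ->
  (E (fun g _ => \prod_k aw hn g (s k))%R <= (c ^+ d)%:E)%E.
Proof.
move=> sd; have [lam lam1 lamE] := root_exists hc hK.
have lam0 : 0 < lam by apply: lt_le_trans lam1.
apply: le_trans (Ex_prod_sets_le hind hG s my y0 lam0 _ _) _.
- by rewrite card_ord.
- move=> k j; rewrite card_ord lamE /y; case: is_min.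
    exact: (integral_hh_pow hn hK hGK hGKE).
  exact: (integral_gg_pow hn hK hGK hGKE).
rewrite lee_fin -lamE -exprM ler_weXn2l //.
apply: (@leq_trans (\sum_(l < K) d)); first by apply: leq_sum => l _.
by rewrite sum_nat_const card_ord.
Qed.

(** Every index occurs at most once, and [hh] and [gg] both have mean 1 because the second moment of
    the matrix is the identity. *)
Lemma Ex_aw_disjoint : (forall i k l, i \in s k -> i \in s l -> k = l) ->
  E (fun g _ => \prod_k aw hn g (s k)) = 1%E.
Proof.
move=> dis; rewrite [LHS](Ex_prod_sets hind hG s my y0) big1 // => i _.
have [k ik|none] := pickP (fun k => i \in s k).
  under eq_integral => x _.
    rewrite (big_pred1 k); last first.
      by move=> l /=; apply/idP/eqP => [il|->//]; exact: dis il ik.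
    over.
  by rewrite /y; case: is_min; [exact: integral_hh|exact: integral_gg].
under eq_integral do rewrite big_pred0 //.
by rewrite integral_cst //= probability_setT mule1.
Qed.

End ExpectedWeights.

End WordMoments.

(** * Replacing words by scalars *)

Section PairTerms.
Context (R : realType) (m n p : nat) (disp : measure_display)
  (T : measurableType disp) (P : probability T R)
  (G : 'I_m -> {RV P >-> borel_mx R n}) (H : 'I_m -> {RV P >-> borel_mx R p}).
Hypothesis hH : forall i : 'I_m, haar_unitary (distribution P (H i)).
Hypothesis hind : mutually_independent P (fun k : 'I_m + 'I_m =>
       match k with
       | inl i => g_sigma_algebra_preimage (G i)
       | inr i => g_sigma_algebra_preimage (H i)
       end).
Hypotheses (hn : (0 < n)%N) (hnp : (n < p)%N) (hdvd : (n %| p)%N).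
Variables (Q : ncpoly R m n) (K : nat).
Local Notation C := R[i].
Local Notation genv := ('I_m -> 'M[C]_n).
Local Notation henv := ('I_m -> 'M[C]_p).
Local Notation E := (Ex G H).
Local Notation SP := ({set 'I_m} * {set 'I_m})%type.
Implicit Types (g : genv) (h : henv) (S V : {set 'I_m}) (s : SP) (f : {ffun 'I_K -> SP}).

Definition pmx g h s : 'M[C]_n := cword Q g h s.1 *m (cword Q g h s.2)^t*.

Definition pmx0 g s : 'M[C]_n :=
  if s.1 == s.2 then (aw hn g s.1)%:C%C *: Wmx Q s.1 else 0.

Definition qnorm s : R := fro (Q s.1) * fro (Q s.2).

Definition pnorm g s : R := wnorm g s.1 * wnorm g s.2.

Lemma qnorm_ge0 s : 0 <= qnorm s.
Proof. by rewrite mulr_ge0 ?fro_ge0. Qed.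

Lemma pnorm_ge0 g s : 0 <= pnorm g s.
Proof. by rewrite mulr_ge0 ?wnorm_ge0. Qed.

Lemma env_gmeas_pnorm s : @env_gmeas R m n p (pnorm ^~ s).
Proof. by apply: env_measurableM; exact: env_measurable_wnorm. Qed.

Lemma env_cmeas_pmx s : env_cmeas (fun g h => pmx g h s).
Proof.
by apply: env_cmeas_mul; [|apply: env_cmeas_adj]; exact: env_cmeas_cword.
Qed.

Lemma env_cmeas_pmx0 s : env_cmeas (fun g (_ : henv) => pmx0 g s).
Proof.
rewrite /pmx0; case: eqP => _; last exact: env_cmeas_cst.
by apply: env_cmeas_scale; [exact: env_gmeas_aw|exact: env_cmeas_cst].
Qed.

Lemma fro_pmx g h s : (forall i, h i \is unitarymx) -> fro (pmx g h s) <= qnorm s * pnorm g s.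
Proof.
move=> uh; apply: le_trans (fro_mul _ _) _; rewrite fro_adj /qnorm /pnorm mulrACA.
by apply: ler_pM; rewrite ?fro_ge0 // fro_cword // ltnW.
Qed.

Lemma fro_pmx0 g s : fro (pmx0 g s) <= qnorm s * pnorm g s.
Proof.
rewrite /pmx0; case: eqP => [e|_]; last by rewrite fro0 mulr_ge0 ?qnorm_ge0 ?pnorm_ge0.
rewrite froZ ger0_norm ?aw_ge0 // /qnorm /pnorm -e mulrC.
apply: ler_pM; rewrite ?fro_ge0 ?aw_ge0 //; last by rewrite -expr2 aw_le.
by apply: le_trans (fro_mul _ _) _; rewrite fro_adj.
Qed.

Lemma fro_pmxB g h s :
  fro (pmx g h s - pmx0 g s) <= qnorm s * \sum_(i < n) \sum_(j < n)
    cabs (wdiff hn g h s.1 s.2 (widen_ord (ltnW hnp) i) (widen_ord (ltnW hnp) j)).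
Proof.
pose D : 'M[C]_n := \matrix_(i, j)
  wdiff hn g h s.1 s.2 (widen_ord (ltnW hnp) i) (widen_ord (ltnW hnp) j).
have -> : pmx g h s - pmx0 g s = Q s.1 *m D *m (Q s.2)^t*.
  have -> : D = corner R n p *m (word g h s.1 *m (word g h s.2)^t*) *m (corner R n p)^T
     - (if s.1 == s.2 then (aw hn g s.1)%:C%C else 0)%:M.
    apply/matrixP => i j; rewrite mxE /wdiff [RHS]mxE (corner_conj (ltnW hnp)) !mxE.
    congr (_ - _); have -> : (widen_ord (ltnW hnp) i == widen_ord (ltnW hnp) j) = (i == j) by [].
    by case: (s.1 == s.2); case: (i == j); rewrite /= ?mulr1n ?mulr0n ?mul0rn.
  rewrite mulmxBr mulmxBl; congr (_ - _).
    rewrite /pmx /cword !trmx_mul !map_mxM /= -/(corner R n p) !mulmxA.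
    by congr (_ *m _ *m _); rewrite corner_adj.
  rewrite /pmx0; case: eqP => [e|_]; last by rewrite -scalemx1 scale0r mulmx0 mul0mx.
  by rewrite mul_mx_scalar -scalemxAl /Wmx -e.
apply: le_trans (fro_mul _ _) _; rewrite fro_adj /qnorm [leRHS]mulrAC ler_wpM2r ?fro_ge0 //.
apply: le_trans (fro_mul _ _) _; rewrite ler_wpM2l ?fro_ge0 //.
apply: le_trans (fro_le_sum_cabs _) _.
by apply: ler_sum => i _; apply: ler_sum => j _; rewrite mxE.
Qed.

Definition tterm g h f : C := \tr (\prod_(k < K) pmx g h (f k)).
Definition tterm0 g f : C := \tr (\prod_(k < K) pmx0 g (f k)).
Definition qprod f : R := \prod_(k < K) qnorm (f k).
Definition pprod g f : R := \prod_(k < K) pnorm g (f k).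

Lemma qprod_ge0 f : 0 <= qprod f.
Proof. by apply: prodr_ge0 => k _; exact: qnorm_ge0. Qed.

Lemma pprod_ge0 g f : 0 <= pprod g f.
Proof. by apply: prodr_ge0 => k _; exact: pnorm_ge0. Qed.

Lemma env_gmeas_pprod f : @env_gmeas R m n p (pprod ^~ f).
Proof. by apply: env_measurable_prod => k; exact: env_gmeas_pnorm. Qed.

Lemma cabs_tterm g h f : (forall i, h i \is unitarymx) ->
  cabs (tterm g h f) <= n%:R * (qprod f * pprod g f).
Proof.
move=> uh; rewrite /qprod /pprod -big_split /=.
by apply: cabs_tr_prod => k; exact: fro_pmx.
Qed.

Lemma env_measurable_ttermB f : env_measurable (fun g h => cabs (tterm g h f - tterm0 g f)).
Proof.
have mB : env_cmeas (fun g h => \prod_(k < K) pmx g h (f k) - \prod_(k < K) pmx0 g (f k)).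
  apply: env_cmeasB; apply: env_cmeas_prod => k; [exact: env_cmeas_pmx|exact: env_cmeas_pmx0].
move=> d D g h mg mh; have := env_measurable_cabs_tr mB mg mh.
by under eq_fun do rewrite raddfB.
Qed.

(** Telescoping over the [K] factors and summing over the [n ^ 2] entries of the block, each
    estimated by [word_dist]. *)
Lemma Ex_ttermB f :
  (E (fun g h => cabs (tterm g h f - tterm0 g f))%R <=
   (n%:R * qprod f * (K%:R * n%:R ^+ 2 * (dist_cst R m n / Num.sqrt p%:R)))%:E *
   E (fun g _ => pprod g f))%E.
Proof.
pose r := dist_cst R m n / Num.sqrt p%:R.
have r0 : 0 <= r by rewrite divr_ge0 ?sqrtr_ge0 // mulr_ge0.
(* The other factors are bounded by norms that depend on [g] only; this is the weight for which
   [word_dist] was stated. *)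
pose F k g := n%:R * qnorm (f k) * \prod_(j < K | j != k) (qnorm (f j) * pnorm g (f j)).
have F0 k g : 0 <= F k g.
  apply: mulr_ge0; first by rewrite mulr_ge0 ?qnorm_ge0.
  apply: prodr_ge0 => j _.
  by rewrite mulr_ge0 ?qnorm_ge0 ?pnorm_ge0.
have mF k : @env_gmeas R m n p (F k).
  apply: env_measurableM; first exact: env_measurable_cst.
  apply: env_measurable_prod => j; apply: env_measurableM; first exact: env_measurable_cst.
  exact: env_gmeas_pnorm.
pose w := fun i : 'I_n => widen_ord (ltnW hnp) i.
pose Phi (z : 'I_K * ('I_n * 'I_n)) g h :=
  F z.1 g * cabs (wdiff hn g h (f z.1).1 (f z.1).2 (w z.2.1) (w z.2.2)).
have mPhi z : env_measurable (Phi z).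
  by apply: env_measurableM; [exact: mF|exact: env_measurable_wdiff].
have Phi0 z g h : 0 <= Phi z g h by rewrite mulr_ge0 ?cabs_ge0.
apply: (@le_trans _ _ (E (fun g h => \sum_z Phi z g h)%R)).
  apply: Ex_le => //.
  - exact: env_measurable_ttermB.
  - exact: env_measurable_sum.
  - by move=> g h; exact: cabs_ge0.
  - by move=> g h; apply: sumr_ge0.
  move=> g h uh; rewrite -(pair_bigA _ (fun k ij => Phi (k, ij) g h)) /=.
  apply: le_trans (cabs_tr_prodB (c := fun k => qnorm (f k) * pnorm g (f k)) _ _) _.
  - by move=> k; exact: fro_pmx.
  - by move=> k; exact: fro_pmx0.
  rewrite mulr_sumr; apply: ler_sum => k _.
  rewrite -(pair_bigA _ (fun i j => Phi (k, (i, j)) g h)) /= /Phi /=.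
  under [leRHS]eq_bigr do rewrite -mulr_sumr.
  rewrite -mulr_sumr /F [leRHS]mulrAC -[X in _ <= X * _]mulrA -[leRHS]mulrA ler_wpM2l //.
  rewrite ler_wpM2r //; last exact: fro_pmxB.
  by apply: prodr_ge0 => j _; rewrite mulr_ge0 ?qnorm_ge0 ?pnorm_ge0.
rewrite Ex_sum // -ExZ; last 3 first.
- exact: env_gmeas_pprod.
- by rewrite mulr_ge0 // mulr_ge0 // ?qprod_ge0 // mulr_ge0 // exprn_ge0.
- by move=> g _; exact: pprod_ge0.
apply: (@le_trans _ _ (E (fun g _ => \sum_(z : 'I_K * ('I_n * 'I_n))
   (n%:R * qprod f * r) * pprod g f)%R)); last first.
  rewrite le_eqVlt; apply/orP; left; apply/eqP; apply: eq_Ex => g h.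
  by rewrite sumr_const !card_prod !card_ord -[LHS]mulr_natl !natrM -/r; ring.
have q0 : 0 <= n%:R * qprod f * r by rewrite mulr_ge0 // mulr_ge0 // qprod_ge0.
rewrite Ex_sum; last 2 first.
- move=> z; apply: env_measurableM; first exact: env_measurable_cst.
  exact: env_gmeas_pprod.
- by move=> z g _; rewrite mulr_ge0 // pprod_ge0.
apply: lee_sum => z _.
apply: le_trans (word_dist hH hind hn hnp hdvd _ _ _ _ (mF z.1) (F0 z.1)) _ => //=.
rewrite le_eqVlt; apply/orP; left; apply/eqP; apply: eq_Ex => g h.
rewrite -/r /F -/(pnorm g (f z.1)) big_split /= /qprod /pprod.
by rewrite [in RHS](bigD1 z.1) //= [\prod_(k < K) pnorm _ _](bigD1 z.1) //=; ring.
Qed.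

End PairTerms.

Section PositiveTraces.
Context (R : realType).
Local Notation C := R[i].

Lemma lee_sum_card (I : finType) (P : pred I) (a : I -> \bar R) (x : R) : 0 <= x ->
  (forall i, P i -> a i <= x%:E)%E -> (\sum_(i | P i) a i <= (#|I|%:R * x)%:E)%E.
Proof.
move=> x0 ax; apply: (@le_trans _ _ (\sum_(i | P i) x%:E)%E); first exact: lee_sum.
rewrite sumEFin lee_fin sumr_const -[leLHS]mulr_natl ler_wpM2r // ler_nat.
exact: max_card.
Qed.

Lemma tr_psd_exp_ge0 n K (A : 'M[C]_n) : psd A -> (0 < K)%N -> 0 <= complex.Re (\tr (A ^+ K)).
Proof.
case: K => // K pA _; have := tr_exp_mono K pA (@psd0 _ n); rewrite subr0 => /(_ pA).
by rewrite expr0n /= mxtrace0.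
Qed.

Lemma psd_Ymx m n p (Q : ncpoly R m n) g h : psd (@Ymx R m n p Q g h).
Proof.
have -> : Ymx Q g h = (\sum_S cword Q g h S) *m (\sum_S cword Q g h S)^t*.
  rewrite /Ymx -(pair_bigA _ (fun S V => cword Q g h S *m (cword Q g h V)^t*)) /=.
  rewrite mulmx_suml; apply: eq_bigr => S _.
  by rewrite linear_sum /= map_mx_sum mulmx_sumr.
exact: psd_mul_adj.
Qed.

End PositiveTraces.

(** * The estimate term by term *)

Section CrudeBound.
Context (R : realType) (m n p : nat) (disp : measure_display)
  (T : measurableType disp) (P : probability T R)
  (G : 'I_m -> {RV P >-> borel_mx R n}) (H : 'I_m -> {RV P >-> borel_mx R p}).
Hypothesis hH : forall i : 'I_m, haar_unitary (distribution P (H i)).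
Hypothesis hind : mutually_independent P (fun k : 'I_m + 'I_m =>
       match k with
       | inl i => g_sigma_algebra_preimage (G i)
       | inr i => g_sigma_algebra_preimage (H i)
       end).
Hypotheses (hn : (0 < n)%N) (hnp : (n < p)%N) (hdvd : (n %| p)%N).
Variable cG : probability (borel_mx R n) R.
Hypothesis hG : forall (i : 'I_m) (A : set (borel_mx R n)), measurable A ->
       distribution P (G i) A = cG A.
Hypothesis hG2 : mx_integrable cG (fun G => G *m G^t*).
Hypothesis hG2E : mx_mean cG (fun G => G *m G^t*) = 1%:M.
Variables (K : nat) (c : R).
Hypotheses (hK : (0 < K)%N) (hc : 1 <= c).
Hypothesis hGK : mx_integrable cG (fun G => (G *m G^t*) ^+ K).
Hypothesis hGKE : opnorm (mx_mean cG (fun G => (G *m G^t*) ^+ K)) <= c.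
Local Notation C := R[i].
Local Notation genv := ('I_m -> 'M[C]_n).
Local Notation henv := ('I_m -> 'M[C]_p).
Local Notation E := (Ex G H).
Implicit Types (g : genv) (h : henv) (S V : {set 'I_m}).
Local Notation SP := ({set 'I_m} * {set 'I_m})%type.
Variables (Q : ncpoly R m n) (d : nat).
Hypothesis hQd : ncdeg_le d Q.
Hypothesis hQ1 : forall b : {ffun 'I_m -> bool}, opnorm (nceval_sign Q b) <= 1.
Implicit Types f : {ffun 'I_K -> SP}.

Let n1 : (1 : R) <= n%:R. Proof. by rewrite ler1n. Qed.

(** A tuple of [K] pairs read as a family of [2 * K] sets, to which the Hölder bounds with exponent
    [2 * K] apply. *)
Definition letter f (l : 'I_K * bool) := if l.2 then (f l.1).1 else (f l.1).2.

Lemma pprodE g f : pprod g f = \prod_l wnorm g (letter f l).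
Proof.
rewrite -(pair_bigA _ (fun k b => wnorm g (letter f (k, b)))) /=.
by apply: eq_bigr => k _; rewrite big_bool.
Qed.

Lemma card_letter : #|{: 'I_K * bool}| = (2 * K)%N.
Proof. by rewrite card_prod card_ord card_bool mulnC. Qed.

Lemma letter_small f : qprod Q f != 0 -> forall l, (#|letter f l| <= d)%N.
Proof.
move=> q0 [k b]; rewrite leqNgt; apply: contra q0 => /hQd q.
rewrite /qprod (bigD1 k) //= /qnorm; case: b q; rewrite /letter /= => ->;
  by rewrite fro0 ?(mul0r, mulr0).
Qed.

Lemma fro_coef_le S : fro (Q S) <= Num.sqrt n%:R.
Proof. by rewrite /fro ler_wsqrtr // fro2_coef_le. Qed.

Lemma qnorm_le s : qnorm Q s <= n%:R.
Proof.
apply: (@le_trans _ _ (Num.sqrt n%:R * Num.sqrt n%:R)).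
  by rewrite ler_pM ?fro_ge0 ?fro_coef_le.
by rewrite -expr2 sqr_sqrtr.
Qed.

Lemma qprod_le f : qprod Q f <= n%:R ^+ K.
Proof.
have -> : n%:R ^+ K = \prod_(k < K) n%:R :> R by rewrite prodr_const card_ord.
by apply: ler_prod => k _; rewrite qnorm_ge0 qnorm_le.
Qed.

Local Notation tau := (max_influence Q).
Local Notation f0 := ([ffun=> (finset.set0, finset.set0)] : {ffun 'I_K -> SP}).

Lemma sqrt_n_le : Num.sqrt n%:R <= n%:R :> R.
Proof. by rewrite -(ler_pXn2r (n := 2)) ?nnegrE ?sqrtr_ge0 // sqr_sqrtr // expr2 ler_peMr. Qed.

Lemma qnorm_le_sqrt s : s != (finset.set0, finset.set0) -> qnorm Q s <= Num.sqrt tau * n%:R.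
Proof.
move=> sn0; have fc S : S != finset.set0 -> fro (Q S) <= Num.sqrt tau.
  by move=> S0; rewrite /fro ler_wsqrtr // fro2_le_max_influence.
have fn S : fro (Q S) <= n%:R by apply: le_trans (fro_coef_le S) sqrt_n_le.
rewrite /qnorm; have [e1|s1] := eqVneq s.1 finset.set0; last first.
  by rewrite ler_pM ?fro_ge0 // fc.
rewrite mulrC ler_pM ?fro_ge0 // fc //.
by apply: contra sn0 => /eqP e2; rewrite (surjective_pairing s) e1 e2.
Qed.

Lemma qprod_le_sqrt f : f != f0 -> qprod Q f <= Num.sqrt tau * n%:R ^+ K.
Proof.
move=> ff0; have [k fk] : exists k, f k != (finset.set0, finset.set0).
  apply/existsP; apply: contraR ff0; rewrite negb_exists => /forallP hf.
  by apply/eqP/ffunP => k; rewrite ffunE; apply/eqP; move: (hf k); rewrite negbK.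
rewrite /qprod (bigD1 k) //=.
have -> : n%:R ^+ K = n%:R * n%:R ^+ K.-1 :> R by rewrite -exprS prednK.
rewrite mulrA.
apply: ler_pM; rewrite ?qnorm_ge0 ?qnorm_le_sqrt //.
  by apply: prodr_ge0 => j _; exact: qnorm_ge0.
have -> : K.-1 = #|[set~ k]%SET| by rewrite cardsC1 card_ord.
rewrite -prodr_const [leRHS](eq_bigl (fun j => j != k)); last by move=> j; rewrite !inE.
by apply: ler_prod => j _; rewrite qnorm_ge0 qnorm_le.
Qed.

(** A vanishing product of coefficients is treated apart, since the sets may then have more than [d]
    elements and the moment bound is not at hand. *)
Lemma qprod_Ex_le f a M : 0 <= a -> 0 <= M ->
  ((forall l, #|letter f l| <= d)%N -> E (fun g _ => pprod g f) <= M%:E)%E ->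
  qprod Q f <= a ->
  ((qprod Q f)%:E * E (fun g _ => pprod g f) <= (a * M)%:E)%E.
Proof.
move=> a0 M0 hM qa; have [->|q0] := eqVneq (qprod Q f) 0.
  by rewrite mul0e lee_fin mulr_ge0.
rewrite EFinM; apply: lee_pmul; rewrite ?lee_fin ?qprod_ge0 //.
  by apply: Ex_ge0 => g h; exact: pprod_ge0.
by apply: hM; exact: letter_small.
Qed.

Lemma Ex_pprod_le f : (forall l, #|letter f l| <= d)%N ->
  (E (fun g _ => pprod g f) <= ((n%:R ^+ K * c) ^+ d)%:E)%E.
Proof.
move=> ld; under eq_Ex do rewrite pprodE.
exact: (Ex_wnorm_le hind hn hG hK hc hGK hGKE card_letter ld).
Qed.

Lemma tr_Ymx_expE g h : \tr (Ymx Q g h ^+ K) = \sum_(f : {ffun 'I_K -> SP}) tterm Q g h f.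
Proof. by rewrite /Ymx tr_exp_sum. Qed.

Lemma env_measurable_tr_Ymx :
  env_measurable (fun g (h : henv) => complex.Re (\tr (Ymx Q g h ^+ K))).
Proof.
apply: env_measurable_Re_tr; apply: env_cmeas_exp; apply: env_cmeas_sum => s.
exact: env_cmeas_pmx.
Qed.

Lemma tterm_f0 g h : tterm Q g h f0 = \tr (Wmx Q finset.set0 ^+ K).
Proof.
rewrite /tterm (eq_bigr (fun=> Wmx Q finset.set0)); first by rewrite prodr_const card_ord.
move=> k _; rewrite ffunE /pmx /cword /= word0 mulmx1 trmx_mul map_mxM /= corner_adj.
by rewrite -mulmxA [X in _ *m X]mulmxA corner_mulT ?mul1mx // ltnW.
Qed.

(** Every tuple but the empty one contains a nonempty set and thus a factor [Num.sqrt tau]. The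
    empty tuple has no such factor and is kept exactly. *)
Lemma crude_bound :
  (E (fun g h => complex.Re (\tr (Ymx Q g h ^+ K)))%R <=
   (complex.Re (\tr (Wmx Q finset.set0 ^+ K)) + n%:R *
     (#|{ffun 'I_K -> SP}|%:R * (Num.sqrt tau * n%:R ^+ K * (n%:R ^+ K * c) ^+ d)))%:E)%E.
Proof.
set w0 := complex.Re (\tr (Wmx Q finset.set0 ^+ K)).
have w00 : 0 <= w0 by apply: tr_psd_exp_ge0 => //; exact: psd_W.
have c0 : 0 <= c by apply: le_trans hc.
have mq f : env_measurable (fun g (_ : henv) => qprod Q f * pprod g f).
  by apply: env_measurableM; [exact: env_measurable_cst|exact: env_gmeas_pprod].
have q0 f g (_ : henv) : 0 <= qprod Q f * pprod g f by rewrite mulr_ge0 ?qprod_ge0 ?pprod_ge0.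
have ms : env_measurable (fun g (_ : henv) => 
    \sum_(f : {ffun 'I_K -> SP} | f != f0) qprod Q f * pprod g f).
  exact: env_measurable_sum.
have s0 g (h : henv) : 0 <= \sum_(f : {ffun 'I_K -> SP} | f != f0) qprod Q f * pprod g f.
  by apply: sumr_ge0 => f _; exact: (q0 f g h).
apply: (@le_trans _ _ (E (fun g _ => w0 + n%:R * \sum_(f : {ffun 'I_K -> SP} | f != f0) 
    qprod Q f * pprod g f)%R)).
  apply: (Ex_le G hH).
  - exact: env_measurable_tr_Ymx.
  - apply: env_measurableD; first exact: env_measurable_cst.
    by apply: env_measurableM; [exact: env_measurable_cst|].
  - by move=> g h; apply: tr_psd_exp_ge0 => //; exact: psd_Ymx.
  - by move=> g h; rewrite addr_ge0 // mulr_ge0 // (s0 g h).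
  move=> g h uh; rewrite tr_Ymx_expE cRe_sum (bigD1 f0) //= tterm_f0 lerD2l mulr_sumr.
  apply: ler_sum => f _; apply: le_trans (Re_le_cabs _) _.
  exact: cabs_tterm.
rewrite ExD //; last 2 first.
- by apply: env_measurableM; [exact: env_measurable_cst|].
- by move=> g h; rewrite mulr_ge0 // (s0 g h).
rewrite Ex_cst EFinD leeD2l // ExZ // EFinM lee_wpmul2l ?lee_fin // Ex_sum //.
apply: lee_sum_card.
  by rewrite !mulr_ge0 ?sqrtr_ge0 ?exprn_ge0 ?mulr_ge0 ?exprn_ge0.
move=> f ff0; rewrite ExZ ?qprod_ge0 //; last 2 first.
- exact: env_gmeas_pprod.
- by move=> g _; exact: pprod_ge0.
apply: qprod_Ex_le.
- by rewrite mulr_ge0 ?sqrtr_ge0 ?exprn_ge0.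
- by rewrite exprn_ge0 ?mulr_ge0 ?exprn_ge0.
- exact: Ex_pprod_le.
- exact: qprod_le_sqrt.
Qed.

End CrudeBound.

Lemma prod_scalemx (R : comNzRingType) n (I : Type) (r : seq I) (a : I -> R)
    (A : I -> 'M[R]_n) :
  \prod_(i <- r) (a i *: A i) = (\prod_(i <- r) a i) *: \prod_(i <- r) A i.
Proof.
elim: r => [|i r IH]; first by rewrite !big_nil scale1r.
rewrite !big_cons IH -![_ * _ in LHS]/(_ *m _) -scalemxAl -scalemxAr scalerA.
by [].
Qed.

Lemma ler_sum_term (R : numDomainType) (I : finType) (P : pred I) (F : I -> R) i :
  P i -> (forall j, 0 <= F j) -> F i <= \sum_(j | P j) F j.
Proof. by move=> Pi F0; rewrite (bigD1 i) //= lerDl sumr_ge0. Qed.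

(** * Tuples of sets with a common index *)

Section Collisions.
Context (R : realType) (m n : nat).
Variables (Q : ncpoly R m n) (d K : nat).
Hypothesis hQd : ncdeg_le d Q.
Hypothesis hQ1 : forall b : {ffun 'I_m -> bool}, opnorm (nceval_sign Q b) <= 1.
Local Notation tau := (max_influence Q).
Implicit Types s : {ffun 'I_K -> {set 'I_m}}.

Definition collision s : bool :=
  [exists k : 'I_K, exists l : 'I_K, exists i : 'I_m,
    [&& k != l, i \in s k & i \in s l]].

(** For fixed [k], [l] and [i] the sum factors over the positions: positions [k] and [l] each give
    the influence of [i], the others at most [n]. One influence is kept, to be summed over [i]
    later. *)
Lemma collision_prod_le (k l : 'I_K) i : k != l ->
  \sum_(s : {ffun 'I_K -> {set 'I_m}} | (i \in s k) && (i \in s l))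
     \prod_(j < K) fro2 (Q (s j)) <= influence Q i * (tau * n%:R ^+ K.-2).
Proof.
move=> kl.
pose F (j : 'I_K) (S : {set 'I_m}) : R :=
  if (j == k) || (j == l) then (if i \in S then fro2 (Q S) else 0) else fro2 (Q S).
have F0 j S : 0 <= F j S by rewrite /F; do 2?[case: ifP => _]; rewrite ?fro2_ge0.
apply: (@le_trans _ _ (\prod_(j < K) \sum_S F j S)).
  rewrite bigA_distr_bigA big_mkcond /=; apply: ler_sum => s _.
  case: ifP => [/andP[ik il]|_]; last by apply: prodr_ge0.
  rewrite le_eqVlt; apply/orP; left; apply/eqP; apply: eq_bigr => j _; rewrite /F.
  by case: eqP => [->|_] /=; [rewrite ik|case: eqP => [->|_] //; rewrite il].
have Fi j : (j == k) || (j == l) -> \sum_S F j S = influence Q i.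
  by move=> jk; rewrite influenceE [RHS]big_mkcond /=; apply: eq_bigr => S _; rewrite /F jk.
rewrite (bigD1 k) //= Fi ?eqxx // (bigD1 l) //=; last by rewrite eq_sym.
rewrite Fi ?eqxx ?orbT //.
apply: ler_pM; rewrite ?influence_ge0 //.
  by rewrite mulr_ge0 ?influence_ge0 // prodr_ge0 // => j _; apply: sumr_ge0.
apply: ler_pM; rewrite ?influence_ge0 ?influence_le_max //.
  by apply: prodr_ge0 => j _; apply: sumr_ge0.
have -> : n%:R ^+ K.-2 = \prod_(j < K | (j != k) && (j != l)) n%:R :> R.
  rewrite prodr_const; congr (_ ^+ _).
  rewrite -[K in LHS]card_ord -(cardC (pred2 k l)) card2 kl /=.
  by apply: eq_card => j; rewrite !inE negb_or.
apply: ler_prod => j /andP[jk jl]; rewrite sumr_ge0 //=.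
apply: le_trans (sum_fro2_le hQ1); apply: ler_sum => S _.
by rewrite /F (negbTE jk) (negbTE jl).
Qed.

(** Union bound over the [K * K.-1] ordered pairs of positions and over [i]; the total influence is
    at most [d * n], so the number of variables does not appear. *)
Lemma sum_collision_le :
  \sum_(s | collision s) \prod_(j < K) fro2 (Q (s j)) <=
  (K * K.-1)%:R * (d%:R * n%:R ^+ K.-1 * tau).
Proof.
have t0 : 0 <= tau by rewrite /max_influence; exact: bigmax_ge_id.
pose pw s := \prod_(j < K) fro2 (Q (s j)).
have pw0 s : 0 <= pw s by apply: prodr_ge0 => j _; exact: fro2_ge0.
apply: (@le_trans _ _ (\sum_(k < K) \sum_(l < K | k != l) \sum_(i < m)
    \sum_(s : {ffun 'I_K -> {set 'I_m}} | (i \in s k) && (i \in s l)) pw s)).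
  have -> : \sum_(k < K) \sum_(l < K | k != l) \sum_(i < m)
      \sum_(s : {ffun 'I_K -> {set 'I_m}} | (i \in s k) && (i \in s l)) pw s =
     \sum_(s : {ffun 'I_K -> {set 'I_m}}) \sum_(k < K) \sum_(l < K | k != l)
       \sum_(i < m | (i \in s k) && (i \in s l)) pw s.
    rewrite [RHS]exchange_big /=; apply: eq_bigr => k _.
    rewrite [RHS](exchange_big_dep (fun l => k != l)) //=; apply: eq_bigr => l kl.
    rewrite [RHS](exchange_big_dep predT) //=; apply: eq_bigr => i _.
    by apply: eq_bigl => s; rewrite kl.
  rewrite big_mkcond /=; apply: ler_sum => s _.
  have nn k : 0 <= \sum_(l < K | k != l) \sum_(i < m | (i \in s k) && (i \in s l)) pw s.
    by apply: sumr_ge0 => l _; apply: sumr_ge0 => i _.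
  case: ifP => [/existsP[k /existsP[l /existsP[i /and3P[kl ik il]]]]|_]; last exact: sumr_ge0.
  apply: le_trans (ler_sum_term (i := k) isT nn).
  apply: le_trans (ler_sum_term (i := l) kl _); last by move=> l'; apply: sumr_ge0.
  by apply: (ler_sum_term (i := i) (F := fun=> pw s)) => //; rewrite ik.
have -> : (K * K.-1)%:R * (d%:R * n%:R ^+ K.-1 * tau) =
    \sum_(k < K) \sum_(l < K | k != l) (d%:R * n%:R ^+ K.-1 * tau).
  under eq_bigr => k _.
    rewrite sumr_const (_ : #|_| = K.-1) ?over //.
    rewrite -[K in RHS]card_ord -(cardC1 k); apply: eq_card => l.
    by rewrite !inE eq_sym.
  by rewrite sumr_const card_ord -mulrnA -[RHS]mulr_natl mulnC.
apply: ler_sum => k _; apply: ler_sum => l kl.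
apply: (@le_trans _ _ (\sum_(i < m) influence Q i * (tau * n%:R ^+ K.-2))).
  by apply: ler_sum => i _; exact: collision_prod_le.
rewrite -mulr_suml; apply: le_trans (ler_wpM2r _ (sum_influence_le hQ1 hQd)) _.
  by rewrite mulr_ge0 // exprn_ge0.
have K2 : (1 < K)%N.
  by case: K k l kl => [[]//|[|//]] k l; rewrite (ord1 k) (ord1 l) eqxx.
have -> : n%:R ^+ K.-1 = n%:R * n%:R ^+ K.-2 :> R by rewrite -exprS; case: K K2 => [|[]].
by rewrite le_eqVlt; apply/orP; left; apply/eqP; ring.
Qed.

End Collisions.

(** * The bound after replacement *)

Section MasterBound.
Context (R : realType) (m n p : nat) (disp : measure_display)
  (T : measurableType disp) (P : probability T R)
  (G : 'I_m -> {RV P >-> borel_mx R n}) (H : 'I_m -> {RV P >-> borel_mx R p}).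
Hypothesis hH : forall i : 'I_m, haar_unitary (distribution P (H i)).
Hypothesis hind : mutually_independent P (fun k : 'I_m + 'I_m =>
       match k with
       | inl i => g_sigma_algebra_preimage (G i)
       | inr i => g_sigma_algebra_preimage (H i)
       end).
Hypotheses (hn : (0 < n)%N) (hnp : (n < p)%N) (hdvd : (n %| p)%N).
Variable cG : probability (borel_mx R n) R.
Hypothesis hG : forall (i : 'I_m) (A : set (borel_mx R n)), measurable A ->
       distribution P (G i) A = cG A.
Hypothesis hG2 : mx_integrable cG (fun G => G *m G^t*).
Hypothesis hG2E : mx_mean cG (fun G => G *m G^t*) = 1%:M.
Variables (K : nat) (c : R).
Hypotheses (hK : (0 < K)%N) (hc : 1 <= c).
Hypothesis hGK : mx_integrable cG (fun G => (G *m G^t*) ^+ K).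
Hypothesis hGKE : opnorm (mx_mean cG (fun G => (G *m G^t*) ^+ K)) <= c.
Local Notation C := R[i].
Local Notation genv := ('I_m -> 'M[C]_n).
Local Notation henv := ('I_m -> 'M[C]_p).
Local Notation E := (Ex G H).
Implicit Types (g : genv) (h : henv) (S V : {set 'I_m}).
Local Notation SP := ({set 'I_m} * {set 'I_m})%type.
Variables (Q : ncpoly R m n) (d : nat).
Hypothesis hQd : ncdeg_le d Q.
Hypothesis hQ1 : forall b : {ffun 'I_m -> bool}, opnorm (nceval_sign Q b) <= 1.
Local Notation tau := (max_influence Q).
Implicit Types (f : {ffun 'I_K -> SP}) (s : {ffun 'I_K -> {set 'I_m}}).

Definition diag_tuple S : {ffun 'I_K -> SP} := [ffun=> (S, S)].

(* For K = 1 no tuple is excluded: the second moment of G is exactly I, and no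
   estimate in terms of tau is available. *)
Definition is_diag f : bool :=
  (1 < K)%N && [exists S, (S != finset.set0) && (f == diag_tuple S)].

Definition wcoef s : R := complex.Re (\tr (\prod_(k < K) Wmx Q (s k))).
Definition awprod g s : R := \prod_(k < K) aw hn g (s k).

Let k0 : 'I_K := Ordinal hK.

Lemma sum_is_diag (F : {ffun 'I_K -> SP} -> R) :
  \sum_(f | is_diag f) F f = \sum_(S | (1 < K)%N && (S != finset.set0)) F (diag_tuple S).
Proof.
rewrite (reindex_onto diag_tuple (fun f => (f k0).1)) /=; last first.
  by move=> f /andP[_ /existsP[S /andP[_ /eqP ->]]]; rewrite ffunE.
apply: eq_bigl => S; rewrite ffunE eqxx andbT /is_diag; congr andb.
apply/existsP/idP => [[V /andP[V0 /eqP/ffunP/(_ k0)]]|S0].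
  by rewrite !ffunE => -[->].
by exists S; rewrite S0 eqxx.
Qed.

Lemma awprod_ge0 g s : 0 <= awprod g s.
Proof. by apply: prodr_ge0 => k _; exact: aw_ge0. Qed.

Lemma env_gmeas_awprod s : @env_gmeas R m n p (awprod ^~ s).
Proof. by apply: env_measurable_prod => k; exact: env_gmeas_aw. Qed.

Lemma ReZ (x : R) (z : C) : complex.Re (x%:C%C * z) = x * complex.Re z.
Proof. by rewrite cReM /= mul0r subr0. Qed.

Lemma sum_tterm0 g :
  \sum_(f : {ffun 'I_K -> SP}) complex.Re (tterm0 hn Q g f) = \sum_s awprod g s * wcoef s.
Proof.
rewrite -cRe_sum /tterm0 -tr_exp_sum.
have -> : \sum_s pmx0 hn Q g s = \sum_S (aw hn g S)%:C%C *: Wmx Q S.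
  rewrite -(pair_bigA _ (fun S V => pmx0 hn Q g (S, V))) /=; apply: eq_bigr => S _.
  rewrite (bigD1 S) //= /pmx0 /= eqxx big1 ?addr0 // => V VS.
  by rewrite eq_sym (negbTE VS).
rewrite tr_exp_sum cRe_sum; apply: eq_bigr => s _.
by rewrite prod_scalemx mxtraceZ -rmorph_prod ReZ.
Qed.

(** Constant tuples are not replaced, but by this sign their limits may be added to the upper bound,
    which completes the sum to the full trace. *)
Lemma Re_tterm0_diag g S : 0 <= complex.Re (tterm0 hn Q g (diag_tuple S)).
Proof.
rewrite /tterm0; under eq_bigr do rewrite ffunE /pmx0 /= eqxx.
rewrite prod_scalemx mxtraceZ -rmorph_prod ReZ mulr_ge0 //.
  by apply: prodr_ge0 => k _; exact: aw_ge0.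
rewrite prodr_const card_ord; apply: tr_psd_exp_ge0 => //; exact: psd_W.
Qed.

Lemma Re_tterm_diag g h S :
  complex.Re (tterm Q g h (diag_tuple S)) <= n%:R * fro2 (cword Q g h S) ^+ K.
Proof.
apply: le_trans (Re_le_cabs _) _; rewrite /tterm.
apply: le_trans (cabs_tr_prod (a := fun=> fro2 (cword Q g h S)) _ _) _.
  move=> k; rewrite ffunE /pmx /=; apply: le_trans (fro_mul _ _) _.
  by rewrite fro_adj -expr2 sqr_fro.
by rewrite prodr_const card_ord.
Qed.

Definition wpos s : R := Num.max (wcoef s) 0.
Definition wneg s : R := Num.max (- wcoef s) 0.

Lemma wpos_ge0 s : 0 <= wpos s. Proof. by rewrite le_max lexx orbT. Qed.
Lemma wneg_ge0 s : 0 <= wneg s. Proof. by rewrite le_max lexx orbT. Qed.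

Lemma wposB s : wpos s - wneg s = wcoef s.
Proof. by rewrite /wpos /wneg /Num.max; case: ifP; case: ifP; lra. Qed.

(* The negative part of the coefficients is moved to the left, so that every
   expectation taken below is one of a nonnegative function. *)
Lemma master_pointwise g h :
  complex.Re (\tr (Ymx Q g h ^+ K)) + \sum_s wneg s * awprod g s <=
  \sum_(S | (1 < K)%N && (S != finset.set0)) n%:R * fro2 (cword Q g h S) ^+ K +
  (\sum_s wpos s * awprod g s +
   \sum_(f | ~~ is_diag f) cabs (tterm Q g h f - tterm0 hn Q g f)).
Proof.
rewrite tr_Ymx_expE cRe_sum (bigID is_diag) /=.
have h1 : \sum_(f | is_diag f) complex.Re (tterm Q g h f) <=
   \sum_(S | (1 < K)%N && (S != finset.set0)) n%:R * fro2 (cword Q g h S) ^+ K +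
   \sum_(f | is_diag f) complex.Re (tterm0 hn Q g f).
  rewrite !sum_is_diag -[leLHS]addr0 lerD //.
    by apply: ler_sum => S _; exact: Re_tterm_diag.
  by apply: sumr_ge0 => S _; exact: Re_tterm0_diag.
have h2 : \sum_(f | ~~ is_diag f) complex.Re (tterm Q g h f) <=
    \sum_(f | ~~ is_diag f) complex.Re (tterm0 hn Q g f) +
    \sum_(f | ~~ is_diag f) cabs (tterm Q g h f - tterm0 hn Q g f).
  rewrite -big_split /=; apply: ler_sum => f _; rewrite -lerBlDl.
  by rewrite -cReN -cReD; exact: Re_le_cabs.
have h3 : \sum_(f | is_diag f) complex.Re (tterm0 hn Q g f) +
    \sum_(f | ~~ is_diag f) complex.Re (tterm0 hn Q g f) =
    \sum_s wpos s * awprod g s - \sum_s wneg s * awprod g s.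
  have := sum_tterm0 g; rewrite (bigID is_diag) /= => ->; rewrite -sumrB; apply: eq_bigr => s _.
  by rewrite -mulrBl wposB mulrC.
lra.
Qed.

Lemma wcoef_le s : `|wcoef s| <= n%:R * \prod_(k < K) fro2 (Q (s k)).
Proof.
have h A : `|complex.Re A| <= cabs A :> R.
  by rewrite ler_norml Re_le_cabs andbT lerNl -cReN -(cabsN A) Re_le_cabs.
apply: le_trans (h _) _; apply: cabs_tr_prod => k.
by apply: le_trans (fro_mul _ _) _; rewrite fro_adj -expr2 sqr_fro.
Qed.

Lemma wcoef_small s : wcoef s != 0 -> forall k, (#|s k| <= d)%N.
Proof.
move=> w0 k; rewrite leqNgt; apply: contra w0 => /hQd q.
rewrite -normr_le0; apply: le_trans (wcoef_le s) _.
by rewrite (bigD1 k) //= q -sqr_fro fro0 expr0n /= mul0r mulr0.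
Qed.

Definition Eaw s : R := fine (E (fun g _ => awprod g s)).

Lemma EawE s : wcoef s != 0 ->
  E (fun g _ => awprod g s) = (Eaw s)%:E /\ 0 <= Eaw s <= c ^+ d.
Proof.
move=> w0; have h1 := Ex_aw_le hind hn hG hK hc hGK hGKE (wcoef_small w0).
have h0 : (0 <= E (fun g _ => awprod g s))%E by apply: Ex_ge0 => g _; exact: awprod_ge0.
have fin : E (fun g _ => awprod g s) \is a fin_num.
  by rewrite ge0_fin_numE //; apply: le_lt_trans h1 _; rewrite ltry.
rewrite /Eaw fineK //; split => //; apply/andP; split; first exact: fine_ge0.
by rewrite -lee_fin fineK.
Qed.

Lemma Ex_awprodZ s x : 0 <= x -> (wcoef s = 0 -> x = 0) ->
  E (fun g _ => x * awprod g s) = (x * Eaw s)%:E.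
Proof.
move=> x0 xw; rewrite ExZ //; last 2 first.
- exact: env_gmeas_awprod.
- by move=> g _; exact: awprod_ge0.
have [w0|w0] := eqVneq (wcoef s) 0; first by rewrite xw // mul0e mul0r.
by have [-> _] := EawE w0; rewrite EFinM.
Qed.

(** Without a collision the mean of the weights is 1; with one it lies between 0 and [c ^+ d], so it
    differs from 1 by at most [c ^+ d]. *)
Lemma Eaw_le s :
  wcoef s * Eaw s <= wcoef s + (if collision s then c ^+ d * `|wcoef s| else 0).
Proof.
have [->|w0] := eqVneq (wcoef s) 0; first by rewrite !mul0r normr0 mulr0 add0r; case: ifP.
have [e /andP[a0 a1]] := EawE w0; have c1 : 1 <= c ^+ d by exact: exprn_ege1.
case: ifP => col.
  rewrite -lerBlDl -{2}[wcoef s]mulr1 -mulrBr mulrC; apply: le_trans (ler_norm _) _.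
  rewrite normrM ler_wpM2r // ler_norml; lra.
suff -> : Eaw s = 1 by rewrite mulr1 addr0.
rewrite /Eaw (Ex_aw_disjoint hind hn hG hG2 hG2E) // => i k l ik il.
apply/eqP; apply: contraFT col => kl; apply/existsP; exists k; apply/existsP; exists l.
by apply/existsP; exists i; rewrite kl ik il.
Qed.

Lemma sum_Eaw_le : \sum_s wcoef s * Eaw s <=
  complex.Re (\tr ((\sum_S Wmx Q S) ^+ K)) +
  c ^+ d * (n%:R * ((K * K.-1)%:R * (d%:R * n%:R ^+ K.-1 * tau))).
Proof.
apply: le_trans (ler_sum _ (fun s _ => Eaw_le s)) _.
rewrite big_split /= tr_exp_sum cRe_sum lerD2l -big_mkcond /= -mulr_sumr.
rewrite ler_wpM2l ?exprn_ge0 //; first by apply: le_trans hc.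
apply: le_trans (ler_sum _ (fun s _ => wcoef_le s)) _.
by rewrite -mulr_sumr ler_wpM2l // sum_collision_le.
Qed.

Lemma Ex_fro2_cword_pow S :
  (E (fun g h => fro2 (cword Q g h S) ^+ K)%R <= (c ^+ d * fro2 (Q S) ^+ K)%:E)%E.
Proof.
have c0 : 0 <= c by apply: le_trans hc.
apply: le_trans (Ex_fro2_word_pow hH hind hdvd hG hK hc hGK hGKE _ S) _.
have -> : fro2 (Q S *m corner R n p) = fro2 (Q S).
  by rewrite -!sqr_fro fro_mul_corner // ltnW.
rewrite lee_fin; have [Sd|/hQd ->] := leqP #|S| d; last first.
  by rewrite -sqr_fro fro0 expr0n /= expr0n -[K == 0]negbK -lt0n hK /= !mulr0.
by rewrite ler_wpM2r ?exprn_ge0 ?fro2_ge0 // ler_weXn2l.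
Qed.

Lemma sum_diag_le : (1 < K)%N ->
  \sum_(S | S != finset.set0) fro2 (Q S) ^+ K <= n%:R * tau ^+ K.-1.
Proof.
move=> K1; have t0 : 0 <= tau by rewrite /max_influence; exact: bigmax_ge_id.
apply: (@le_trans _ _ (\sum_(S | S != finset.set0) fro2 (Q S) * tau ^+ K.-1)).
  apply: ler_sum => S S0; rewrite -{1}(prednK hK) exprS ler_wpM2l ?fro2_ge0 //.
  by rewrite lerXn2r ?nnegrE ?fro2_ge0 // fro2_le_max_influence.
rewrite -mulr_suml ler_wpM2r ?exprn_ge0 //; apply: le_trans (sum_fro2_le hQ1).
by rewrite big_mkcond /=; apply: ler_sum => S _; case: ifP => // _; exact: fro2_ge0.
Qed.

(** The moment bound [M] stays a parameter because [K = 1] and [K > 1] use different ones. *)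
Lemma master_bound M : 0 <= M ->
  (forall f, ~~ is_diag f -> (forall l, #|letter f l| <= d)%N ->
    (E (fun g _ => pprod g f) <= M%:E)%E) ->
  (E (fun g h => complex.Re (\tr (Ymx Q g h ^+ K)))%R <=
   ((if (1 < K)%N then n%:R * (c ^+ d * (n%:R * tau ^+ K.-1)) else 0) +
    (complex.Re (\tr ((\sum_S Wmx Q S) ^+ K)) +
     c ^+ d * (n%:R * ((K * K.-1)%:R * (d%:R * n%:R ^+ K.-1 * tau)))) +
    n%:R * (K%:R * n%:R ^+ 2 * (dist_cst R m n / Num.sqrt p%:R)) *
     (#|{ffun 'I_K -> SP}|%:R * (n%:R ^+ K * M)))%:E)%E.
Proof.
move=> M0 hM; have c0 : 0 <= c by apply: le_trans hc.
pose r := K%:R * n%:R ^+ 2 * (dist_cst R m n / Num.sqrt p%:R).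
have r0 : 0 <= r.
  rewrite /r mulr_ge0 // ?divr_ge0 ?sqrtr_ge0 // /dist_cst ?mulr_ge0 // exprn_ge0 //.
have maw s x : env_measurable (fun g (_ : henv) => x * awprod g s).
  by apply: env_measurableM; [exact: env_measurable_cst|exact: env_gmeas_awprod].
have nw s g (h : henv) : 0 <= wneg s * awprod g s by rewrite mulr_ge0 ?wneg_ge0 ?awprod_ge0.
have pw s g (h : henv) : 0 <= wpos s * awprod g s by rewrite mulr_ge0 ?wpos_ge0 ?awprod_ge0.
have mD S : env_measurable (fun g h => n%:R * fro2 (cword Q g h S) ^+ K).
  apply: env_measurableM; first exact: env_measurable_cst.
  by apply: env_measurableX; apply: env_measurable_fro2; exact: env_cmeas_cword.
have D0 S g h : 0 <= n%:R * fro2 (cword Q g h S) ^+ K by rewrite mulr_ge0 ?exprn_ge0 ?fro2_ge0.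
have mYn := @env_measurable_tr_Ymx R m n p hdvd K Q.
have mneg : env_measurable (fun g (_ : henv) => \sum_s wneg s * awprod g s).
  exact: env_measurable_sum.
have mpos : env_measurable (fun g (_ : henv) => \sum_s wpos s * awprod g s).
  exact: env_measurable_sum.
have mdg : env_measurable (fun g h => \sum_(S | (1 < K)%N && (S != finset.set0))
    n%:R * fro2 (cword Q g h S) ^+ K) by exact: env_measurable_sum.
have mer : env_measurable (fun g h =>
    \sum_(f | ~~ is_diag f) cabs (tterm Q g h f - tterm0 hn Q g f)).
  by apply: env_measurable_sum => f; exact: env_measurable_ttermB.
have er0 g h : 0 <= \sum_(f | ~~ is_diag f) cabs (tterm Q g h f - tterm0 hn Q g f).
  by apply: sumr_ge0 => f _; exact: cabs_ge0.
have Y0 g h : 0 <= complex.Re (\tr (Ymx Q g h ^+ K)).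
  by apply: tr_psd_exp_ge0 => //; exact: psd_Ymx.
have neg0 g (h : henv) : 0 <= \sum_s wneg s * awprod g s 
  by apply: sumr_ge0 => s _; exact: (nw s g h).
have pos0 g (h : henv) : 0 <= \sum_s wpos s * awprod g s 
  by apply: sumr_ge0 => s _; exact: (pw s g h).
have dg0 g h : 0 <= \sum_(S | (1 < K)%N && (S != finset.set0)) n%:R * fro2 (cword Q g h S) ^+ K.
  by apply: sumr_ge0 => S _; exact: D0.
have mpe := env_measurableD mpos mer.
have pe0 g h := addr_ge0 (pos0 g h) (er0 g h).
have := Ex_le G hH (env_measurableD mYn mneg) (env_measurableD mdg mpe)
  (fun g h => addr_ge0 (Y0 g h) (neg0 g h)) (fun g h => addr_ge0 (dg0 g h) (pe0 g h))
  (fun g h _ => master_pointwise g h).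
rewrite (ExD G H mYn mneg) // (ExD G H mdg mpe) // (ExD G H mpos mer) //.
rewrite (Ex_sum G H _ _ (fun s => maw s _) nw) (Ex_sum G H _ _ (fun s => maw s _) pw).
have en s : E (fun g _ => wneg s * awprod g s) = (wneg s * Eaw s)%:E.
  by apply: Ex_awprodZ => [|w0]; rewrite ?wneg_ge0 // /wneg w0 oppr0 maxxx.
have ep s : E (fun g _ => wpos s * awprod g s) = (wpos s * Eaw s)%:E.
  by apply: Ex_awprodZ => [|w0]; rewrite ?wpos_ge0 // /wpos w0 maxxx.
rewrite (eq_bigr _ (fun s _ => en s)) (eq_bigr _ (fun s _ => ep s)).
(* The negative part has a finite mean, so it can be subtracted again. *)
rewrite !sumEFin -leeBrDr // => main; apply: le_trans main _.
have hdiag : (E (fun g h => \sum_(S | (1 < K)%N && (S != finset.set0))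
    n%:R * fro2 (cword Q g h S) ^+ K)%R <=
    (if (1 < K)%N then n%:R * (c ^+ d * (n%:R * tau ^+ K.-1)) else 0)%:E)%E.
  rewrite (Ex_sum G H _ _ mD D0); case: (ltnP 1 K) => K1; last by rewrite big_pred0.
  apply: (@le_trans _ _ (\sum_(S : {set 'I_m} | S != finset.set0)
      (n%:R * (c ^+ d * fro2 (Q S) ^+ K))%:E)%E).
    apply: lee_sum => S _; rewrite ExZ //; last 2 first.
    - by apply: env_measurableX; apply: env_measurable_fro2; exact: env_cmeas_cword.
    - by move=> g h; rewrite exprn_ge0 ?fro2_ge0.
    by rewrite EFinM lee_wpmul2l ?lee_fin // Ex_fro2_cword_pow.
  rewrite sumEFin lee_fin -mulr_sumr ler_wpM2l // -mulr_sumr ler_wpM2l ?exprn_ge0 //.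
  exact: sum_diag_le.
have herr : (E (fun g h => \sum_(f | ~~ is_diag f) cabs (tterm Q g h f - tterm0 hn Q g f))%R <=
    (n%:R * r * (#|{ffun 'I_K -> SP}|%:R * (n%:R ^+ K * M)))%:E)%E.
  rewrite Ex_sum; last 2 first.
  - by move=> f; exact: env_measurable_ttermB.
  - by move=> f g h; exact: cabs_ge0.
  rewrite mulrCA; apply: lee_sum_card; first by rewrite !mulr_ge0 // exprn_ge0.
  move=> f fD; apply: le_trans (Ex_ttermB hH hind hn hnp hdvd Q f) _; rewrite -/r.
  rewrite [X in X%:E](_ : _ = (n%:R * r) * qprod Q f); last by ring.
  rewrite EFinM -muleA [leRHS]EFinM lee_wpmul2l ?lee_fin ?mulr_ge0 //.
  apply: (qprod_Ex_le hQd) => //; rewrite ?exprn_ge0 //; first exact: hM.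
  exact: qprod_le.
apply: le_trans (leeB (leeD hdiag (leeD2l _ herr)) (lexx _)) _.
rewrite -!EFinD lee_fin -/r.
have := sum_Eaw_le.
have -> : \sum_s wcoef s * Eaw s = \sum_s wpos s * Eaw s - \sum_s wneg s * Eaw s.
  by rewrite -sumrB; apply: eq_bigr => s _; rewrite -mulrBl wposB.
lra.
Qed.

End MasterBound.

(** * Conclusion *)

Lemma opnorm_1 (R : realType) n : opnorm (1%:M : 'M[R[i]]_n) <= 1.
Proof.
apply: ge_sup; last by move=> _ [v /= v1 <-]; rewrite mul1mx.
exists 0; exists 0; first by rewrite /= l2norm_fro fro0.
by rewrite mulmx0 l2norm_fro fro0.
Qed.

Section Conclusions.
Context (R : realType) (m n p : nat) (disp : measure_display)
  (T : measurableType disp) (P : probability T R)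
  (G : 'I_m -> {RV P >-> borel_mx R n}) (H : 'I_m -> {RV P >-> borel_mx R p}).
Hypothesis hH : forall i : 'I_m, haar_unitary (distribution P (H i)).
Hypothesis hind : mutually_independent P (fun k : 'I_m + 'I_m =>
       match k with
       | inl i => g_sigma_algebra_preimage (G i)
       | inr i => g_sigma_algebra_preimage (H i)
       end).
Hypotheses (hn : (0 < n)%N) (hnp : (n < p)%N) (hdvd : (n %| p)%N).
Variable cG : probability (borel_mx R n) R.
Hypothesis hG : forall (i : 'I_m) (A : set (borel_mx R n)), measurable A ->
       distribution P (G i) A = cG A.
Hypothesis hG2 : mx_integrable cG (fun G => G *m G^t*).
Hypothesis hG2E : mx_mean cG (fun G => G *m G^t*) = 1%:M.
Variables (K : nat) (c : R).
Hypotheses (hK : (0 < K)%N) (hc : 1 <= c).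
Hypothesis hGK : mx_integrable cG (fun G => (G *m G^t*) ^+ K).
Hypothesis hGKE : opnorm (mx_mean cG (fun G => (G *m G^t*) ^+ K)) <= c.
Local Notation C := R[i].
Local Notation genv := ('I_m -> 'M[C]_n).
Local Notation henv := ('I_m -> 'M[C]_p).
Local Notation E := (Ex G H).
Implicit Types (g : genv) (h : henv) (S V : {set 'I_m}).
Local Notation SP := ({set 'I_m} * {set 'I_m})%type.
Variables (Q : ncpoly R m n) (d : nat).
Hypothesis hQd : ncdeg_le d Q.
Hypothesis hQ1 : forall b : {ffun 'I_m -> bool}, opnorm (nceval_sign Q b) <= 1.
Local Notation tau := (max_influence Q).
Local Notation lhs := ('E_P[(fun w => n%:R^-1 * tr_abs_pow (2 * K)
          (nceval (ncpoly_iota p Q)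
             (fun i => tens_idmx p (G i w) *m H i w)))%R])%E.
Local Notation rhs := (sign_mean (fun b => n%:R^-1 * tr_abs_pow (2 * K) (nceval_sign Q b))).

Let n0 : (n%:R : R) != 0. Proof. by rewrite pnatr_eq0 -lt0n. Qed.
Let n1 : (1 : R) <= n%:R. Proof. by rewrite ler1n. Qed.

Lemma expectation_Ex :
  lhs = (n%:R^-1%:E * E (fun g h => complex.Re (\tr (Ymx Q g h ^+ K))))%E.
Proof.
rewrite -ExZ ?invr_ge0 //.
- rewrite unlock /Ex; apply: eq_integral => w _; congr EFin; congr (_ * _).
  by rewrite tr_abs_pow_iota // ltnW.
- exact: env_measurable_tr_Ymx.
- by move=> g h; apply: tr_psd_exp_ge0 => //; exact: psd_Ymx.
Qed.

Lemma crude_conclusion :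
  (lhs <= (rhs + #|{ffun 'I_K -> SP}|%:R *
     (Num.sqrt tau * n%:R ^+ K * (n%:R ^+ K * c) ^+ d))%:E)%E.
Proof.
rewrite expectation_Ex.
apply: le_trans (lee_wpmul2l _ (crude_bound hH hind hn hnp hdvd hG hK hc hGK hGKE hQd hQ1)) _.
  by rewrite lee_fin invr_ge0.
rewrite -EFinM lee_fin mulrDr mulKf // lerD2r; apply: le_trans (sign_mean_ge Q hK).
by rewrite ler_wpM2l ?invr_ge0 // tr_W_exp_ge.
Qed.

Lemma master_conclusion M : 0 <= M ->
  (forall f : {ffun 'I_K -> SP}, ~~ is_diag f -> (forall l, #|letter f l| <= d)%N ->
    (E (fun g _ => pprod g f) <= M%:E)%E) ->
  (lhs <= (rhs + ((if (1 < K)%N then c ^+ d * (n%:R * tau ^+ K.-1) else 0) +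
    c ^+ d * ((K * K.-1)%:R * (d%:R * n%:R ^+ K.-1 * tau)) +
    (K%:R * n%:R ^+ 2 * (dist_cst R m n / Num.sqrt p%:R)) *
     (#|{ffun 'I_K -> SP}|%:R * (n%:R ^+ K * M))))%:E)%E.
Proof.
move=> M0 hM; rewrite expectation_Ex.
apply: le_trans (lee_wpmul2l _ (master_bound hH hind hn hnp hdvd hG hG2 hG2E hK hc hGK hGKE
  hQd hQ1 M0 hM)) _; first by rewrite lee_fin invr_ge0.
rewrite -EFinM lee_fin; have := sign_mean_ge Q hK.
set x := complex.Re _; move: rhs => y xy.
rewrite !mulrDr [n%:R^-1 * (c ^+ d * _)]mulrCA mulKf //.
rewrite -[n%:R * _ * (_ * (n%:R ^+ K * M))]mulrA mulKf //.
have -> : n%:R^-1 * (if (1 < K)%N then n%:R * (c ^+ d * (n%:R * tau ^+ K.-1)) else 0) =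
   (if (1 < K)%N then c ^+ d * (n%:R * tau ^+ K.-1) else 0).
  by case: ifP => _; rewrite ?mulr0 // mulKf.
by rewrite !addrA lerD2r lerD2r [leRHS]addrC lerD2l.
Qed.

(** Either some index distinguishes two of the [2 * K] sets and [Ex_wnorm_small] applies, or all of
    them coincide; not being diagonal, the tuple then consists of empty sets and the product is
    1. *)
Lemma diag_bound eps (f : {ffun 'I_K -> SP}) : (1 < K)%N -> 0 < eps -> eps <= 1 ->
  ~~ is_diag f -> (forall l, #|letter f l| <= d)%N ->
  (E (fun g _ => pprod g f) <=
   (eps * (n%:R ^+ K * c) ^+ d + (1 + small_cst n K eps) ^+ (2 * K * d))%:E)%E.
Proof.
move=> K1 eps0 eps1 fD fd.
have sc0 := small_cst_ge0 n K eps0.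
have c0 : 0 <= c by apply: le_trans hc.
under eq_Ex do rewrite pprodE.
have [/existsP[[l1 l2] /existsP[i /andP[/= i1 i2]]]|none] := boolP
  [exists l : ('I_K * bool) * ('I_K * bool), exists i,
    (i \in letter f l.1) && (i \notin letter f l.2)].
  exact: (Ex_wnorm_small hind hn hG hG2 hG2E hK hc hGK hGKE (card_letter K) fd eps0 eps1 i1 i2).
pose S := letter f (Ordinal hK, true).
have same l : letter f l = S.
  have sub l1 l2 : letter f l1 \subset letter f l2.
    apply/fintype.subsetP => i i1; apply: contraR none => i2; apply/existsP; exists (l1, l2).
    by apply/existsP; exists i; rewrite /= i1 i2.
  by apply/eqP; rewrite finset.eqEsubset !sub.
have fS : f = diag_tuple K S.
  apply/ffunP => k; rewrite ffunE [f k]surjective_pairing.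
  by have := same (k, true); have := same (k, false); rewrite /letter /= => -> ->.
have S0 : S = finset.set0.
  apply/eqP; apply: contraR fD => Sn0; rewrite /is_diag K1 /=; apply/existsP; exists S.
  by rewrite Sn0 fS eqxx.
under eq_Ex do under eq_bigr do rewrite same S0 /wnorm big_set0.
under eq_Ex do rewrite big1 //.
rewrite Ex_cst lee_fin -[leLHS]add0r lerD ?mulr_ge0 ?exprn_ge0 ?mulr_ge0 ?exprn_ge0 ?(ltW eps0) //.
by rewrite exprn_ege1 // lerDl.
Qed.

End Conclusions.

(** * Numerical inequalities, with [t] for the fourth root of the maximal influence *)

Section RealEstimates.
Context (R : realType).

Lemma pow4_le_mul (t N : R) : 0 <= t -> 1 <= N -> t ^+ 4 <= N -> t <= N /\ t ^+ 4 <= N * t.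
Proof.
move=> t0 N1 tN; have [t1|t1] := leP t 1.
  split; first exact: le_trans N1.
  rewrite exprSr ler_wpM2r //; apply: le_trans N1.
  by rewrite exprn_ile1.
have t14 : t <= t ^+ 4 by rewrite -{1}[t]expr1 ler_weXn2l // ltW.
split; first exact: le_trans tN.
rewrite exprSr ler_wpM2r //; apply: le_trans tN.
by rewrite ler_weXn2l // ltW.
Qed.

(** With [M = 2 ^ m], the number of tuples is [(M * M) ^ K]. One factor [t] is bounded by [N], and
    [(M * N) ^ (2 * d * K) * N ^ (2 * K)] then exceeds both the count and all powers of [N]. *)
Lemma large_K_le (M N K d : nat) (c t : R) : (0 < N)%N -> (0 < K)%N -> (0 < d)%N ->
  (0 < M)%N -> (M * N <= 2 * K - 1)%N -> 0 <= c -> 0 <= t -> t <= N%:R ->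
  ((M * M) ^ K)%:R * (t ^+ 2 * N%:R ^+ K * (N%:R ^+ K * c) ^+ d) <=
  K%:R ^+ 3 * (2 * K%:R - 1) ^+ (2 * d * K) * c ^+ d * N%:R ^+ (2 * K) * t.
Proof.
move=> N0 K0 d0 M0 MN c0 t0 tN.
have e : 2 * K%:R - 1 = (2 * K - 1)%:R :> R by rewrite natrB ?natrM // muln_gt0.
rewrite e exprMn -[N%:R ^+ K ^+ d]exprM.
have key : ((M * M) ^ K * N * N ^ K * N ^ (K * d) <=
    K ^ 3 * (2 * K - 1) ^ (2 * d * K) * N ^ (2 * K))%N.
  apply: (@leq_trans ((M * N) ^ (2 * d * K) * N ^ (2 * K))); last first.
    rewrite leq_mul2r; apply/orP; right; apply: (@leq_trans ((2 * K - 1) ^ (2 * d * K))).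
      by rewrite leq_exp2r // !muln_gt0 d0 K0.
    by rewrite leq_pmull // expn_gt0 K0.
  rewrite [((M * N) ^ _)%N]expnMn [leqRHS]mulnAC -(mulnA _ N).
  have h1 : ((M * M) ^ K <= M ^ (2 * d * K))%N.
    rewrite mulnn -expnM leq_pexp2l // -mulnA leq_pmul2l //.
    by rewrite leq_pmull.
  have h2 : (N ^ (K * d) <= N ^ (2 * d * K))%N.
    by rewrite leq_pexp2l // [(K * d)%N]mulnC -mulnA leq_pmull.
  have h3 : (N * N ^ K <= N ^ (2 * K))%N.
    by rewrite -expnS leq_pexp2l // mul2n -addnn -addn1 leq_add2l.
  by rewrite leq_mul ?leq_mul.
move: key; rewrite -(ler_nat R) !natrM !natrX => key.
have cd0 : 0 <= c ^+ d by rewrite exprn_ge0.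
apply: (@le_trans _ _ (((M * M)%:R ^+ K * N%:R * N%:R ^+ K * N%:R ^+ (K * d)) * c ^+ d * t)).
  have -> : (M * M)%:R ^+ K * (t ^+ 2 * N%:R ^+ K * (N%:R ^+ (K * d) * c ^+ d)) =
    ((M * M)%:R ^+ K * N%:R ^+ K * N%:R ^+ (K * d) * c ^+ d * t) * t :> R by ring.
  have -> : (M * M)%:R ^+ K * N%:R * N%:R ^+ K * N%:R ^+ (K * d) * c ^+ d * t =
    ((M * M)%:R ^+ K * N%:R ^+ K * N%:R ^+ (K * d) * c ^+ d * t) * N%:R :> R by ring.
  by rewrite ler_wpM2l // !mulr_ge0 // exprn_ge0.
have -> : K%:R ^+ 3 * (2 * K - 1)%:R ^+ (2 * d * K) * c ^+ d * N%:R ^+ (2 * K) * t =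
  (K%:R ^+ 3 * (2 * K - 1)%:R ^+ (2 * d * K) * N%:R ^+ (2 * K)) * c ^+ d * t :> R by ring.
by rewrite ler_wpM2r // ler_wpM2r.
Qed.

(** The next two estimates only use the power [N ^ K] of the coefficient and aim at multiples of
    [c ^+ d * N ^ K * t]. *)
Lemma coef_ge (N K d : nat) (c t : R) : (0 < N)%N -> (0 < K)%N -> (0 < d)%N -> 0 <= c -> 0 <= t ->
  c ^+ d * N%:R ^+ K * t * (K%:R ^+ 3 * (2 * K%:R - 1) ^+ (2 * d * K)) <=
  K%:R ^+ 3 * (2 * K%:R - 1) ^+ (2 * d * K) * c ^+ d * N%:R ^+ (2 * K) * t.
Proof.
move=> N0 K0 d0 c0 t0.
have K1 : 1 <= K%:R :> R by rewrite ler1n.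
have N1 : 1 <= N%:R :> R by rewrite ler1n.
have k1 : 0 <= 2 * K%:R - 1 :> R by lra.
have -> : K%:R ^+ 3 * (2 * K%:R - 1) ^+ (2 * d * K) * c ^+ d * N%:R ^+ (2 * K) * t =
  c ^+ d * N%:R ^+ (2 * K) * t * (K%:R ^+ 3 * (2 * K%:R - 1) ^+ (2 * d * K)) by ring.
rewrite ler_wpM2r ?mulr_ge0 ?exprn_ge0 // ler_wpM2r // ler_wpM2l ?exprn_ge0 //.
by rewrite ler_weXn2l // mul2n -addnn leq_addr.
Qed.

(** One factor of [t ^+ 2] absorbs the number [A] of tuples and the power of [N] from the
    moments. *)
Lemma small_t_le (N K d : nat) (A c t : R) : (0 < N)%N -> (0 < K)%N -> (0 < d)%N ->
  0 <= A -> 0 <= c -> 0 <= t -> A * N%:R ^+ (K * d) * t <= 1 ->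
  A * (t ^+ 2 * N%:R ^+ K * (N%:R ^+ K * c) ^+ d) <=
  K%:R ^+ 3 * (2 * K%:R - 1) ^+ (2 * d * K) * c ^+ d * N%:R ^+ (2 * K) * t.
Proof.
move=> N0 K0 d0 A0 c0 t0 At; apply: le_trans (coef_ge N0 K0 d0 c0 t0).
have K1 : 1 <= K%:R :> R by rewrite ler1n.
rewrite exprMn -[N%:R ^+ K ^+ d]exprM.
have -> : A * (t ^+ 2 * N%:R ^+ K * (N%:R ^+ (K * d) * c ^+ d)) =
  (c ^+ d * N%:R ^+ K * t) * (A * N%:R ^+ (K * d) * t) by ring.
rewrite ler_wpM2l ?mulr_ge0 ?exprn_ge0 //; apply: le_trans At _.
have k1 : 1 <= 2 * K%:R - 1 :> R by lra.
by rewrite -[leLHS]mulr1 ler_pM // exprn_ege1.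
Qed.

(** By [t ^+ 4 <= N * t] all terms are multiples of the same [u]: one for the constant tuples, one
    for [x], and [K * K.-1 * d] for the collisions. As [2 <= K * d], the total is at most
    [K * K * d], and [d] is below the exponential factor. *)
Lemma main_terms_le (N K d : nat) (c t x : R) : (0 < N)%N -> (1 < K)%N -> (0 < d)%N ->
  0 <= c -> 0 <= t -> t ^+ 4 <= N%:R -> x <= c ^+ d * t ->
  c ^+ d * (N%:R * (t ^+ 4) ^+ K.-1) +
  c ^+ d * ((K * K.-1)%:R * (d%:R * N%:R ^+ K.-1 * t ^+ 4)) + x <=
  K%:R ^+ 3 * (2 * K%:R - 1) ^+ (2 * d * K) * c ^+ d * N%:R ^+ (2 * K) * t.
Proof.
move=> N0 K1 d0 c0 t0 tN xt; have K0 : (0 < K)%N by apply: ltnW.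
apply: le_trans (coef_ge N0 K0 d0 c0 t0).
have N1 : 1 <= N%:R :> R by rewrite ler1n.
have [tN1 t4] := pow4_le_mul t0 N1 tN.
have cd0 : 0 <= c ^+ d by rewrite exprn_ge0.
have t40 : 0 <= t ^+ 4 by rewrite exprn_ge0.
have NK : N%:R ^+ K = N%:R ^+ K.-1 * N%:R :> R by rewrite -exprSr prednK.
have NKm : N%:R ^+ K.-1 = N%:R * N%:R ^+ K.-2 :> R by rewrite -exprS; case: (K) K1 => [|[]].
have NK1 : 1 <= N%:R ^+ K :> R by rewrite exprn_ege1.
pose u := c ^+ d * N%:R ^+ K * t.
have u0 : 0 <= u by rewrite !mulr_ge0 // exprn_ge0.
have h4 : c ^+ d * N%:R ^+ K.-1 * t ^+ 4 <= u.
  rewrite /u NK -[leRHS]mulrA -mulrA ler_wpM2l // -mulrA ler_wpM2l ?exprn_ge0 //.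
have h1 : c ^+ d * (N%:R * (t ^+ 4) ^+ K.-1) <= u.
  apply: le_trans h4; rewrite -mulrA ler_wpM2l // NKm -mulrA ler_wpM2l //.
  have -> : (t ^+ 4) ^+ K.-1 = (t ^+ 4) ^+ K.-2 * t ^+ 4 by rewrite -exprSr; case: (K) K1 => [|[]].
  by rewrite ler_wpM2r // lerXn2r ?nnegrE.
have h2 : c ^+ d * ((K * K.-1)%:R * (d%:R * N%:R ^+ K.-1 * t ^+ 4)) <= (K * K.-1 * d)%:R * u.
  rewrite [(K * K.-1 * d)%:R]natrM [leLHS](_ : _ =
    (K * K.-1)%:R * d%:R * (c ^+ d * N%:R ^+ K.-1 * t ^+ 4)); last by ring.
  by rewrite ler_wpM2l.
have h3 : x <= u.
  apply: le_trans xt _; rewrite /u mulrAC ler_peMr // mulr_ge0 //.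
apply: (@le_trans _ _ (u * (2 + K * K.-1 * d)%:R)).
  by rewrite natrD mulrDr; lra.
rewrite ler_wpM2l //.
have e : 2 * K%:R - 1 = (2 * K - 1)%:R :> R by rewrite natrB ?natrM // muln_gt0.
rewrite e -!natrX -natrM ler_nat.
have two : (2 <= 2 * K - 1)%N 
  by rewrite leq_subRL ?muln_gt0 //; apply: (@leq_trans (2 * 2)); rewrite ?leq_mul2l.
have dk : (d <= (2 * K - 1) ^ (2 * d * K))%N.
  apply: (@leq_trans (2 ^ d)); first by apply: ltnW; exact: ltn_expl.
  apply: (@leq_trans ((2 * K - 1) ^ d)); first by rewrite leq_exp2r.
  rewrite leq_pexp2l //; first exact: leq_trans two.
  by rewrite mulnAC leq_pmull // muln_gt0.
apply: (@leq_trans (K ^ 3 * d)); last by rewrite leq_mul2l dk orbT.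
have Kd : (2 <= K * d)%N by apply: leq_trans K1 _; rewrite leq_pmulr.
apply: (@leq_trans (K * d + K * K.-1 * d)); first by rewrite leq_add2r.
have -> : (K * d + K * K.-1 * d = K * K * d)%N.
  by rewrite -mulnDl -mulnS prednK.
by rewrite leq_mul2r !expnS expn0 muln1 leq_mul2l leq_pmulr // !orbT.
Qed.

End RealEstimates.

(** The estimate for one degree and one exponent, so that constants can first be found for each pair
    and merged afterwards. *)
Definition haar_bound (R : realType) (m n d K : nat) (C : R) : Prop :=
  forall (p : nat) (hnp : (n < p)%N) (hdvd : (n %| p)%N)
    (Q : ncpoly R m n) (hQd : ncdeg_le d Q)
    (hQ1 : forall b : {ffun 'I_m -> bool}, opnorm (nceval_sign Q b) <= 1)
    (tau : R) (htau : tau = max_influence Q) (htau0 : 0 < tau)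
    (cG : probability (borel_mx R n) R)
    (hG1 : mx_integrable cG (fun G => G))
    (hG1E : mx_mean cG (fun G => G) = 0)
    (hG2 : mx_integrable cG (fun G => G *m G^t*))
    (hG2E : mx_mean cG (fun G => G *m G^t*) = 1%:M)
    (cK : R) (hcK : 1 <= cK)
    (hGK : mx_integrable cG (fun G => (G *m G^t*) ^+ K))
    (hGKE : opnorm (mx_mean cG (fun G => (G *m G^t*) ^+ K)) <= cK)
    (disp : measure_display) (T : measurableType disp) (P : probability T R)
    (G : 'I_m -> {RV P >-> borel_mx R n})
    (H : 'I_m -> {RV P >-> borel_mx R p})
    (hG : forall (i : 'I_m) (A : set (borel_mx R n)), measurable A ->
       distribution P (G i) A = cG A)
    (hH : forall i : 'I_m, haar_unitary (distribution P (H i)))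
    (hind : mutually_independent P (fun k : 'I_m + 'I_m =>
       match k with
       | inl i => g_sigma_algebra_preimage (G i)
       | inr i => g_sigma_algebra_preimage (H i)
       end)),
  ('E_P[(fun w => n%:R^-1 * tr_abs_pow (2 * K)
          (nceval (ncpoly_iota p Q)
             (fun i => tens_idmx p (G i w) *m H i w)))%R]
   <= (sign_mean (fun b => n%:R^-1 * tr_abs_pow (2 * K) (nceval_sign Q b))
       + K%:R ^+ 3 * (2 * K%:R - 1) ^+ (2 * d * K) * cK ^+ d
         * n%:R ^+ (2 * K) * tau `^ (4^-1)
       + C * (p%:R `^ (- 2^-1) * K%:R ^+ 2 * tau `^ (- 4^-1)))%:E)%E.

(** * Choice of the constants *)

Section FinalBounds.
Context (R : realType) (m n : nat).
Hypotheses (hm : (0 < m)%N) (hn : (0 < n)%N).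
Local Notation SP := ({set 'I_m} * {set 'I_m})%type.
Local Notation card K := (#|{ffun 'I_K -> SP}|).

Let n1 : (1 : R) <= n%:R. Proof. by rewrite ler1n. Qed.

Lemma root4P (x : R) : 0 < x -> exists2 t, 0 < t &
  [/\ t ^+ 4 = x, x `^ 4^-1 = t, x `^ (- 4^-1) = t^-1 & Num.sqrt x = t ^+ 2].
Proof.
move=> x0; exists (x `^ 4^-1); first by rewrite powR_gt0.
have e : (x `^ 4^-1) ^+ 4 = x.
  by rewrite -powR_mulrn ?powR_ge0 // -powRrM mulVf ?powRr1 // ltW.
split => //; first by rewrite powRN.
by rewrite -{1}e (exprM _ 2 2) sqrtr_sqr ger0_norm // exprn_ge0 // powR_ge0.
Qed.

Lemma powR_inv_sqrt p : (p%:R : R) `^ (- 2^-1) = (Num.sqrt p%:R)^-1.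
Proof. by rewrite powRN powR12_sqrt. Qed.

Lemma card_set_ord : #|{: {set 'I_m}}| = (2 ^ m)%N.
Proof. by rewrite -cardsT -powersetT card_powerset cardsT card_ord. Qed.

Lemma card_pair_tuples K : card K = ((2 ^ m * 2 ^ m) ^ K)%N.
Proof. by rewrite card_ffun card_prod card_ord card_set_ord. Qed.

Lemma haar_bound_le d K (C C' : R) : C <= C' ->
  haar_bound m n d K C -> haar_bound m n d K C'.
Proof.
move=> CC' hb p hnp hdvd Q hQd hQ1 tau htau htau0 cG hG1 hG1E hG2 hG2E cK hcK hGK hGKE
  disp T P G H hG hH hind.
apply: le_trans (hb p hnp hdvd Q hQd hQ1 tau htau htau0 cG hG1 hG1E hG2 hG2E cK hcK hGK hGKE
  disp T P G H hG hH hind) _.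
rewrite lee_fin lerD2l ler_wpM2r // mulr_ge0 ?powR_ge0 // mulr_ge0 ?powR_ge0 // exprn_ge0 //.
Qed.

Lemma haar_bound_deg d K (C : R) : (0 < K)%N -> (m <= d)%N ->
  haar_bound m n m K C -> haar_bound m n d K C.
Proof.
move=> hK md hb p hnp hdvd Q hQd hQ1 tau htau htau0 cG hG1 hG1E hG2 hG2E cK hcK hGK hGKE
  disp T P G H hG hH hind.
have hQm : ncdeg_le m Q 
  by move=> S; rewrite ltnNge; have := max_card (mem S); rewrite card_ord => ->.
apply: le_trans (hb p hnp hdvd Q hQm hQ1 tau htau htau0 cG hG1 hG1E hG2 hG2E cK hcK hGK hGKE
  disp T P G H hG hH hind) _.
have K1 : (1 : R) <= K%:R by rewrite ler1n.
have k1 : 1 <= 2 * K%:R - 1 :> R by lra.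
have c0 : 0 <= cK by apply: le_trans hcK.
rewrite lee_fin lerD2r lerD2l ler_wpM2r ?powR_ge0 // ler_wpM2r ?exprn_ge0 //.
apply: ler_pM; rewrite ?mulr_ge0 ?exprn_ge0 //; first by apply: le_trans k1.
  rewrite ler_wpM2l ?exprn_ge0 // ler_weXn2l // leq_mul2r leq_mul2l md ?orbT //.
by rewrite ler_weXn2l.
Qed.

(** For such [K] the factor [(2 * K - 1) ^ (2 * d * K)] dominates the number of tuples, so the
    estimate term by term leaves no error in [p]. *)
Lemma haar_bound_large d K : (0 < d)%N -> (0 < K)%N -> (2 ^ m * n <= 2 * K - 1)%N ->
  haar_bound m n d K (0 : R).
Proof.
move=> hd hK large p hnp hdvd Q hQd hQ1 tau htau htau0 cG hG1 hG1E hG2 hG2E cK hcK hGK hGKE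
  disp T P G H hG hH hind.
have c0 : 0 <= cK by apply: le_trans hcK.
have [t t0 [t4 -> -> st]] := root4P htau0.
apply: le_trans (crude_conclusion hH hind hn hnp hdvd hG hK hcK hGK hGKE hQd hQ1) _.
rewrite -htau st lee_fin mul0r addr0 lerD2l card_pair_tuples.
have tn : t ^+ 4 <= n%:R by rewrite t4 htau; exact: max_influence_le.
have [tn1 _] := pow4_le_mul (ltW t0) n1 tn.
by apply: large_K_le => //; rewrite ?expn_gt0 // ltW.
Qed.

Lemma haar_bound_fixed d K : (0 < d)%N -> (0 < K)%N ->
  exists2 C : R, 0 <= C & haar_bound m n d K C.
Proof.
move=> hd hK.
have K1 : (1 : R) <= K%:R by rewrite ler1n.
pose A : R := (card K)%:R.
have A0 : 0 < A by rewrite ltr0n card_pair_tuples !expn_gt0 /= muln_gt0 !expn_gt0.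
pose B : R := K%:R * n%:R ^+ 2 * dist_cst R m n * A * n%:R ^+ K.
have dc0 : 0 < dist_cst R m n by rewrite mulr_gt0.
have n0 : 0 < n%:R :> R by apply: lt_le_trans n1.
have B0 : 0 < B.
  do 2![apply: mulr_gt0; last by rewrite ?exprn_gt0].
  by apply: mulr_gt0 => //; apply: mulr_gt0; rewrite ?exprn_gt0 ?ltr0n.
pose D : R := A * n%:R ^+ (K * d).
have D0 : 0 < D by apply: mulr_gt0 => //; rewrite exprn_gt0.
have BD0 : 0 < B * D * n%:R ^+ (K * d) 
  by apply: mulr_gt0; [exact: mulr_gt0|rewrite exprn_gt0].
(* Chosen so that [B * n%:R ^+ (K * d) * eps] is at most [D^-1], which is below [t] in the case
   [1 < D * t]. *)
pose eps : R := (1 + B * D * n%:R ^+ (K * d))^-1.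
have eps0 : 0 < eps by rewrite invr_gt0 addr_gt0.
have eps1 : eps <= 1 by rewrite invf_le1 ?addr_gt0 // lerDl ltW.
(* The first summand is the part of the moment bound free of [cK] when [1 < K]; the second is the
   moment bound for [K = 1]. *)
pose L : R := (1 + small_cst n K eps) ^+ (2 * K * d) + n%:R ^+ d.
have sc0 := small_cst_ge0 n K eps0.
have L0 : 0 <= L by rewrite addr_ge0 ?exprn_ge0 ?addr_ge0.
exists (B * L * n%:R); first by rewrite !mulr_ge0 // ltW.
move=> p hnp hdvd Q hQd hQ1 tau htau htau0 cG hG1 hG1E hG2 hG2E cK hcK hGK hGKE
  disp T P G H hG hH hind.
have c0 : 0 <= cK by apply: le_trans hcK.
have [t t0 [t4 -> -> st]] := root4P htau0; rewrite powR_inv_sqrt.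
have tn : t ^+ 4 <= n%:R by rewrite t4 htau; exact: max_influence_le.
have [tn1 _] := pow4_le_mul (ltW t0) n1 tn.
have sp1 : (1 : R) <= Num.sqrt p%:R 
  by rewrite -[leLHS]sqrtr1 ler_wsqrtr // ler1n (leq_ltn_trans _ hnp).
have sp0 : 0 < Num.sqrt p%:R :> R by apply: lt_le_trans sp1.
set x := sign_mean _.
have err0 : 0 <= B * L * n%:R * ((Num.sqrt p%:R)^-1 * K%:R ^+ 2 * t^-1).
  by rewrite !mulr_ge0 ?invr_ge0 ?exprn_ge0 // ltW.
(* Since [t <= n], the inverse fourth root of the influence in the error term costs only a factor
   [n]. *)
have errL : B * L / Num.sqrt p%:R <= B * L * n%:R * ((Num.sqrt p%:R)^-1 * K%:R ^+ 2 * t^-1).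
  have -> : B * L * n%:R * ((Num.sqrt p%:R)^-1 * K%:R ^+ 2 * t^-1) =
     B * L / Num.sqrt p%:R * (n%:R / t * K%:R ^+ 2) by ring.
  rewrite ler_peMr ?divr_ge0 ?mulr_ge0 ?(ltW B0) ?(ltW sp0) //.
  by rewrite -[leLHS]mulr1 ler_pM // ?exprn_ege1 // ler_pdivlMr // mul1r.
have coef0 : 0 <= K%:R ^+ 3 * (2 * K%:R - 1) ^+ (2 * d * K) * cK ^+ d * n%:R ^+ (2 * K) * t.
  by rewrite !mulr_ge0 ?exprn_ge0 ?(ltW t0) //; lra.
(* Small influence is settled term by term, whatever [p] is. Otherwise [t] is bounded below by
   [D^-1], a constant depending on [m], [n], [d], [K] only, and the replacement bound is used. *)
have [Dt|Dt] := leP (D * t) 1.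
  apply: le_trans (crude_conclusion hH hind hn hnp hdvd hG hK hcK hGK hGKE hQd hQ1) _.
  rewrite -htau st lee_fin -addrA lerD2l -[leLHS]addr0 lerD //.
  by apply: small_t_le => //; rewrite // ltW.
have [K2|K2] := ltnP 1 K.
  pose M := eps * (n%:R ^+ K * cK) ^+ d + (1 + small_cst n K eps) ^+ (2 * K * d).
  have M0 : 0 <= M.
    apply: addr_ge0; last by rewrite exprn_ge0 ?addr_ge0.
    by apply: mulr_ge0; [exact: ltW|rewrite exprn_ge0 // mulr_ge0 // exprn_ge0].
  apply: le_trans (master_conclusion hH hind hn hnp hdvd hG hG2 hG2E hK hcK hGK hGKE hQd hQ1 M0
    (fun f => @diag_bound _ _ _ _ _ _ _ _ _ hind hn _ hG hG2 hG2E _ _ hK hcK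
      hGK hGKE _ eps f K2 eps0 eps1)) _.
  rewrite K2 lee_fin -[leRHS]addrA lerD2l -htau.
  have -> : K%:R * n%:R ^+ 2 * (dist_cst R m n / Num.sqrt p%:R) * ((card K)%:R * (n%:R ^+ K * M)) =
     B * M / Num.sqrt p%:R by rewrite /B /A; ring.
  apply: (@le_trans _ _ (cK ^+ d * (n%:R * tau ^+ K.-1) +
     cK ^+ d * ((K * K.-1)%:R * (d%:R * n%:R ^+ K.-1 * tau)) + cK ^+ d * t
     + B * L / Num.sqrt p%:R)); last first.
    by apply: lerD => //; rewrite -t4; apply: main_terms_le => //; exact: ltW.
  rewrite -[leRHS]addrA lerD2l.
  (* The part of the error that contains [cK] gives up its decay in [p] and is counted among the
     main terms. *)
  apply: (@le_trans _ _ ((cK ^+ d * t + B * L) / Num.sqrt p%:R)); last first.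
    have ct0 : 0 <= cK ^+ d * t by apply: mulr_ge0; [exact: exprn_ge0|exact: ltW].
    by rewrite mulrDl lerD2r ler_pdivrMr // ler_peMr.
  rewrite ler_wpM2r ?invr_ge0 ?(ltW sp0) //.
  rewrite /M mulrDr lerD //; last first.
    by rewrite ler_wpM2l ?(ltW B0) // /L lerDl exprn_ge0.
  rewrite exprMn -exprM.
  have -> : B * (eps * (n%:R ^+ (K * d) * cK ^+ d)) = cK ^+ d * (B * n%:R ^+ (K * d) * eps) by ring.
  rewrite ler_wpM2l ?exprn_ge0 //; apply: (@le_trans _ _ D^-1).
    rewrite /eps ler_pdivrMr ?addr_gt0 // -(ler_pM2l D0) [leRHS]mulrA mulfV ?gt_eqF // mul1r.
    by rewrite mulrA [D * B]mulrC lerDr.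
  by rewrite -[D^-1]mul1r ler_pdivrMr // mulrC ltW.
(* Here the moment matrix is the identity, so the bound is run with constant 1 instead of [cK], and
   the collision and diagonal terms are 0. *)
have K1E : K = 1%N by apply/eqP; rewrite eqn_leq K2 hK.
have hGK' : opnorm (mx_mean cG (fun G => (G *m G^t*) ^+ K)) <= 1.
  have -> : (fun G : borel_mx R n => (G *m G^t*) ^+ K) = (fun G => G *m G^t*).
    by apply/funext => y; rewrite K1E expr1.
  by rewrite hG2E opnorm_1.
have M0 : 0 <= (n%:R ^+ K * 1) ^+ d :> R by rewrite exprn_ge0 // mulr_ge0 ?exprn_ge0.
apply: le_trans (master_conclusion hH hind hn hnp hdvd hG hG2 hG2E hK (lexx 1)
  hGK hGK' hQd hQ1 M0 _) _.
  by move=> f _; exact: (Ex_pprod_le hind hn hG hK (lexx 1) hGK hGK').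
rewrite ltnNge K2 /= lee_fin -[leRHS]addrA lerD2l.
have -> : (K * K.-1)%:R = 0 :> R by rewrite K1E.
rewrite mul0r mulr0 !add0r -[leLHS]add0r lerD //; apply: le_trans errL.
have -> : K%:R * n%:R ^+ 2 * (dist_cst R m n / Num.sqrt p%:R) *
   ((card K)%:R * (n%:R ^+ K * (n%:R ^+ K * 1) ^+ d)) =
     B * (n%:R ^+ K * 1) ^+ d / Num.sqrt p%:R by rewrite /B /A; ring.
rewrite ler_wpM2r ?invr_ge0 ?(ltW sp0) // ler_wpM2l ?(ltW B0) //.
have -> : n%:R ^+ K * 1 = n%:R :> R by rewrite K1E expr1 mulr1.
by rewrite /L lerDr exprn_ge0 // addr_ge0.
Qed.

(** Only the degrees up to [m] and finitely many exponents need a positive constant, so a finite sum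
    of the constants found for each pair serves for all. *)
Lemma haar_bound_uniform : exists2 C : R, 0 < C &
  forall d K, (0 < d)%N -> (0 < K)%N -> haar_bound m n d K C.
Proof.
have hb d K : exists C : R, 0 <= C /\ ((0 < d)%N -> (0 < K)%N -> haar_bound m n d K C).
  have [d0|d0] := posnP d; first by exists 0; split => //; rewrite d0.
  have [K0|K0] := posnP K; first by exists 0; split => //; rewrite K0.
  by have [C C0 h] := haar_bound_fixed d0 K0; exists C.
pose Cf d K : R := projT1 (cid (hb d K)).
have Cf0 d K : 0 <= Cf d K by exact: (projT2 (cid (hb d K))).1.
have Cfb d K : (0 < d)%N -> (0 < K)%N -> haar_bound m n d K (Cf d K).
  exact: (projT2 (cid (hb d K))).2.
(* From this exponent on [haar_bound_large] applies with error constant 0. *)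
pose K1 := (2 ^ m * n).+1.
pose C := 1 + \sum_(d < m.+1) \sum_(K < K1) Cf d K.
have s0 : 0 <= \sum_(d < m.+1) \sum_(K < K1) Cf d K.
  by apply: sumr_ge0 => d _; apply: sumr_ge0.
exists C; first by rewrite ltr_pwDl.
move=> d K d0 K0; have [KK|KK] := leqP K1 K.
  apply: (@haar_bound_le _ _ 0); first by rewrite addr_ge0.
  apply: haar_bound_large => //; rewrite -ltnS subn1 prednK ?muln_gt0 //.
  by apply: leq_trans KK _; rewrite leq_pmull.
have bdd d' : (0 < d')%N -> (d' < m.+1)%N -> haar_bound m n d' K C.
  move=> d'0 dm; apply: (haar_bound_le _ (Cfb d' K d'0 K0)).
  apply: (@le_trans _ _ (\sum_(d < m.+1) \sum_(K < K1) Cf d K)); last by rewrite lerDr.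
  have nn (e : 'I_m.+1) : 0 <= \sum_(K < K1) Cf e K by apply: sumr_ge0.
  apply: le_trans (ler_sum_term (i := Ordinal dm) (P := predT) isT nn).
  exact: (ler_sum_term (i := Ordinal KK) (P := predT) (F := fun k : 'I_K1 => Cf d' k)).
have [dm|dm] := leqP d m; first by apply: bdd; rewrite // ltnS.
by apply: (haar_bound_deg K0 (ltnW dm)); apply: bdd.
Qed.

End FinalBounds.

Theorem theorem3p9 (R : realType) (m n : nat) (hm : (0 < m)%N)
    (hn : (0 < n)%N) :
  exists2 C : R, 0 < C &
  forall (d K p : nat) (hd : (0 < d)%N) (hK : (0 < K)%N)
    (hnp : (n < p)%N) (hdvd : (n %| p)%N)
    (Q : ncpoly R m n) (hQd : ncdeg_le d Q)
    (hQ1 : forall b : {ffun 'I_m -> bool}, opnorm (nceval_sign Q b) <= 1)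
    (tau : R) (htau : tau = max_influence Q) (htau0 : 0 < tau)
    (cG : probability (borel_mx R n) R)
    (hG1 : mx_integrable cG (fun G => G))
    (hG1E : mx_mean cG (fun G => G) = 0)
    (hG2 : mx_integrable cG (fun G => G *m G^t*))
    (hG2E : mx_mean cG (fun G => G *m G^t*) = 1%:M)
    (cK : R) (hcK : 1 <= cK)
    (hGK : mx_integrable cG (fun G => (G *m G^t*) ^+ K))
    (hGKE : opnorm (mx_mean cG (fun G => (G *m G^t*) ^+ K)) <= cK)
    (disp : measure_display) (T : measurableType disp) (P : probability T R)
    (G : 'I_m -> {RV P >-> borel_mx R n})
    (H : 'I_m -> {RV P >-> borel_mx R p})
    (hG : forall (i : 'I_m) (A : set (borel_mx R n)), measurable A ->
       distribution P (G i) A = cG A)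
    (hH : forall i : 'I_m, haar_unitary (distribution P (H i)))
    (hind : mutually_independent P (fun k : 'I_m + 'I_m =>
       match k with
       | inl i => g_sigma_algebra_preimage (G i)
       | inr i => g_sigma_algebra_preimage (H i)
       end)),
  ('E_P[(fun w => n%:R^-1 * tr_abs_pow (2 * K)
          (nceval (ncpoly_iota p Q)
             (fun i => tens_idmx p (G i w) *m H i w)))%R]
   <= (sign_mean (fun b => n%:R^-1 * tr_abs_pow (2 * K) (nceval_sign Q b))
       + K%:R ^+ 3 * (2 * K%:R - 1) ^+ (2 * d * K) * cK ^+ d
         * n%:R ^+ (2 * K) * tau `^ (4^-1)
       + C * (p%:R `^ (- 2^-1) * K%:R ^+ 2 * tau `^ (- 4^-1)))%:E)%E.
Proof.
have [C C0 hC] := haar_bound_uniform R hm hn; exists C => // d K p hd hK.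
exact: hC.
Qed.
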